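(* Let $1\le l\le m$, let $\mathcal T$ be an $m$-linear operator, let $\vec b=(b_1,\dots,b_l)\in \mathrm{BMO}(\mathbb R^n)^l$, and suppose that the iterated commutator $\mathcal T_{\vec b}$ satisfies the sparse domination hypothesis (SD) of the context. Then for any $0<p<\infty$ and $w\in A_\infty$ (and bounded compactly supported $f_1,\dots,f_m$), $$\int_{\mathbb R^n}|\mathcal T_{\vec b}(\vec f)(x)|^pw(x)\,dx\lesssim \prod_{s=1}^l\|b_s\|_{\mathrm{BMO}}\;[w]_{A_\infty}^{pl}\,[w]_{A_\infty}^{\max\{2,p\}}\int_{\mathbb R^n}\big(\mathcal M_{L(\log L)}(\vec f)(x)\big)^pw(x)\,dx .$$
   Context: $A\lesssim B$ means $A\le C'B$ with a positive constant $C'$ independent of the main parameters. Cubes have sides parallel to the axes. $\langle g\rangle_Q=\frac1{|Q|}\int_Q g$. $\|b\|_{\mathrm{BMO}}=\sup_Q\langle|b-\langle b\rangle_Q|\rangle_Q$. $A_\infty=\bigcup_{p>1}A_p$ (Muckenhoupt classes) and $[w]_{A_\infty}=\sup_Q\frac1{w(Q)}\int_QM(w\chi_Q)$ with $M$ the Hardy–Littlewood maximal operator over cubes. Iterated commutator. For an $m$-linear operator $\mathcal T$ acting on (suitable) functions on $\mathbb R^n$, and $\vec b=(b_1,\dots,b_l)$, set $[\mathcal T,\vec b]_{e_i}(\vec f)(x)=b_i(x)\mathcal T(f_1,\dots,f_m)(x)-\mathcal T(f_1,\dots,b_if_i,\dots,f_m)(x)$ and $\mathcal T_{\vec b}=[\cdots[[\mathcal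 T,\vec b]_{e_1},\vec b]_{e_2}\cdots,\vec b]_{e_l}$. Dyadic lattice: a collection $\mathcal D$ of cubes such that (i) if $Q\in\mathcal D$ then all dyadic descendants of $Q$ are in $\mathcal D$; (ii) any two $Q_1,Q_2\in\mathcal D$ have a common ancestor in $\mathcal D$; (iii) every compact set is contained in some $Q\in\mathcal D$. A subfamily $\mathcal S$ of a dyadic lattice is $\eta$-sparse, $\eta\in(0,1)$, if $|\bigcup_{P\in\mathcal S,P\subsetneq Q}P|\le(1-\eta)|Q|$ for all $Q\in\mathcal S$. Hypothesis (SD). There are constants $C>0$, $\eta\in(0,1)$ such that for all bounded compactly supported $f_1,\dots,f_m$ there are $3^n$ $\eta$-sparse families $\mathcal S_1,\dots,\mathcal S_{3^n}$ (each in a dyadic lattice) with, for a.e. $x\in\mathbb R^n$, $$|\mathcal T_{\vec b}(\vec f)(x)|\le C\sum_{j=1}^{3^n}\sum_{\vec\gamma\in\{1,2\}^l}\sum_{Q\in\mathcal S_j}\Big(\prod_{s=1}^l\mathcal U(b_s,f_s,Q,\gamma_s)(x)\Big)\Big(\prod_{s=l+1}^m\langle|f_s|\rangle_Q\Big)\chi_Q(x),$$ where $\mathcal U(b,f,Q,1)(x)=|b(x)-\langle b\rangle_Q|\langle|f|\rangle_Q$ and $\mathcal U(b,f,Q,2)(x)=\langle|(b-\langle b\rangle_Q)f|\rangle_Q$. Maximal function. $\|f\|_{L(\log L),Q}=\inf\{\lambda>0:\frac1{|Q|}\int_Q\phi(|f|/\lambda)\le1\}$ with $\phi(t)=t\log(e+t)$;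 $\mathcal M_{L(\log L)}(\vec f)(x)=\sup_{Q\ni x}\prod_{i=1}^m\|f_i\|_{L(\log L),Q}$.
   Formalization: The printed first power of ∏‖b_s‖_BMO fails by scaling b when p≠1 with a constant independent of b; it is replaced by ∏‖b_s‖_BMO^p with a uniform constant, and the printed form is also proved with a constant that may depend on T and b. *)

(* Defs.v *)
From HB Require Import structures.
From mathcomp Require Import all_boot all_order all_algebra.
From mathcomp Require Import all_classical all_reals all_analysis.

Set Implicit Arguments.
Unset Strict Implicit.
Unset Printing Implicit Defensive.
Import Order.TTheory GRing.Theory Num.Theory numFieldNormedType.Exports.
Local Open Scope classical_set_scope.
Local Open Scope ring_scope.
Local Open Scope ereal_scope.

Lemma measurable_prod_set (R : realType) n (A : 'I_n -> set R) :
  (forall i, measurable (A i)) ->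
  measurable [set x : n.-tuple R | forall i, A i (tnth x i)].
Proof.
move=> mA.
rewrite (_ : mkset _ = \bigcap_(i in setT) ((@tnth n R)^~ i @^-1` A i)).
  apply: fin_bigcap_measurable => // i _; rewrite -[X in measurable X]setTI.
  exact: measurable_tnth.
by apply/seteqP; split => x /= h i; [move=> _|]; exact: h.
Qed.

Section lebesgue_step.
Context (R : realType) (n : nat).
Variable mu : {sigma_finite_measure set (n.-tuple R) -> \bar R}.

Definition rv_cons (x : measurableTypeR R * n.-tuple R) : n.+1.-tuple R :=
  [the n.+1.-tuple R of (x.1 : R) :: x.2].

Lemma measurable_rv_cons : measurable_fun setT rv_cons.
Proof.
apply: (@measurable_cons _ _ (measurableTypeR R * n.-tuple R)%type R
  (fst : _ -> R)) => //.
Qed.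

Definition lebesgue_step : set (n.+1.-tuple R) -> \bar R :=
  pushforward ((@lebesgue_measure R) \x mu) rv_cons.

HB.instance Definition _ := Measure.copy lebesgue_step
  (measure_function_pushforward__canonical__measure_function_Measure
     ((@lebesgue_measure R) \x mu) measurable_rv_cons).

Let lebesgue_step_sigma_finite : sigma_finite setT lebesgue_step.
Proof.
have /sigma_finiteP[F [TF ndF Foo]] := sigma_finiteT (@lebesgue_measure R).
have /sigma_finiteP[G [TG ndG Goo]] := sigma_finiteT mu.
pose g1 (x : n.+1.-tuple R) : measurableTypeR R := tnth x ord0.
pose g2 (x : n.+1.-tuple R) : n.-tuple R := [tuple of behead x].
have mg1 : measurable_fun setT g1 by exact: (@measurable_tnth _ R n.+1 ord0).
have mg2 : measurable_fun setT g2 by exact: measurable_behead.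
exists (fun i => g1 @^-1` F i `&` g2 @^-1` G i) => [|i].
  apply/esym; rewrite -subTset => x _.
  have [i _ Fi] : (\bigcup_i F i) (g1 x) by rewrite -TF.
  have [j _ Gj] : (\bigcup_i G i) (g2 x) by rewrite -TG.
  exists (maxn i j) => //; split.
  - by move/subsetPset : (ndF _ _ (leq_maxl i j)); exact.
  - by move/subsetPset : (ndG _ _ (leq_maxr i j)); exact.
have [mF Fi] := Foo i; have [mG Gi] := Goo i; split.
  by apply: measurableI; rewrite -[X in measurable X]setTI; [exact: mg1|exact: mg2].
rewrite /lebesgue_step /pushforward.
have g2K z : g2 (rv_cons z) = z.2 by apply/val_inj.
rewrite (_ : rv_cons @^-1` _ = F i `*` G i); last first.
  by apply/seteqP; split => z; rewrite /preimage /= g2K /g1 tnth0.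
by rewrite product_measure1E// lte_mul_pinfty// ge0_fin_numE.
Qed.

HB.instance Definition _ := Measure_isSigmaFinite.Build _ _ _ lebesgue_step
  lebesgue_step_sigma_finite.

End lebesgue_step.

(* n-dimensional Lebesgue measure on the Borel sets of R^n, as an iterated
   product of lebesgue_measure; lebesgue_box below gives its value on boxes. *)
Fixpoint lebesgue (R : realType) (n : nat) :
    {sigma_finite_measure set (n.-tuple R) -> \bar R} :=
  match n with
  | 0 => (dirac [tuple] : {sigma_finite_measure set (0.-tuple R) -> \bar R})
  | n'.+1 => (lebesgue_step (lebesgue R n')
     : {sigma_finite_measure set (n'.+1.-tuple R) -> \bar R})
  end.


Lemma lebesgue_prod_set (R : realType) n (A : 'I_n -> set R) :
  (forall i, measurable (A i)) ->
  lebesgue R n [set x | forall i, A i (tnth x i)] =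
  \prod_(i < n) lebesgue_measure (A i : set (measurableTypeR R)).
Proof.
elim: n A => [|n IH] A mA.
  by rewrite big_ord0 /= diracE mem_set//= => -[].
rewrite big_ord_recl -(IH (A \o lift ord0)) => [|i]; last exact: mA.
rewrite -[RHS]product_measure1E//; last 2 first.
- exact: mA.
- by apply: measurable_prod_set => i; exact: mA.
rewrite /= /lebesgue_step /pushforward.
congr (product_measure1 _ _ _); apply/seteqP; split => -[x y] /= h.
  by split=> [|i]; [have := h ord0; rewrite tnth0|
    have := h (lift ord0 i); rewrite tnthS].
by move=> i; have [j ->|->] := unliftP ord0 i; rewrite ?tnthS ?tnth0;
  [apply: h.2|apply: h.1].
Qed.

Lemma lebesgue_box (R : realType) n (a b : 'I_n -> R) :
  (forall i, a i <= b i)%R ->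
  lebesgue R n [set x | forall i, (a i <= tnth x i < b i)%R] =
  (\prod_(i < n) (b i - a i))%:E.
Proof.
move=> ab; have := @lebesgue_prod_set R n (fun i => `[a i, b i[%classic).
rewrite (_ : mkset _ = [set x | forall i, (a i <= tnth x i < b i)%R]); last first.
  by apply/seteqP; split => x /= h i; move: (h i); rewrite in_itv.
move=> -> //; rewrite -prodEFin; apply: eq_bigr => i _.
rewrite lebesgue_measure_itv /= lte_fin; case: ltP => // ba.
by rewrite (@le_anti _ _ (a i) (b i)) ?ba ?ab// subrr.
Qed.

Section analysis_on_Rn.
Context (R : realType) (n : nat).
Local Notation V := (n.-tuple R).
Local Notation mu := (lebesgue R n).
Implicit Types (Q P K : set V) (b f w : V -> R).

(* The library has a topology on row vectors but none on tuples. *)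
Definition compact_in K := compact ((fun x : V => \row_i tnth x i) @` K).

Definition bounded_compactly_supported : set (V -> R) := [set f : V -> R |
  [/\ measurable_fun setT f,
      exists M : R, forall x, (`|f x| <= M)%R
    & exists2 K, compact_in K & forall x, ~ K x -> f x = 0%R]].

(* Cubes are half-open, so that the dyadic children of a cube partition it;
   families of cubes are sets of point sets. *)
Definition cube (a : 'I_n -> R) (h : R) : set V :=
  [set x | forall i, (a i <= tnth x i < a i + h)%R].

Definition is_cube : set (set V) :=
  [set Q | exists a, exists2 h : R, (0 < h)%R & Q = cube a h].

(* Descendants of generation k, for every k : nat; Q is its own descendant of
   generation 0. *)
Definition dyadic_descendant Q P := exists (a : 'I_n -> R) (h : R) (k : nat)
    (z : 'I_n -> nat),
  [/\ (0 < h)%R, Q = cube a h, forall i, (z i < 2 ^ k)%N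
    & P = cube (fun i => a i + (z i)%:R * (h / 2 ^+ k))%R (h / 2 ^+ k)%R].

Definition dyadic_lattice (D : set (set V)) := [/\ D `<=` is_cube,
  forall Q P, D Q -> dyadic_descendant Q P -> D P,
  forall Q1 Q2, D Q1 -> D Q2 -> exists Q,
    [/\ D Q, dyadic_descendant Q Q1 & dyadic_descendant Q Q2]
  & forall K, compact_in K -> exists2 Q, D Q & K `<=` Q].

Definition sparse (eta : R) (S : set (set V)) :=
  (exists2 D, dyadic_lattice D & S `<=` D) /\
  forall Q, S Q ->
    mu (\bigcup_(P in [set P | S P /\ P `<` Q]) P) <= (1 - eta)%:E * mu Q.

Definition avg Q (g : V -> \bar R) : \bar R := (\int[mu]_(x in Q) g x) / mu Q.

Definition mean b Q : R := fine (avg Q (EFin \o b)).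

Definition loc_integrable b := measurable_fun setT b /\
  forall Q, is_cube Q -> mu.-integrable Q (EFin \o b).

Definition BMO_norm b : \bar R :=
  ereal_sup [set avg Q (fun x => `|b x - mean b Q|%:E) | Q in is_cube].

Definition BMO b := loc_integrable b /\ BMO_norm b < +oo.

Definition HL_max_cubes (g : V -> R) (x : V) : \bar R :=
  ereal_sup [set avg Q (fun y => `|g y|%:E)
            | Q in [set Q | is_cube Q /\ Q x]].

Definition weight w := [/\ loc_integrable w, forall x, (0 <= w x)%R
  & {ae mu, forall x, (0 < w x)%R}].

Definition Ap_const (q : R) w : \bar R :=
  ereal_sup [set avg Q (fun x => (w x)%:E) *
                 avg Q (fun x => (w x `^ (1 - q / (q - 1)))%:E) `^ (q - 1)
            | Q in is_cube].

Definition Ainfty w :=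
  weight w /\ exists2 q : R, (1 < q)%R & Ap_const q w < +oo.

Definition Ainfty_const w : \bar R :=
  ereal_sup [set (\int[mu]_(x in Q) HL_max_cubes (fun y => w y * \1_Q y)%R x) /
                 (\int[mu]_(x in Q) (w x)%:E)
            | Q in is_cube].

Definition LlogL_norm f Q : \bar R :=
  let phi (t : R) : R := (t * ln (expR 1 + t))%R in
  ereal_inf [set lam%:E | lam in [set lam : R |
    (0 < lam)%R /\ avg Q (fun x => (phi (`|f x| / lam)%R)%:E) <= 1]].

Definition LlogL_max m (f : 'I_m -> V -> R) (x : V) : \bar R :=
  ereal_sup [set \prod_(i < m) LlogL_norm (f i) Q
            | Q in [set Q | is_cube Q /\ Q x]].

End analysis_on_Rn.

Section multilinear_operators.
Context (R : realType) (n m : nat).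
Local Notation V := (n.-tuple R).
Local Notation mu := (lebesgue R n).
Implicit Types (D : 'I_m -> set (V -> R)) (f : 'I_m -> V -> R).
Implicit Types T : ('I_m -> V -> R) -> V -> R.

Definition upd f (i : 'I_m) (g : V -> R) : 'I_m -> V -> R :=
  fun j => if j == i then g else f j.

(* D i is the linear space of functions accepted in slot i; outside of D the
   values of T carry no meaning. Functions are only identified a.e. *)
Definition multilinear_on D T :=
  [/\ forall i u, D i u -> measurable_fun setT u,
      forall i (a : R) u v, D i u -> D i v -> D i (a \*o u \+ v)%R,
      forall f, (forall j, D j (f j)) -> measurable_fun setT (T f)
    & forall i (a : R) f u v, (forall j, D j (f j)) -> D i u -> D i v ->
        {ae mu, forall x, T (upd f i (a \*o u \+ v)%R) x =
                          (a * T (upd f i u) x + T (upd f i v) x)%R}].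

Definition commutator (i : 'I_m) (c : V -> R) T :
    ('I_m -> V -> R) -> V -> R :=
  fun f x => (c x * T f x - T (upd f i (c \* f i)) x)%R.

Section iterated.
Context (l : nat) (lm : (l <= m)%N).
Implicit Type b : 'I_l -> V -> R.
Local Notation slot := (widen_ord lm).

Definition iterated_commutator b T : ('I_m -> V -> R) -> V -> R :=
  foldl (fun U s => commutator (slot s) (b s) U) T (enum 'I_l).

(* Membership in D of every function on which the iterated commutator evaluates
   T, when applied to bounded compactly supported functions. *)
Definition suitable_domain D b :=
  (forall i, @bounded_compactly_supported R n `<=` D i) /\
  (forall s u, @bounded_compactly_supported R n u -> D (slot s) (b s \* u)%R).

(* first = true stands for gamma = 1 and first = false for gamma = 2. *)
Definition sparse_factor (c g : V -> R) (Q : set V) (first : bool) (x : V)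
    : \bar R :=
  if first then `|c x - mean c Q|%:E * avg Q (fun y => `|g y|%:E)
  else avg Q (fun y => `|(c y - mean c Q) * g y|%:E).

Definition sparse_domination (C eta : R) b (U : ('I_m -> V -> R) -> V -> R) :=
  forall f, (forall i, bounded_compactly_supported (f i)) ->
  exists S : 'I_(3 ^ n) -> set (set V), (forall j, sparse eta (S j)) /\
    {ae mu, forall x, `|U f x|%:E <=
      C%:E * \sum_(j < 3 ^ n) \sum_(g : {ffun 'I_l -> bool})
        \esum_(Q in S j)
          ((\prod_(s < l) sparse_factor (b s) (f (slot s)) Q (g s) x) *
           (\prod_(i < m | (l <= i)%N) avg Q (fun y => `|f i y|%:E)) *
           (\1_Q x)%:E)}.

End iterated.
End multilinear_operators.

(* Main.v *)
Require Import Defs.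
From HB Require Import structures.
From mathcomp Require Import all_boot all_order all_algebra.
From mathcomp Require Import all_classical all_reals all_analysis.
From mathcomp Require Import measurable_realfun measurable_fun_approximation simple_functions.
From mathcomp Require Import ring lra.
Set Implicit Arguments.
Unset Strict Implicit.
Unset Printing Implicit Defensive.
Import Order.TTheory GRing.Theory Num.Theory numFieldNormedType.Exports.
Local Open Scope classical_set_scope.
Local Open Scope ring_scope.
Local Open Scope ereal_scope.

(* A sparse family is handled through finite subfamilies, which live in the
   dyadic tree of one cube, where all packing arguments are finite.

   Sparseness and the bound int_P M(w 1_P) <= [w] w(P) yield the Carleson packing
   sum_(P' in S, P' subset P) w(P') <= ([w] / eta) w(P). Carleson packing bounds
   the moments of sum_P 1_P B_P, by telescoping and Jensen's inequality.

   The Calderon-Zygmund stopping cubes of b in Q form a 1/2-sparse family, and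
   |b - <b>_Q| <= c |b|_BMO N_Q a.e. on Q, where N_Q counts the stopping cubes
   containing a point. So N_Q is exponentially integrable, hence by Young's
   inequality <|(b - <b>_Q) f|>_Q <= c |b|_BMO |f|_{LlogL,Q}, and its moments of
   order k for w dx are at most c_k [w]^k w(Q). This reduces the sparse operator to
   the sum over Q of 1_Q lambda_Q N_{1,Q} ... N_{l,Q}, where lambda_Q is the product
   of the norms |f_i|_{LlogL,Q}.

   The cubes are then sorted by the dyadic size of lambda_Q. For k > p the k-th
   moment of the sum over one size class is controlled by the w-measure of the
   union of the class, and summing the geometric series over the sizes bounds the
   L^p(w) norm by [w]^(l+1) |M_LlogL f|_{L^p(w)}. Since [w] >= 1, the power
   [w]^(p(l+1)) is at most [w]^(pl) [w]^max(2,p). *)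

(** Counting stopping cubes shapes the proof: the stopping family depends on [b] and the cube but
    not on a measure, and its sparseness yields packing for every measure with a maximal bound. One
    counting function thus serves both [dx], where it is paired with [f], and [w dx], where it is
    integrated.

    The exponent [l + 1] has two origins. A product of [l] counts is at most the sum of their [l]-th
    powers, whose [k]-th moments cost [[w]^(lk)]; packing of the sparse family costs another
    [[w]^k]. Taking the [k]-th root leaves [[w]^(l+1)].

    Maximal functions are handled as arbitrary nonnegative functions, so the estimates are between
    lower integrals, with measurable finite sums inserted between the two sides. *)

(** * Lower integrals and monotone convergence *)

Section lower_integral.
Context d (T : measurableType d) (R : realType).
Variable mu : {measure set T -> \bar R}.
Implicit Types (D : set T) (f g : T -> \bar R).

(* No measurability is assumed: the integral of a nonnegative function is its
   lower integral. *)
Lemma le_lower_integral D f g : (forall x, D x -> 0 <= f x) ->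
  (forall x, D x -> f x <= g x) ->
  \int[mu]_(x in D) f x <= \int[mu]_(x in D) g x.
Proof.
move=> f0 fg.
have g0 x : D x -> 0 <= g x by move=> Dx; exact: le_trans (f0 _ Dx) (fg _ Dx).
rewrite !ge0_integralE//; apply: ge_ereal_sup => _ [h /= hf <-].
apply: ereal_sup_ubound; exists h => //= x; apply: le_trans (hf x) _.
by apply: lee_restrict.
Qed.

(** Only [g] is measurable. Raising [g] to [+oo] on the exceptional null set makes the bound hold
    everywhere and leaves its integral unchanged. *)
Lemma ae_lower_integral_le D f g : measurable D -> measurable_fun D g ->
  (forall x, D x -> 0 <= f x) -> (forall x, D x -> 0 <= g x) ->
  {ae mu, forall x, D x -> f x <= g x} ->
  \int[mu]_(x in D) f x <= \int[mu]_(x in D) g x.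
Proof.
move=> mD mg f0 g0 [N [mN N0 fgN]].
pose g' x := if x \in N then +oo else g x.
have mg' : measurable_fun D g'.
  apply: measurable_fun_if => //.
    apply: (measurable_fun_bool true) => //.
    rewrite (_ : _ @^-1` _ = N); first exact: measurableI.
    by apply/seteqP; split => [x h|x h]; [exact: set_mem|exact: mem_set].
  by apply: measurable_funS mg => // x [].
have -> : \int[mu]_(x in D) g x = \int[mu]_(x in D) g' x.
  apply: ge0_ae_eq_integral => //.
    by move=> x Dx; rewrite /g'; case: ifP => // _; exact: g0.
  exists N; split => // x /=; apply: contra_notP => xN Dx.
  by rewrite /g' memNset.
apply: le_lower_integral => // x Dx; rewrite /g'; case: ifPn => [_|/negP xN].
  exact: leey.
by apply: contra_notP xN => fg; rewrite inE; apply: fgN => /= /(_ Dx).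
Qed.

(** Carries uniform bounds on measurable truncations [G L] over to a function known only to lie a.e.
    below their supremum; monotone convergence is applied to the truncations. *)
Lemma ae_le_sup_integral D f (G : nat -> T -> \bar R) C : measurable D ->
  (forall L, measurable_fun D (G L)) ->
  (forall L x, D x -> 0 <= G L x) ->
  (forall x, D x -> {homo G ^~ x : a b / (a <= b)%N >-> a <= b}) ->
  (forall x, D x -> 0 <= f x) ->
  {ae mu, forall x, D x -> f x <= ereal_sup (range (G ^~ x))} ->
  (forall L, \int[mu]_(x in D) G L x <= C) ->
  \int[mu]_(x in D) f x <= C.
Proof.
move=> mD mG G0 ndG f0 fG GC.
have limG x : D x -> limn (G ^~ x) = ereal_sup (range (G ^~ x)).
  move=> Dx; apply/cvg_lim => //; apply: ereal_nondecreasing_cvgn.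
  exact: ndG.
apply: (@le_trans _ _ (\int[mu]_(x in D) limn (G ^~ x))).
  apply: ae_lower_integral_le => //.
  - apply: (emeasurable_fun_cvg G) => //= x Dx.
    by apply: ereal_nondecreasing_is_cvgn; exact: ndG.
  - move=> x Dx; rewrite limG//; apply: le_trans (G0 0%N _ Dx) _.
    by apply: ereal_sup_ubound; exists 0%N.
  - by apply: filterS fG => x + Dx => /(_ Dx); rewrite limG.
rewrite monotone_convergence//.
apply: lime_le.
  apply: ereal_nondecreasing_is_cvgn => a b ab; apply: ge0_le_integral => //.
    by move=> x Dx; exact: G0.
  by move=> x Dx; exact: ndG.
exact: nearW.
Qed.

End lower_integral.

(** * The measure with density [w] *)

Section weighted_measure.
Context d (T : measurableType d) (R : realType).
Variable mu : {measure set T -> \bar R}.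
Variable w : T -> R.
Hypothesis mw : measurable_fun [set: T] w.
Hypothesis w0 : forall x, (0 <= w x)%R.

Definition wmeas (A : set T) : \bar R := \int[mu]_(x in A) (w x)%:E.

Let wmeas0 : wmeas set0 = 0.
Proof. by rewrite /wmeas integral_set0. Qed.

Let wmeas_ge0 A : 0 <= wmeas A.
Proof. by apply: integral_ge0 => x _; rewrite lee_fin. Qed.

Let wmeas_semi_sigma_additive : semi_sigma_additive wmeas.
Proof.
move=> F mF tF mUF; rewrite /wmeas ge0_integral_bigcup//; last 2 first.
  by apply/measurable_EFinP; exact: measurable_funTS.
  by move=> x _; rewrite lee_fin.
by apply: is_cvg_nneseries => i _ _; exact: wmeas_ge0.
Qed.

Definition wmeasure : {measure set T -> \bar R} :=
  HB.pack wmeas (isMeasure.Build d T R wmeas wmeas0 wmeas_ge0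
    wmeas_semi_sigma_additive).

Lemma wmeasureE A : wmeasure A = \int[mu]_(x in A) (w x)%:E.
Proof. by []. Qed.

Import HBNNSimple.

(** Both sides are limits along the same increasing simple functions, and on an indicator the
    identity is the definition of the measure. *)
Lemma integral_wmeasure (f : T -> \bar R) (D : set T) : measurable D ->
  measurable_fun D f -> (forall x, 0 <= f x) ->
  \int[wmeasure]_(x in D) f x = \int[mu]_(x in D) (f x * (w x)%:E).
Proof.
move=> mE mf f0.
have mwD (E : set T) : measurable_fun E (EFin \o w).
  by apply/measurable_EFinP; exact: measurable_funTS.
pose h := nnsfun_approx mE mf.
have fE x : D x -> f x = lim ((EFin \o h n) x @[n --> \oo]).
  by move=> Dx; apply/esym/cvg_lim => //; exact: cvg_nnsfun_approx.
have fgE x : D x -> f x * (w x)%:E = lim (((EFin \o h n) \* (EFin \o w)) x @[n --> \oo]).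
  move=> Dx; apply/esym/cvg_lim => //; apply: cvgeZr => //.
  exact: cvg_nnsfun_approx.
transitivity (limn (fun n => \int[wmeasure]_(x in D) (EFin \o h n) x)).
  under eq_integral => x /[!inE] /fE -> //.
  apply: monotone_convergence => //.
  - by move=> n; apply/measurable_EFinP; apply: (measurable_funS measurableT).
  - by move=> n x Ex //=; rewrite lee_fin.
  - by move=> x Ex a b ab; rewrite lee_fin; exact/lefP/nd_nnsfun_approx.
transitivity (limn (fun n => \int[mu]_(x in D) ((EFin \o h n) \* (EFin \o w)) x)); last first.
  under [in RHS]eq_integral => x /[!inE] /fgE -> //.
  apply/esym; apply: monotone_convergence => //.
  - move=> n; apply: emeasurable_funM => //; apply/measurable_EFinP.
    exact: (measurable_funS measurableT).
  - by move=> n x Ex /=; rewrite mule_ge0 ?lee_fin.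
  - move=> x Ex a b ab /=; rewrite lee_wpmul2r ?lee_fin//.
    exact/lefP/nd_nnsfun_approx.
congr (limn _); apply/funext => n.
transitivity (\int[wmeasure]_(x in D)
   (\sum_(y \in range (h n)) (y * \1_(h n @^-1` [set y]) x)%:E)).
  by apply: eq_integral => t tE; rewrite /= fimfunE -fsumEFin.
have indich m r : measurable_fun D (fun x => (r * \1_(h m @^-1` [set r]) x)%:E).
  by apply: (measurable_comp measurableT) => //; exact: measurable_funM.
rewrite ge0_integral_fsum//; last by move=> m y Ey; exact: nnfun_muleindic_ge0.
transitivity (\int[mu]_(x in D) (\sum_(y \in range (h n))
    (y * \1_(h n @^-1` [set y]) x)%:E * (w x)%:E)); last first.
  under [RHS]eq_integral => x xE.
    rewrite /= fimfunE -fsumEFin// ge0_mule_fsuml; last first.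
      by move=> y; exact: nnfun_muleindic_ge0.
    over.
  by [].
rewrite ge0_integral_fsum//; last 2 first.
  - by move=> y; exact: emeasurable_funM.
  - by move=> m y Ey; rewrite mule_ge0 ?lee_fin ?w0// -lee_fin nnfun_muleindic_ge0.
apply: eq_fsbigr => r rhn.
have r0 : (0 <= r)%R by move: rhn; rewrite inE => -[t _ <-].
rewrite integralZl_indic_nnsfun//.
under [RHS]eq_integral do rewrite EFinM -muleA.
rewrite ge0_integralZl//; last 2 first.
- by apply: emeasurable_funM => //; exact/measurable_EFinP.
- by move=> t Et; rewrite mule_ge0 ?lee_fin.
congr (_ * _); rewrite integral_indic// wmeasureE setIC integral_mkcondr.
by apply: eq_integral => x _; rewrite epatch_indic /= muleC.
Qed.

(** One inequality survives without measurability: a simple function below [F], multiplied by [w],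
    lies below [F * w]. It is the direction needed for a maximal function, which stands on the
    larger side of the estimate. *)
Lemma lower_integral_wmeasure_le (F : T -> \bar R) : (forall x, 0 <= F x) ->
  \int[wmeasure]_x F x <= \int[mu]_x (F x * (w x)%:E).
Proof.
move=> F0; rewrite ge0_integralTE//; apply: ge_ereal_sup => _ [h hF <-].
rewrite -(integralT_nnsfun (wmeasure) h) integral_wmeasure//; last by move=> x; rewrite lee_fin.
  apply: le_lower_integral => x _; first by rewrite mule_ge0// lee_fin.
  by rewrite lee_wpmul2r ?lee_fin.
by apply/measurable_EFinP.
Qed.

End weighted_measure.

(** * Dyadic subcubes of a cube *)

Section dyadic_subcubes.
Context (R : realType) (n : nat).
Local Notation V := (n.-tuple R).
Local Notation mu := (lebesgue R n).
Implicit Types (a : 'I_n -> R) (h : R) (x y : V).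

Lemma measurable_cube a h : measurable (cube a h).
Proof.
rewrite (_ : cube a h = [set x | forall i, `[a i, (a i + h)%R[%classic (tnth x i)]).
  by apply: (@measurable_prod_set R n (fun i => `[a i, (a i + h)%R[%classic)).
by apply/seteqP; split => x /= h' i; move: (h' i); rewrite in_itv.
Qed.

Lemma lebesgue_cube a h : (0 <= h)%R -> mu (cube a h) = (h ^+ n)%:E.
Proof.
move=> h0; rewrite lebesgue_box => [|i]; last by rewrite lerDl.
by congr _%:E; under eq_bigr do rewrite addrC addKr; rewrite prodr_const card_ord.
Qed.

Lemma lebesgue_cube_gt0 a h : (0 < h)%R -> 0 < mu (cube a h).
Proof. by move=> h0; rewrite lebesgue_cube ?lte_fin ?exprn_gt0// ltW. Qed.

Lemma lebesgue_cube_fin a h : (0 < h)%R -> mu (cube a h) \is a fin_num.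
Proof. by move=> h0; rewrite lebesgue_cube// ltW. Qed.

Lemma cube_corner a h : (0 < h)%R -> cube a h [tuple a i | i < n].
Proof. by move=> h0 i; rewrite tnth_mktuple lexx ltrDl. Qed.

Variables (a : 'I_n -> R) (h : R).
Hypothesis h0 : (0 < h)%R.

Definition sub_index j x (i : 'I_n) : nat :=
  Num.truncn ((tnth x i - a i) / (h / 2 ^+ j)).

(* The dyadic subcube of generation j of [cube a h] that contains x; meaningful
   only for x in [cube a h]. *)
Definition subcube j x : set V :=
  cube (fun i => a i + (sub_index j x i)%:R * (h / 2 ^+ j))%R (h / 2 ^+ j)%R.

Lemma side_gt0 j : (0 < h / 2 ^+ j)%R.
Proof. by rewrite divr_gt0// exprn_gt0. Qed.

Let coord_ge0 j x i : cube a h x -> (0 <= (tnth x i - a i) / (h / 2 ^+ j))%R.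
Proof.
by move=> /(_ i) /andP[? _]; rewrite divr_ge0 ?(ltW (side_gt0 _))// subr_ge0.
Qed.

Lemma sub_indexP j x (z : 'I_n -> nat) : cube a h x ->
  cube (fun i => a i + (z i)%:R * (h / 2 ^+ j))%R (h / 2 ^+ j)%R x <->
  sub_index j x =1 z.
Proof.
move=> Qx; split => [P i|zE i].
  apply: truncn_def; have /andP[P1 P2] := P i.
  rewrite ler_pdivlMr ?ltr_pdivrMr ?side_gt0// -(natr1 (z i)) mulrDl mul1r.
  by rewrite lerBrDl P1 ltrBlDl addrA P2.
rewrite -zE /sub_index; have := truncn_itv (coord_ge0 j i Qx) => /andP[].
set t := Num.truncn _; rewrite ler_pdivlMr ?ltr_pdivrMr ?side_gt0// -(natr1 t) mulrDl mul1r.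
by rewrite lerBrDl ltrBlDl addrA => -> ->.
Qed.

Lemma sub_index_lt j x i : cube a h x -> (sub_index j x i < 2 ^ j)%N.
Proof.
move=> Qx; rewrite truncn_lt_nat ?coord_ge0// ltr_pdivrMr ?side_gt0//.
rewrite natrX mulrCA divff ?mulr1; last by rewrite expf_neq0.
by have /andP[_] := Qx i; rewrite ltrBlDl.
Qed.

Lemma dyadic_subset j (z : 'I_n -> nat) : (forall i, (z i < 2 ^ j)%N) ->
  cube (fun i => a i + (z i)%:R * (h / 2 ^+ j))%R (h / 2 ^+ j)%R `<=` cube a h.
Proof.
move=> zj x P i; have /andP[P1 P2] := P i; apply/andP; split.
  apply: le_trans P1; rewrite lerDl mulr_ge0//; exact/ltW/side_gt0.
apply: lt_le_trans P2 _; rewrite -addrA lerD2l.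
rewrite -[X in (_ + X)%R]mul1r -mulrDl (natr1 (z i)) mulrCA ler_piMr ?(ltW h0)//.
by rewrite ler_pdivrMr ?exprn_gt0// mul1r -natrX ler_nat.
Qed.

Lemma subcube_sub j x : cube a h x -> subcube j x `<=` cube a h.
Proof. by move=> Qx; apply: dyadic_subset => i; exact: sub_index_lt. Qed.

Lemma subcube_refl j x : cube a h x -> subcube j x x.
Proof. by move=> Qx; apply/sub_indexP. Qed.

Lemma subcubeP j x y : cube a h x ->
  subcube j x y <-> cube a h y /\ sub_index j y =1 sub_index j x.
Proof.
move=> Qx; split => [xy|[Qy yx]]; last exact/sub_indexP.
by have Qy := subcube_sub Qx xy; split=> //; exact/sub_indexP.
Qed.

Lemma eq_subcube j x y : cube a h x -> subcube j x y ->
  subcube j y = subcube j x.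
Proof.
move=> Qx /(subcubeP _ _ Qx)[Qy /funext yx]; rewrite /subcube.
by congr cube; apply/funext => i; rewrite yx.
Qed.

(** Passing to a coarser generation drops the last [j - i] binary digits of the index. *)
Lemma sub_index_le i j x k : cube a h x -> (i <= j)%N ->
  sub_index i x k = (sub_index j x k %/ 2 ^ (j - i))%N.
Proof.
move=> Qx ij; apply: truncn_def; rewrite /sub_index.
set u := ((_ - _) / (h / 2 ^+ i))%R.
have -> : (((tnth x k - a k) / (h / 2 ^+ j)) = u * (2 ^ (j - i))%:R :> R)%R.
  rewrite /u natrX -!mulrA; congr (_ * _)%R; rewrite !invfM !invrK.
  by rewrite -mulrA -exprD subnKC.
have u0 : (0 <= u * (2 ^ (j - i))%:R)%R by rewrite mulr_ge0// coord_ge0.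
have /andP[t1 t2] := truncn_itv u0; set t := Num.truncn _ in t1 t2 *.
have p0 : (0 < 2 ^ (j - i))%N by rewrite expn_gt0.
have p0' : (0 < (2 ^ (j - i))%:R :> R)%R by rewrite ltr0n.
apply/andP; split.
  rewrite -(ler_pM2r p0'); apply: le_trans t1.
  by rewrite -natrM ler_nat leq_trunc_div.
rewrite -(ltr_pM2r p0'); apply: lt_le_trans t2 _.
by rewrite -natrM ler_nat -ltn_divLR.
Qed.

Lemma subcube_le i j x : cube a h x -> (i <= j)%N ->
  subcube j x `<=` subcube i x.
Proof.
move=> Qx ij y /(subcubeP _ _ Qx)[Qy yx]; apply/subcubeP => //; split=> // k.
by rewrite !(sub_index_le _ _ ij)// yx.
Qed.

Lemma subcube0 x : cube a h x -> subcube 0 x = cube a h.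
Proof.
move=> Qx; rewrite /subcube expr0 divr1; congr cube; apply/funext => i.
by have := sub_index_lt 0 i Qx; rewrite expn0 ltnS leqn0 => /eqP ->; rewrite mul0r addr0.
Qed.

Lemma lebesgue_subcube j x : mu (subcube j x) = ((h / 2 ^+ j) ^+ n)%:E.
Proof. by rewrite lebesgue_cube// ltW// side_gt0. Qed.

Lemma lebesgue_subcube_gt0 j x : 0 < mu (subcube j x).
Proof. by rewrite lebesgue_cube_gt0// side_gt0. Qed.

Lemma is_cube_subcube j x : is_cube (subcube j x).
Proof.
by exists (fun i => a i + (sub_index j x i)%:R * (h / 2 ^+ j))%R, (h / 2 ^+ j)%R => //; exact: side_gt0.
Qed.

Lemma measurable_subcube j x : measurable (subcube j x).
Proof. exact: measurable_cube. Qed.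

(** The volume determines the side, in positive dimension. *)
Lemma subcube_inj i j x y : (0 < n)%N -> subcube i x = subcube j y -> i = j.
Proof.
move=> n0 /(congr1 mu); rewrite !lebesgue_subcube => -[] /eqP.
rewrite eqrXn2// ?(ltW (side_gt0 _))// => /eqP /(mulfI (lt0r_neq0 h0)) /invr_inj.
by apply: ieexprIn => //; rewrite gt_eqF// ltr1n.
Qed.

Lemma dyadicE j (z : 'I_n -> nat) x : (forall i, (z i < 2 ^ j)%N) ->
  cube (fun i => a i + (z i)%:R * (h / 2 ^+ j))%R (h / 2 ^+ j)%R x ->
  cube a h x /\
  cube (fun i => a i + (z i)%:R * (h / 2 ^+ j))%R (h / 2 ^+ j)%R = subcube j x.
Proof.
move=> zj Px; have Qx := dyadic_subset zj Px; split=> //; rewrite /subcube.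
move/(sub_indexP _ _ Qx): Px => zx.
by congr cube; apply/funext => i; rewrite zx.
Qed.

(* Unions of dyadic subcubes of generation j. *)
Definition level_set j (U : set V) :=
  U `<=` cube a h /\ forall x, U x -> subcube j x `<=` U.

Lemma level_setT j : level_set j (cube a h).
Proof. by split=> // x Qx; exact: subcube_sub. Qed.

Lemma level_set0 j : level_set j set0.
Proof. by split. Qed.

Lemma level_setU j U U' : level_set j U -> level_set j U' ->
  level_set j (U `|` U').
Proof.
move=> [UQ UU] [UQ' UU']; split=> [x [/UQ|/UQ']//|x [/UU|/UU'] xU y /xU];
by [left|right].
Qed.

Lemma level_setI j U U' : level_set j U -> level_set j U' ->
  level_set j (U `&` U').
Proof.
move=> [UQ UU] [UQ' UU']; split=> [x [/UQ//]|x [/UU xU /UU' xU'] y xy].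
by split; [exact: xU|exact: xU'].
Qed.

Lemma level_setD j U U' : level_set j U -> level_set j U' ->
  level_set j (U `\` U').
Proof.
move=> [UQ UU] [UQ' UU']; split=> [x [/UQ//]|x [Ux U'x] y xy].
split; first exact: UU xy.
have Qx := UQ _ Ux; have /(subcubeP _ _ Qx)[Qy _] := xy.
move=> U'y; apply: U'x; apply: (UU' y U'y).
by rewrite (eq_subcube Qx xy); exact: subcube_refl.
Qed.

Lemma level_set_le i j U : (i <= j)%N -> level_set i U -> level_set j U.
Proof.
move=> ij [UQ UU]; split=> // x Ux; apply: subset_trans (UU x Ux).
by apply: subcube_le => //; exact: UQ.
Qed.

Lemma level_set_subcube i j x : cube a h x -> (i <= j)%N ->
  level_set j (subcube i x).
Proof.
move=> Qx ij; apply: (level_set_le ij); split; first exact: subcube_sub.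
by move=> y xy; rewrite (eq_subcube Qx xy).
Qed.

Let dyadic j (z : {ffun 'I_n -> 'I_(2 ^ j)}) :=
  cube (fun i => a i + (z i)%:R * (h / 2 ^+ j))%R (h / 2 ^+ j)%R.

Let dyadic_cover j x : cube a h x ->
  exists z : {ffun 'I_n -> 'I_(2 ^ j)}, dyadic z x.
Proof.
move=> Qx; exists [ffun i => Ordinal (sub_index_lt j i Qx)].
by apply/sub_indexP => // i; rewrite ffunE.
Qed.

Let dyadic_subcube j (z : {ffun 'I_n -> 'I_(2 ^ j)}) x : dyadic z x ->
  cube a h x /\ dyadic z = subcube j x.
Proof. by move=> zx; apply: dyadicE. Qed.

Let level_setE j U : level_set j U ->
  U = \big[setU/set0]_(z <- [seq z <- index_enum {ffun 'I_n -> 'I_(2 ^ j)} |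
     `[< dyadic z `<=` U >]]) dyadic z.
Proof.
move=> [UQ UU]; rewrite -bigcup_seq; apply/seteqP; split => x.
  move=> Ux; have [z zx] := dyadic_cover j (UQ _ Ux); exists z => //=.
  rewrite mem_filter mem_index_enum andbT; apply/asboolP.
  by have [_ ->] := dyadic_subcube zx; exact: UU.
by move=> [z] /=; rewrite mem_filter => /andP[/asboolP zU _] /zU.
Qed.

Let trivIset_dyadic j (A : set {ffun 'I_n -> 'I_(2 ^ j)}) :
  trivIset A (@dyadic j).
Proof.
move=> z z' _ _ [x [/[dup] zx /dyadic_subcube[Qx _] z'x]].
apply/ffunP => i; apply/val_inj => /=.
by move/(sub_indexP _ _ Qx): zx => /(_ i) <-; move/(sub_indexP _ _ Qx): z'x => /(_ i) <-.
Qed.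

Lemma measurable_level_set j U : level_set j U -> measurable U.
Proof.
move/level_setE ->; apply: bigsetU_measurable => z _; exact: measurable_cube.
Qed.

(** Local to global: a level set is a finite disjoint union of subcubes of generation [j], so
    inequalities on each of them add up. Two measures are allowed so that [nu] can be compared with
    Lebesgue measure. *)
Lemma le_integral_level_set (nu1 nu2 : {measure set V -> \bar R})
    (f1 f2 : V -> \bar R) j U : level_set j U ->
  measurable_fun U f1 -> measurable_fun U f2 ->
  (forall x, U x -> 0 <= f1 x) -> (forall x, U x -> 0 <= f2 x) ->
  (forall x, U x ->
    \int[nu1]_(y in subcube j x) f1 y <= \int[nu2]_(y in subcube j x) f2 y) ->
  \int[nu1]_(x in U) f1 x <= \int[nu2]_(x in U) f2 x.
Proof.
move=> lU mf1 mf2 f10 f20 f12.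
rewrite [X in \int[nu1]_(x in X) _](level_setE lU).
rewrite [X in _ <= \int[nu2]_(x in X) _](level_setE lU).
rewrite !ge0_integral_bigsetU//; last first.
- by rewrite -level_setE.
- by rewrite -level_setE.
- exact: trivIset_dyadic.
- by rewrite filter_uniq// index_enum_uniq.
- by move=> z; exact: measurable_cube.
- by rewrite -level_setE.
- by rewrite -level_setE.
- exact: trivIset_dyadic.
- by rewrite filter_uniq// index_enum_uniq.
- by move=> z; exact: measurable_cube.
rewrite big_seq [leRHS]big_seq; apply: lee_sum => z.
rewrite mem_filter => /andP[/asboolP zU _].
have zx : dyadic z [tuple a i + (z i)%:R * (h / 2 ^+ j) | i < n]%R.
  by apply: cube_corner; exact: side_gt0.
by have [_ ->] := dyadic_subcube zx; apply: f12; exact: zU.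
Qed.

Lemma measurable_fun_level d' (T : measurableType d') j U (f : V -> T) :
  level_set j U -> (forall x, U x -> measurable_fun (subcube j x) f) ->
  measurable_fun U f.
Proof.
move=> lU mf mU Y mY; rewrite [X in X `&` _](level_setE lU) -bigcup_seq.
rewrite setI_bigcupl.
apply: fin_bigcup_measurable => [|z /=]; first exact: finite_seq.
rewrite mem_filter => /andP[/asboolP zU _].
have zx : dyadic z [tuple a i + (z i)%:R * (h / 2 ^+ j) | i < n]%R.
  by apply: cube_corner; exact: side_gt0.
have [_ zE] := dyadic_subcube zx; rewrite zE.
by apply: mf => //; [exact: zU|exact: measurable_subcube].
Qed.

(** Preimages are level sets. This settles measurability for every function that sees a point only
    through its subcubes. *)
Lemma measurable_fun_const_level d' (T : measurableType d') j (f : V -> T) :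
  (forall x, cube a h x -> forall y, subcube j x y -> f y = f x) ->
  measurable_fun (cube a h) f.
Proof.
move=> fE mQ Y mY; apply: (@measurable_level_set j); split=> [x []//|].
move=> x [Qx Yx] y xy; split; first exact: subcube_sub xy.
by rewrite /= (fE x).
Qed.

End dyadic_subcubes.

Section cube_uniqueness.
Context (R : realType) (n : nat).
Hypothesis n0 : (0 < n)%N.
Implicit Types (a : 'I_n -> R) (h : R).

(** Each half-open cube contains its lower corner, so each corner dominates the other
    coordinatewise; the volume then gives the side. *)
Lemma cube_inj a a' h h' : (0 < h)%R -> (0 < h')%R -> cube a h = cube a' h' ->
  a = a' /\ h = h'.
Proof.
move=> h0 h0' aa'; split.
  apply/funext => i; apply/eqP; rewrite eq_le; apply/andP; split.
    have := cube_corner a' h0'; rewrite -aa' => /(_ i) /andP[+ _].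
    by rewrite tnth_mktuple.
  have := cube_corner a h0; rewrite aa' => /(_ i) /andP[+ _].
  by rewrite tnth_mktuple.
have /eqP := congr1 (lebesgue R n) aa'.
by rewrite !lebesgue_cube ?ltW// eqe eqrXn2 ?ltW// => /eqP.
Qed.

Lemma dyadic_descendant_trans (P Q S : set (n.-tuple R)) :
  dyadic_descendant S Q -> dyadic_descendant Q P -> dyadic_descendant S P.
Proof.
move=> [a [h [k [z [h0 SE zk QE]]]]] [a' [h' [k' [z' [h0' QE' zk' PE]]]]].
have [aE hE] : a' = (fun i => a i + (z i)%:R * (h / 2 ^+ k))%R /\ h' = (h / 2 ^+ k)%R.
  by apply: cube_inj => //; [rewrite divr_gt0// exprn_gt0|rewrite -QE'].
(* Positions concatenate in binary: the [k'] digits of [z'] are appended to those of [z]. *)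
exists a, h, (k + k')%N, (fun i => z i * 2 ^ k' + z' i)%N; split => //.
  move=> i; rewrite expnD; apply: (@leq_trans ((z i).+1 * 2 ^ k')).
    by rewrite mulSn addnC ltn_add2r.
  by rewrite leq_mul2r zk orbT.
have h2 : (h / 2 ^+ (k + k') = h' / 2 ^+ k')%R.
  by rewrite hE exprD invfM mulrA.
rewrite PE -h2; congr cube; apply/funext => i; rewrite aE -addrA; congr (_ + _)%R.
rewrite natrD natrM mulrDl; congr (_ + _)%R; rewrite -mulrA; congr (_ * _)%R.
rewrite exprD invfM natrX [(_^-1 * _)%R]mulrC mulrCA mulrA mulrA mulfK//.
Qed.

End cube_uniqueness.

(** * Carleson packing *)

Section weighted_sums.
Context (R : realType).
Local Open Scope ring_scope.
Implicit Types (m k : nat).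

Lemma ler_exprn k (x y : R) : 0 <= x -> x <= y -> x ^+ k <= y ^+ k.
Proof.
move=> x0 xy; have y0 := le_trans x0 xy.
by apply: (@Num.Theory.lerXn2r R k x y) => //; rewrite nnegrE.
Qed.

(** Chebyshev's sum inequality: twice the difference is the sum over all pairs of [a i * a j * ((y i
    - y j) * (y i ^+ k - y j ^+ k))], with nonnegative terms since powers are monotone. *)
Lemma chebyshev_sum m k (a y : 'I_m -> R) :
  (forall i, 0 <= a i) -> (forall i, 0 <= y i) ->
  (\sum_i a i * y i) * (\sum_i a i * y i ^+ k) <=
  (\sum_i a i) * (\sum_i a i * y i ^+ k.+1).
Proof.
move=> a0 y0; rewrite -subr_ge0.
have E1 : (\sum_i a i) * (\sum_i a i * y i ^+ k.+1) =
    \sum_i \sum_j a i * (a j * y j ^+ k.+1) by rewrite big_distrlr.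
have E2 : (\sum_i a i) * (\sum_i a i * y i ^+ k.+1) =
    \sum_i \sum_j a j * (a i * y i ^+ k.+1).
  by rewrite E1 exchange_big.
have E3 : (\sum_i a i * y i) * (\sum_i a i * y i ^+ k) =
    \sum_i \sum_j (a i * y i) * (a j * y j ^+ k) by rewrite big_distrlr.
have E4 : (\sum_i a i * y i) * (\sum_i a i * y i ^+ k) =
    \sum_i \sum_j (a j * y j) * (a i * y i ^+ k).
  by rewrite E3 exchange_big.
rewrite -(pmulrn_lge0 _ (isT : (0 < 2)%N)); set L := (_ - _).
have -> : L *+ 2 = \sum_i \sum_j a i * a j * ((y i - y j) * (y i ^+ k - y j ^+ k)).
  rewrite mulr2n {1}/L E1 E3 /L E2 E4 -!sumrB -big_split /=.
  apply: eq_bigr => i _; rewrite -!sumrB -big_split /=.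
  by apply: eq_bigr => j _; rewrite !exprS; ring.
apply: sumr_ge0 => i _; apply: sumr_ge0 => j _.
apply: mulr_ge0; first exact: mulr_ge0.
have [ij|ji] := leP (y i) (y j).
  by apply: mulr_le0; rewrite subr_le0// ler_exprn.
by apply: mulr_ge0; rewrite subr_ge0 ?ler_exprn// ltW.
Qed.

(** Jensen's inequality for weights of arbitrary total mass, by induction on the power with one use
    of Chebyshev's inequality per step. *)
Lemma jensen_power_sum m k (a y : 'I_m -> R) :
  (forall i, 0 <= a i) -> (forall i, 0 <= y i) ->
  (\sum_i a i * y i) ^+ k.+1 <= (\sum_i a i) ^+ k * \sum_i a i * y i ^+ k.+1.
Proof.
move=> a0 y0; elim: k => [|k IH].
  by rewrite expr1 expr0 mul1r.
have s0 : 0 <= \sum_i a i * y i by apply: sumr_ge0 => i _; rewrite mulr_ge0.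
rewrite exprS; apply: le_trans (ler_wpM2l s0 IH) _.
rewrite mulrCA exprSr -[leRHS]mulrA ler_wpM2l ?chebyshev_sum//.
by rewrite exprn_ge0// sumr_ge0.
Qed.

(* Telescoping along the visits of a 0-1 sequence. *)
Lemma sum_visits (b : nat -> bool) (c : R) m :
  (c - 1) * \sum_(i < m) (b i)%:R * c ^+ (\sum_(j < i) b j)%N =
  c ^+ (\sum_(j < m) b j)%N - 1.
Proof.
elim: m => [|m IH]; first by rewrite !big_ord0 expr0 mulr0 subrr.
rewrite !big_ord_recr /= mulrDr IH; case: (b m) => /=.
  by rewrite mul1r addn1 exprS; ring.
by rewrite mul0r mulr0 addr0 addn0.
Qed.

(** The exponent grows by one at each visit, so the terms of the visited indices are
    [1, c, c^2, ...]. *)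
Lemma sum_visits_geometric (b : nat -> bool) (c : R) m : 0 <= c < 1 ->
  \sum_(i < m) (b i)%:R * c ^+ (\sum_(j < i) b j)%N <= (1 - c)^-1.
Proof.
move=> /andP[c0 c1]; have c1' : 0 < 1 - c by rewrite subr_gt0.
rewrite -(ler_pM2l c1') divff ?gt_eqF//.
have := sum_visits b c m; set S := \sum_(i < m) _; set e := _ ^+ _ => SE.
have e0 : 0 <= e by rewrite exprn_ge0.
by nra.
Qed.

(** Telescoping and an exchange of sums turn the excess over the plain count into a sum over pairs
    of visits [i <= j]. Such pairs are what packing controls, and the factor [c - 1] makes the
    excess small. *)
Lemma sum_visits_quadratic (b : nat -> bool) (c : R) m :
  c * (\sum_(i < m) (b i)%:R * c ^+ (\sum_(j < i) b j)%N) =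
  \sum_(i < m) (b i)%:R +
  (c - 1) * \sum_(i < m) (b i)%:R * c ^+ (\sum_(j < i) b j)%N *
     \sum_(i <= j < m) (b j)%:R.
Proof.
have -> : \sum_(i < m) (b i)%:R * c ^+ (\sum_(j < i) b j)%N *
     \sum_(i <= j < m) (b j)%:R =
  \sum_(j < m) (b j)%:R * \sum_(i < j.+1) (b i)%:R * c ^+ (\sum_(j < i) b j)%N.
  under eq_bigr do rewrite big_geq_mkord mulr_sumr.
  rewrite (exchange_big_dep xpredT)//=; apply: eq_bigr => j _.
  rewrite (big_ord_widen m (fun i : nat => (b i)%:R * c ^+ (\sum_(k < i) b k)%N))//.
  rewrite mulr_sumr.
  by apply: eq_bigr => i _; rewrite mulrC.
rewrite !mulr_sumr -big_split /=; apply: eq_bigr => j _.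
rewrite [X in _ + X]mulrCA sum_visits big_ord_recr /=.
by case: (b j); rewrite ?mul0r ?mulr0 ?addr0// !mul1r addn1 exprS /=; ring.
Qed.

End weighted_sums.

(** * Moments of sums over a Carleson family *)

Section carleson.
Context (R : realType) (n : nat) (a : 'I_n -> R) (h : R).
Hypothesis h0 : (0 < h)%R.
Variable nu : {measure set (n.-tuple R) -> \bar R}.
Local Notation V := (n.-tuple R).
Local Notation Q := (cube a h).
Local Notation sub := (subcube a h).
Hypothesis nuQ : nu Q < +oo.
Variables (J : nat) (U : nat -> set V).
Hypothesis lU : forall i, level_set a h i (U i).

Definition visits i (x : V) : nat := \sum_(j < i) (x \in U j).

Lemma mem_level i j x y : (i <= j)%N -> Q x -> sub j x y ->
  (y \in U i) = (x \in U i).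
Proof.
move=> ij Qx xy; have [UQ UU] := level_set_le h0 ij (lU i).
have [Qy _] := (subcubeP h0 _ _ Qx).1 xy.
apply/idP/idP => /set_mem Ux; apply/mem_set; last exact: UU xy.
by apply: UU Ux _ _; rewrite (eq_subcube h0 Qx xy); exact: subcube_refl.
Qed.

Lemma visits_level i j x y : (i <= j)%N -> Q x -> sub j x y ->
  visits i y = visits i x.
Proof.
move=> ij Qx xy; apply: eq_bigr => k _; congr nat_of_bool.
by apply: (mem_level _ Qx xy); rewrite (leq_trans (ltnW (ltn_ord k))).
Qed.

(** An exponential moment in telescoped form: for [c != 1] this is
    [(c ^+ visits J x - 1) / (c - 1)]. *)
Definition visit_sum (c : R) (x : V) : R :=
  (\sum_(i < J) (x \in U i)%:R * c ^+ visits i x)%R.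

Lemma visit_sum_ge0 c x : (0 <= c)%R -> (0 <= visit_sum c x)%R.
Proof. by move=> c0; rewrite sumr_ge0// => i _; rewrite mulr_ge0// exprn_ge0. Qed.

Lemma measurable_visit_sum c : measurable_fun Q (visit_sum c).
Proof.
apply: (measurable_fun_const_level h0 (j := J)) => x Qx y xy.
apply: eq_bigr => i _; have iJ := ltnW (ltn_ord i).
by rewrite (mem_level iJ Qx xy) (visits_level iJ Qx xy).
Qed.

Definition carleson (K : R) := forall i x, (i < J)%N -> U i x ->
  \sum_(i <= j < J) nu (U j `&` sub i x) <= K%:E * nu (sub i x).

Variable K : R.
Hypothesis K1 : (1 <= K)%R.
Hypothesis cU : carleson K.

Let mQ : measurable Q. Proof. exact: measurable_cube. Qed.

Let mind i : measurable_fun Q (fun x => (x \in U i)%:R : R).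
Proof.
apply: (measurable_fun_const_level h0 (j := i)) => x Qx y xy.
by rewrite (mem_level _ Qx xy).
Qed.

(** The weight [1_(U i) phi] is constant on each subcube of generation [i]; once it is taken out of
    the integral, the packing condition remains. *)
Lemma carleson_level i (phi : V -> R) : (i < J)%N ->
  (forall x, 0 <= phi x)%R ->
  (forall x, Q x -> forall y, sub i x y -> phi y = phi x) ->
  \int[nu]_(x in Q) ((x \in U i)%:R * phi x * \sum_(i <= j < J) (x \in U j)%:R)%:E
  <= K%:E * \int[nu]_(x in Q) ((x \in U i)%:R * phi x)%:E.
Proof.
move=> iJ phi0 phiE.
have mphi : measurable_fun Q phi by exact: (measurable_fun_const_level h0 phiE).
have msum : measurable_fun Q (fun x => (\sum_(i <= j < J) (x \in U j)%:R)%R : R).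
  by apply: measurable_sum.
have m1 : measurable_fun Q (fun x => (x \in U i)%:R * phi x)%R.
  exact: measurable_funM.
have K0 : (0 <= K)%R by exact: le_trans K1.
rewrite -ge0_integralZl//; last 2 first.
  exact/measurable_EFinP.
  by move=> x _; rewrite lee_fin mulr_ge0.
apply: (le_integral_level_set h0 (level_setT a h0 i)) => //.
- by apply/measurable_EFinP; exact: measurable_funM.
- by apply: emeasurable_funM => //; exact/measurable_EFinP.
- by move=> x _; rewrite lee_fin !mulr_ge0// sumr_ge0.
- by move=> x _; rewrite mule_ge0 ?lee_fin// mulr_ge0.
move=> x Qx; have Sub := subcube_sub h0 Qx (j := i).
have mS : measurable (sub i x) by exact: measurable_subcube.
have [xU|xU] := boolP (x \in U i); last first.
  rewrite integral0_eq; last first.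
    by move=> y xy; rewrite (mem_level _ Qx xy)// (negbTE xU) !mul0r.
  by rewrite integral_ge0// => y _; rewrite mule_ge0 ?lee_fin// mulr_ge0.
rewrite (eq_integral (fun y => (phi x)%:E * (\sum_(i <= j < J) (y \in U j)%:R%:E))); last first.
  move=> y /set_mem xy; rewrite (mem_level _ Qx xy)// xU mul1r (phiE _ Qx)//.
  by rewrite EFinM sumEFin.
rewrite [leRHS](eq_integral (fun y => (K * phi x)%:E)); last first.
  by move=> y /set_mem xy; rewrite (mem_level _ Qx xy)// xU mul1r (phiE _ Qx).
have mi j : measurable_fun (sub i x) (fun y => (y \in U j)%:R%:E : \bar R).
  by apply/measurable_EFinP; apply: measurable_funS (mind j).
rewrite ge0_integralZl ?lee_fin//; last 2 first.
- by apply: emeasurable_sum => j _; exact: mi.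
- by move=> y _; apply: sume_ge0 => j _; rewrite lee_fin.
rewrite integral_cst// EFinM -muleA muleCA lee_wpmul2l ?lee_fin//.
rewrite ge0_integral_sum//.
apply: le_trans (cU iJ (set_mem xU)); apply: lee_sum => j _.
rewrite -integral_indic//; last exact: measurable_level_set (lU j).
Qed.

Let Omega := \bigcup_(i in `I_J) U i.

Let msum c := measurable_visit_sum c.

Let visit_pairs (c : R) (x : V) : R :=
  (\sum_(i < J) (x \in U i)%:R * c ^+ visits i x *
     \sum_(i <= j < J) (x \in U j)%:R)%R.

Let mpairs c : measurable_fun Q (visit_pairs c).
Proof.
apply: measurable_sum => i; apply: measurable_funM.
  apply: measurable_funM => //; apply: (measurable_fun_const_level h0 (j := i)).
  by move=> x Qx y xy; rewrite (visits_level _ Qx xy).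
by apply: measurable_sum.
Qed.

Let pairs_le (c : R) : (0 <= c)%R ->
  \int[nu]_(x in Q) (visit_pairs c x)%:E <=
  K%:E * \int[nu]_(x in Q) (visit_sum c x)%:E.
Proof.
move=> c0.
have mc (i : nat) : measurable_fun Q (fun x => c ^+ visits i x)%R.
  apply: (measurable_fun_const_level h0 (j := i)) => x Qx y xy.
  by rewrite (visits_level _ Qx xy).
under eq_integral do rewrite /visit_pairs -sumEFin.
under [in leRHS]eq_integral do rewrite /visit_sum -sumEFin.
rewrite !ge0_integral_sum//; last 4 first.
- by move=> i; apply/measurable_EFinP; exact: measurable_funM.
- by move=> i x _; rewrite lee_fin mulr_ge0// exprn_ge0.
- move=> i; apply/measurable_EFinP; apply: measurable_funM.
    exact: measurable_funM.
  by apply: measurable_sum.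
- by move=> i x _; rewrite lee_fin !mulr_ge0 ?exprn_ge0// sumr_ge0.
rewrite ge0_sume_distrr; last first.
  by move=> i _; apply: integral_ge0 => x _; rewrite lee_fin mulr_ge0// exprn_ge0.
apply: lee_sum => i _.
apply: (@carleson_level i (fun x => c ^+ visits i x)%R).
- exact: ltn_ord.
- by move=> x; rewrite exprn_ge0.
- by move=> x Qx y xy; rewrite (visits_level _ Qx xy).
Qed.

(** Since [0 ^+ 0 = 1], exactly the first visit contributes at [c = 0]. *)
Lemma visit_sum0 x : visit_sum 0 x = \1_Omega x.
Proof.
have := sum_visits (fun i => x \in U i) (0 : R) J.
rewrite -/(visits J x) -/(visit_sum 0 x) indicE => SE.
have -> : visit_sum 0 x = (1 - 0 ^+ visits J x)%R by move: SE; lra.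
rewrite expr0n; have -> : (visits J x == 0%N) = (x \notin Omega).
  rewrite /visits sum_nat_eq0; apply/forallP/idP => [xU|/negP xU i].
    apply/negP => /set_mem[i /= iJ Ux].
    by have := xU (Ordinal iJ); rewrite /= mem_set.
  rewrite /= eqb0; apply/negP => /set_mem Ux; apply: xU; apply/mem_set.
  by exists i => //=.
by case: (x \in Omega); rewrite ?subr0 ?subrr.
Qed.

Lemma measurable_visited : measurable Omega.
Proof.
by apply: bigcup_measurable => i _; exact: measurable_level_set (lU i).
Qed.

Lemma visited_sub : Omega `<=` Q.
Proof. by move=> x [i _ Ux]; have [+ _] := lU i; apply. Qed.

Lemma integral_visit_sum0 : \int[nu]_(x in Q) (visit_sum 0 x)%:E = nu Omega.
Proof.
under eq_integral do rewrite visit_sum0.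
rewrite integral_indic//; last exact: measurable_visited.
by rewrite setIidl//; exact: visited_sub.
Qed.

(** A crude bound, but finiteness is what permits the absorption below. *)
Let visit_sum_fin c : (1 <= c)%R ->
  \int[nu]_(x in Q) (visit_sum c x)%:E \is a fin_num.
Proof.
move=> c1; have c0 : (0 <= c)%R by exact: le_trans c1.
rewrite ge0_fin_numE; last first.
  by apply: integral_ge0 => x _; rewrite lee_fin visit_sum_ge0.
apply: (@le_lt_trans _ _ (\int[nu]_(x in Q) (J%:R * c ^+ J)%:E)).
  apply: le_lower_integral => x _; rewrite lee_fin ?visit_sum_ge0//.
  have -> : (J%:R * c ^+ J = \sum_(i < J) c ^+ J)%R.
    by rewrite sumr_const card_ord mulr_natl.
  apply: ler_sum => i _; rewrite -[leRHS]mul1r ler_pM ?exprn_ge0//.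
    by case: (_ \in _).
  rewrite ler_weXn2l// /visits; apply: (@leq_trans i); last exact: ltnW.
  rewrite -[X in (_ <= X)%N]card_ord -sum1_card; apply: leq_sum => k _.
  by case: (_ \in _).
by rewrite integral_cst//= lte_mul_pinfty// lee_fin mulr_ge0// exprn_ge0.
Qed.

(** Absorption: the quadratic identity and packing give [c S <= K nu(Omega) + (c - 1) K S] for the
    integral [S], and the last term is at most [S / 2]. The plain count is bounded by [K nu(Omega)]
    through the same identity at [c = 0], where it equals the sum over pairs. *)
Lemma integral_visit_sum_le c : (1 <= c)%R -> ((c - 1) * K <= 2^-1)%R ->
  \int[nu]_(x in Q) (visit_sum c x)%:E <= (2 * K)%:E * nu Omega.
Proof.
move=> c1 cK; have c0 : (0 <= c)%R by exact: le_trans c1.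
have c10 : (0 <= c - 1)%R by rewrite subr_ge0.
have K0 : (0 <= K)%R by exact: le_trans K1.
pose C0 x : R := (\sum_(i < J) (x \in U i)%:R)%R.
have mC0 : measurable_fun Q (EFin \o C0).
  by apply/measurable_EFinP; exact: measurable_sum.
have C00 x : 0 <= (C0 x)%:E by rewrite lee_fin sumr_ge0.
have C0_le : \int[nu]_(x in Q) (C0 x)%:E <= K%:E * nu Omega.
  rewrite -integral_visit_sum0; apply: le_trans (pairs_le (lexx 0%R)).
  apply: le_lower_integral => // x _; rewrite lee_fin.
  have := sum_visits_quadratic (fun i => x \in U i) (0 : R) J.
  by rewrite mul0r /visit_pairs /C0 /visits; lra.
have pairs0 x : 0 <= (visit_pairs c x)%:E.
  rewrite lee_fin sumr_ge0// => i _; rewrite mulr_ge0 ?mulr_ge0 ?exprn_ge0//.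
  exact: sumr_ge0.
have : c%:E * \int[nu]_(x in Q) (visit_sum c x)%:E =
    \int[nu]_(x in Q) (C0 x)%:E + (c - 1)%:E * \int[nu]_(x in Q) (visit_pairs c x)%:E.
  rewrite -!ge0_integralZl//.
  - rewrite -ge0_integralD//.
    + apply: eq_integral => x _; rewrite -!EFinM -EFinD; congr _%:E.
      exact: (sum_visits_quadratic (fun i => x \in U i) c J).
    + by move=> x _; rewrite mule_ge0// lee_fin.
    + by apply: emeasurable_funM => //; exact/measurable_EFinP.
  - exact/measurable_EFinP.
  - exact/measurable_EFinP.
  - by move=> x _; rewrite lee_fin visit_sum_ge0.
have := visit_sum_fin c1; have := pairs_le c0.
have := @integral_ge0 _ _ _ nu Q _ (fun x _ => pairs0 x).
have : nu Omega \is a fin_num.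
  rewrite ge0_fin_numE//; apply: le_lt_trans nuQ; apply: le_measure.
  - by rewrite inE; exact: measurable_visited.
  - by rewrite inE.
  - exact: visited_sub.
move: C0_le; have := @integral_ge0 _ _ _ nu Q _ (fun x _ => C00 x).
move: (\int[nu]_(x in Q) (visit_sum c x)%:E) => S.
move: (\int[nu]_(x in Q) (C0 x)%:E) => s.
move: (\int[nu]_(x in Q) (visit_pairs c x)%:E) => P.
case: (nu Omega) => // v; case: S => // S.
case: s => // s s0 sv _; case: P => // P P0 PS _ [SE].
move: s0 sv P0 PS; rewrite -!EFinM !lee_fin => s0 sv P0 PS.
have PS' : ((c - 1) * P <= (c - 1) * (K * S))%R by rewrite ler_wpM2l.
have S0 : (0 <= S)%R.
  have : (0 <= c * S)%R by rewrite SE addr_ge0// mulr_ge0.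
  by rewrite pmulr_rge0//; exact: lt_le_trans c1.
nra.
Qed.

(** Jensen with weights decaying geometrically in the visit number turns the power of the sum into a
    sum of powers, at the price of factors [c ^+ visits]. These are constant on the subcubes of
    their generation, so the hypothesis on [B] applies cube by cube and the exponential moment bound
    concludes. *)
Theorem integral_sum_power_le (k : nat) (D : R) (B : nat -> V -> R) : (0 <= D)%R ->
  (forall i, measurable_fun Q (B i)) -> (forall i x, 0 <= B i x)%R ->
  (forall i x, (i < J)%N -> U i x ->
    \int[nu]_(y in sub i x) (B i y ^+ k.+1)%:E <= D%:E * nu (sub i x)) ->
  \int[nu]_(x in Q) ((\sum_(i < J) (x \in U i)%:R * B i x) ^+ k.+1)%:E <=
  ((4 * k.+1%:R * K) ^+ k * (2 * K * D))%:E * nu Omega.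
Proof.
move=> D0 mB B0 BD.
have K0 : (0 < K)%R by exact: lt_le_trans K1.
(* The rate [r] balances two demands: the total weight [1 / r] enters to the power [k], while the
   compensating base [c = (1 - r) ^- k] must satisfy [(c - 1) * K <= 1/2], which Bernoulli's
   inequality ensures. *)
pose r : R := ((4 * k.+1%:R * K)^-1)%R.
have r0 : (0 < r)%R by rewrite invr_gt0 !mulr_gt0.
have rK : (r * k.+1%:R * K = 4^-1)%R.
  by rewrite /r; field; rewrite gt_eqF//= addrC natr1 pnatr_eq0.
pose rho : R := (1 - r)%R.
have kr : (k%:R * r * K <= 4^-1)%R.
  by rewrite -rK; move: r0; rewrite -natr1; nra.
have kr4 : (k%:R * r <= 4^-1)%R.
  apply: le_trans kr; rewrite ler_peMr// mulr_ge0//; exact: ltW.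
have r4 : (r <= 4^-1)%R.
  have k1 : (1 <= k.+1%:R :> R)%R by rewrite ler1n.
  rewrite -rK -mulrA ler_peMr// ?(ltW r0)//.
  by rewrite -[leLHS]mulr1 ler_pM.
have rho0 : (0 < rho)%R by rewrite /rho; move: r4; lra.
have rho1 : (rho < 1)%R by rewrite /rho; move: r0; lra.
have bern : (1 - k%:R * r <= rho ^+ k)%R.
  elim: (k) => [|m IH]; first by rewrite mul0r subr0 expr0.
  rewrite exprS -natr1; apply: le_trans (ler_wpM2l (ltW rho0) IH).
  have : (0 <= m%:R :> R)%R by [].
  by rewrite /rho; move: r0; move: (m%:R : R) => M; nra.
pose c : R := ((rho ^+ k)^-1)%R.
have c1 : (1 <= c)%R by rewrite invr_ge1 ?unitfE ?expf_neq0 ?gt_eqF// ?exprn_gt0// exprn_ile1// ltW.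
have cK : ((c - 1) * K <= 2^-1)%R.
  have cr : (c * rho ^+ k = 1)%R by rewrite mulVf// expf_neq0// gt_eqF.
  move: bern cr kr kr4 K1 c1; move: (k%:R * r)%R (rho ^+ k)%R => X Y.
  by nra.
(* Jensen with the weights [rho ^+ visits i x], whose sum is at most 1 / r. *)
have jens x : ((\sum_(i < J) (x \in U i)%:R * B i x) ^+ k.+1 <=
    (4 * k.+1%:R * K) ^+ k *
    \sum_(i < J) (x \in U i)%:R * c ^+ visits i x * B i x ^+ k.+1)%R.
  pose w (i : 'I_J) : R := ((x \in U i)%:R * rho ^+ visits i x)%R.
  pose y (i : 'I_J) : R := (B i x / rho ^+ visits i x)%R.
  have w0 i : (0 <= w i)%R by rewrite mulr_ge0// exprn_ge0// ltW.
  have y0 i : (0 <= y i)%R by rewrite divr_ge0// exprn_ge0// ltW.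
  have rn m : (rho ^+ m != 0)%R by rewrite expf_neq0// gt_eqF.
  have -> : (\sum_(i < J) (x \in U i)%:R * B i x = \sum_i w i * y i)%R.
    by apply: eq_bigr => i _; rewrite /w /y mulrACA divff ?mulr1.
  apply: le_trans (jensen_power_sum k w0 y0) _; apply: ler_pM.
  - by rewrite exprn_ge0// sumr_ge0.
  - by rewrite sumr_ge0// => i _; rewrite mulr_ge0// exprn_ge0.
  - apply: ler_exprn; first exact: sumr_ge0.
    have -> : (4 * k.+1%:R * K = (1 - rho)^-1)%R.
      by rewrite /rho /r opprB addrCA subrr addr0 invrK.
    by apply: (sum_visits_geometric (fun i => x \in U i)); rewrite ltW.
  - apply: ler_sum => i _; rewrite /w /y expr_div_n.
    have -> : (c ^+ visits i x = ((rho ^+ visits i x) ^+ k)^-1)%R.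
      by rewrite /c exprVn -!exprM mulnC.
    have := rn (visits i x); move: (rho ^+ visits i x)%R => W W0.
    have Wk : (W ^+ k != 0)%R by rewrite expf_neq0.
    rewrite (exprS W) [leLHS](_ : _ = ((x \in U i)%:R * (W ^+ k)^-1 * B i x ^+ k.+1)%R)//.
    by field; rewrite W0 Wk.
have mBk i : measurable_fun Q (fun x => (x \in U i)%:R * c ^+ visits i x * B i x ^+ k.+1)%R.
  apply: measurable_funM; last exact: measurable_funX.
  apply: measurable_funM => //; apply: (measurable_fun_const_level h0 (j := i)).
  by move=> x Qx y xy; rewrite (visits_level _ Qx xy).
have mk : measurable_fun Q (fun x => (4 * k.+1%:R * K) ^+ k *
    \sum_(i < J) (x \in U i)%:R * c ^+ visits i x * B i x ^+ k.+1)%R.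
  by apply: measurable_funM => //; exact: measurable_sum.
have c0 : (0 <= c)%R by exact: le_trans c1.
apply: (@le_trans _ _ (\int[nu]_(x in Q) ((4 * k.+1%:R * K) ^+ k *
    \sum_(i < J) (x \in U i)%:R * c ^+ visits i x * B i x ^+ k.+1)%:E)).
  apply: le_lower_integral => x _; rewrite lee_fin ?jens// exprn_ge0//.
  by rewrite sumr_ge0// => i _; rewrite mulr_ge0.
have K40 : (0 <= (4 * k.+1%:R * K) ^+ k)%R.
  by rewrite exprn_ge0// !mulr_ge0// ltW.
under eq_integral do rewrite EFinM -sumEFin.
rewrite ge0_integralZl//; last 2 first.
- by apply: emeasurable_sum => i; exact/measurable_EFinP.
- by move=> x _; apply: sume_ge0 => i _; rewrite lee_fin !mulr_ge0// exprn_ge0.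
rewrite EFinM -muleA lee_wpmul2l ?lee_fin//.
apply: (@le_trans _ _ (D%:E * \int[nu]_(x in Q) (visit_sum c x)%:E)); last first.
  rewrite mulrC EFinM -muleA lee_wpmul2l ?lee_fin//.
  exact: integral_visit_sum_le.
under [in leRHS]eq_integral do rewrite /visit_sum -sumEFin.
have mcv (i : nat) : measurable_fun Q (fun x => (x \in U i)%:R * c ^+ visits i x)%R.
  apply: measurable_funM => //; apply: (measurable_fun_const_level h0 (j := i)).
  by move=> x Qx y xy; rewrite (visits_level _ Qx xy).
rewrite !ge0_integral_sum//; last 4 first.
- by move=> i; apply/measurable_EFinP.
- by move=> i x _; rewrite lee_fin mulr_ge0// exprn_ge0.
- by move=> i; apply/measurable_EFinP.
- by move=> i x _; rewrite lee_fin !mulr_ge0// exprn_ge0.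
rewrite ge0_sume_distrr; last first.
  by move=> i _; apply: integral_ge0 => x _; rewrite lee_fin mulr_ge0// exprn_ge0.
apply: lee_sum => i _; rewrite -ge0_integralZl//; last 2 first.
  exact/measurable_EFinP.
  by move=> x _; rewrite lee_fin mulr_ge0// exprn_ge0.
apply: (le_integral_level_set h0 (level_setT a h0 i)) => //.
- exact/measurable_EFinP.
- by apply: emeasurable_funM => //; exact/measurable_EFinP.
- by move=> x _; rewrite lee_fin !mulr_ge0// exprn_ge0.
- by move=> x _; rewrite mule_ge0 ?lee_fin// mulr_ge0// exprn_ge0.
move=> x Qx; have Sub := subcube_sub h0 Qx (j := i).
have mS : measurable (sub i x) by exact: measurable_subcube.
have [xU|xU] := boolP (x \in U i); last first.
  rewrite integral0_eq; last first.
    by move=> y xy; rewrite (mem_level _ Qx xy)// (negbTE xU) !mul0r.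
  by rewrite integral_ge0// => y _; rewrite mule_ge0 ?lee_fin// mulr_ge0// exprn_ge0.
rewrite (eq_integral (fun y => (c ^+ visits i x)%:E * (B i y ^+ k.+1)%:E)); last first.
  by move=> y /set_mem xy; rewrite (mem_level _ Qx xy)// xU mul1r (visits_level _ Qx xy)// EFinM.
rewrite [leRHS](eq_integral (fun y => (D * c ^+ visits i x)%:E)); last first.
  by move=> y /set_mem xy; rewrite (mem_level _ Qx xy)// xU mul1r (visits_level _ Qx xy).
rewrite ge0_integralZl ?lee_fin ?exprn_ge0//; last 2 first.
- by apply/measurable_EFinP; apply: measurable_funX; exact: measurable_funS (mB i).
- by move=> y _; rewrite lee_fin exprn_ge0.
rewrite integral_cst//= EFinM -muleA muleCA lee_wpmul2l ?lee_fin ?exprn_ge0//.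
by apply: BD => //; exact: set_mem.
Qed.

End carleson.

(** * From sparseness to Carleson packing *)

Section carleson_sparse.
Context (R : realType) (n : nat).
Local Notation V := (n.-tuple R).
Local Notation mu := (lebesgue R n).
Variable nu : {measure set V -> \bar R}.

(* [M] plays the role of the maximal function of [nu] restricted to [P]; it
   need not be measurable. *)
Definition maximal_bound (kappa : R) := forall P : set V, is_cube P ->
  exists M : V -> \bar R, [/\ forall x, 0 <= M x,
    \int[mu]_(x in P) M x <= kappa%:E * nu P &
    forall P' x, is_cube P' -> P' `<=` P -> P' x -> nu P' <= M x * mu P'].

Variables (a : 'I_n -> R) (h : R).
Hypothesis h0 : (0 < h)%R.
Local Notation Q := (cube a h).
Local Notation sub := (subcube a h).

(** Sparseness read on generations: the smaller cubes inside a cube of generation [i] are those of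
    later generations. *)
Definition sparse_levels (eta : R) (J : nat) (U : nat -> set V) :=
  forall i x, (i < J)%N -> U i x ->
  mu (\bigcup_(j in [set j | (i < j < J)%N]) U j `&` sub i x) <=
    (1 - eta)%:E * mu (sub i x).

Hypothesis nuQ : nu Q < +oo.
Variables (J : nat) (U : nat -> set V).
Hypothesis lU : forall i, level_set a h i (U i).

(** The sets [E j] are pairwise disjoint and keep a share [eta] of each cube of generation [j]. So
    [nu] of such a cube is at most [1 / eta] times the integral over its part of [E j] of its mean
    density [r j], which [M] dominates; disjointness merges the sum over [j] into one integral of
    [M]. *)
Lemma carleson_sparse (kappa eta : R) : (0 < eta)%R ->
  maximal_bound kappa -> sparse_levels eta J U ->
  carleson a h nu J U (kappa / eta)%R.
Proof.
move=> eta0 nuM spU i x iJ Ux.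
have Qx : Q x by have [+ _] := lU i; apply.
have [M [M0 MI Msub]] := nuM _ (is_cube_subcube a h0 i x).
have mS j y : measurable (sub j y) by exact: measurable_subcube.
have mQ : measurable Q by exact: measurable_cube.
have mU j : measurable (U j) by exact: measurable_level_set (lU j).
pose L j := \bigcup_(k in [set k | (j < k < J)%N]) U k.
have mL j : measurable (L j) by apply: bigcup_measurable => k _; exact: mU.
(* Each point lies in at most one [E j]: the last level that it visits. *)
pose E j := U j `\` L j.
have mE j : measurable (E j) by exact: measurableD.
pose r j y : R := (fine (nu (sub j y)) / fine (mu (sub j y)))%R.
have r0 j y : (0 <= r j y)%R by rewrite divr_ge0// fine_ge0.
have nu_fin j y : Q y -> nu (sub j y) \is a fin_num.
  move=> Qy; rewrite ge0_fin_numE//; apply: le_lt_trans nuQ; apply: le_measure.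
  - by rewrite inE; exact: mS.
  - by rewrite inE; exact: measurable_cube.
  - exact: subcube_sub.
have rE j y : Q y -> (r j y)%:E * mu (sub j y) = nu (sub j y).
  move=> Qy; rewrite /r lebesgue_subcube//= -EFinM divrK ?fineK ?nu_fin//.
  by rewrite unitfE expf_neq0// gt_eqF// side_gt0.
have mr j : measurable_fun Q (r j).
  apply: (measurable_fun_const_level h0 (j := j)) => y Qy z yz.
  by rewrite /r (eq_subcube h0 Qy yz).
have subQ : sub i x `<=` Q by exact: subcube_sub.
pose g j y : R := (eta^-1 * (\1_(E j) y * r j y))%R.
have eta'0 : (0 <= eta^-1)%R by rewrite invr_ge0 ltW.
have g0 j y : (0 <= g j y)%R by rewrite mulr_ge0// mulr_ge0.
have mg j : measurable_fun (sub i x) (g j).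
  apply: measurable_funM => //; apply: measurable_funM => //.
  exact: measurable_funS (mr j).
have step j : (i <= j < J)%N ->
    nu (U j `&` sub i x) <= \int[mu]_(y in sub i x) (g j y)%:E.
  move=> /andP[ij jJ].
  have lUS : level_set a h j (U j `&` sub i x).
    by apply: level_setI => //; exact: level_set_subcube.
  have mUS := measurable_level_set h0 lUS.
  apply: (@le_trans _ _ (\int[mu]_(y in U j `&` sub i x) (g j y)%:E)); last first.
    apply: ge0_subset_integral => //; first exact/measurable_EFinP.
    by move=> y _; rewrite lee_fin.
  rewrite -[leLHS]mul1e -integral_cst//.
  apply: (le_integral_level_set h0 lUS) => //.
  - apply/measurable_EFinP; exact: measurable_funS (mg j).
  - by move=> y _; rewrite lee_fin.
  move=> y [Uy xy]; have Qy := subQ _ xy.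
  rewrite integral_cst// mul1e.
  rewrite (eq_integral (fun z => (eta^-1 * r j y)%:E * (\1_(E j) z)%:E)); last first.
    move=> z /set_mem yz; rewrite /g -EFinM; congr _%:E.
    have -> : r j z = r j y by rewrite /r (eq_subcube h0 Qy yz).
    by ring.
  rewrite ge0_integralZl//; last 2 first.
  - by apply/measurable_EFinP.
  - by rewrite lee_fin mulr_ge0.
  rewrite integral_indic// -(rE j y Qy).
  have -> : (eta^-1 * r j y)%:E = (r j y)%:E * (eta^-1)%:E by rewrite -EFinM mulrC.
  rewrite -muleA lee_wpmul2l ?lee_fin//.
  have ULe : sub j y `<=` U j by have [_] := lU j; apply.
  have -> : E j `&` sub j y = sub j y `\` L j.
    by apply/seteqP; split=> z; [move=> [[_ ?] ?]|move=> [/[dup] /ULe]].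
  suff : eta%:E * mu (sub j y) <= mu (sub j y `\` L j).
    move=> le; have := @lee_wpmul2l _ (eta^-1)%:E _ _ _ le.
    by rewrite lee_fin muleA -EFinM mulVf ?gt_eqF// mul1e; apply.
  have muS : mu (sub j y) < +oo by rewrite lebesgue_subcube// ltey.
  have -> : mu (sub j y `\` L j) = mu (sub j y) - mu (sub j y `&` L j).
    exact: measureD.
  have := spU _ _ jJ Uy; rewrite setIC -/(L j).
  have : mu (sub j y `&` L j) \is a fin_num.
    rewrite ge0_fin_numE//; apply: le_lt_trans muS.
    by apply: le_measure; rewrite ?inE//; exact: measurableI.
  have := lebesgue_subcube a h0 j y; move: (mu (sub j y)) => s ->.
  move: (mu _) => v; case: v => // v _.
  rewrite -!EFinM -EFinB !lee_fin => vle.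
  move: vle; lra.
apply: (@le_trans _ _ (\sum_(i <= j < J) \int[mu]_(y in sub i x) (g j y)%:E)).
  by rewrite big_nat [leRHS]big_nat; apply: lee_sum => j; exact: step.
rewrite -ge0_integral_sum//; last 2 first.
- by move=> j; apply/measurable_EFinP.
- by move=> j y _; rewrite lee_fin.
rewrite [(kappa / eta)%R]mulrC EFinM -muleA.
apply: (@le_trans _ _ ((eta^-1)%:E * \int[mu]_(y in sub i x) M y)); last first.
  by rewrite lee_wpmul2l// lee_fin.
under eq_integral do rewrite sumEFin -mulr_sumr EFinM.
rewrite ge0_integralZl//; last 2 first.
- apply/measurable_EFinP; apply: measurable_sum => j; apply: measurable_funM => //.
  exact: measurable_funS (mr j).
- by move=> y _; rewrite lee_fin sumr_ge0// => j _; rewrite mulr_ge0.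
rewrite lee_wpmul2l ?lee_fin//; apply: le_lower_integral => y xy.
  by rewrite lee_fin sumr_ge0// => j _; rewrite mulr_ge0.
have Qy := subQ _ xy.
have rM j : (i <= j)%N -> (r j y)%:E <= M y.
  move=> ij; have := Msub (sub j y) y (is_cube_subcube a h0 j y).
  rewrite -(eq_subcube h0 Qx xy) => /(_ (subcube_le h0 Qy ij) (subcube_refl h0 j Qy)).
  rewrite -(rE j y Qy) lee_pmul2r//; last exact: lebesgue_subcube_gt0.
  exact: lebesgue_cube_fin (side_gt0 h0 j).
rewrite big_geq_mkord.
have [[k ik Ek]|noE] := pselect (exists2 k : 'I_J, (i <= k)%N & E k y); last first.
  rewrite big1// => k ik; rewrite indicE memNset ?mul0r// => Ek.
  by apply: noE; exists k.
rewrite (bigD1 k)//= big1 ?addr0.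
  by rewrite indicE mem_set// mul1r rM.
move=> j /andP[ij jk]; rewrite indicE memNset ?mul0r// => Ej.
move: jk; rewrite -(inj_eq val_inj) neq_ltn => /orP[jk|kj].
  by case: Ej => _; apply; exists k; [rewrite /= jk /=|case: Ek].
by case: Ek => _; apply; exists j; [rewrite /= kj /=|case: Ej].
Qed.

End carleson_sparse.

Section lebesgue_maximal_bound.
Context (R : realType) (n : nat).

Lemma maximal_bound_lebesgue : maximal_bound (lebesgue R n) 1.
Proof.
move=> P [a [h h0 ->]]; exists (cst 1); split => //.
- by rewrite integral_cst//; exact: measurable_cube.
- by move=> P' x _ _ _; rewrite mul1e.
Qed.

End lebesgue_maximal_bound.

(** * Stopping cubes and mean oscillation *)

Section dyadic_approximation.
Context (R : realType) (n : nat) (a : 'I_n -> R) (h : R).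
Hypothesis h0 : (0 < h)%R.
Local Notation V := (n.-tuple R).
Local Notation Q := (cube a h).
Local Notation sub := (subcube a h).
Variable rho : {measure set V -> \bar R}.
Hypothesis rhoQ : rho Q < +oo.

Let sd (X D : set V) := ((X `&` Q) `\` D) `|` (D `\` X).

Let approximable (X : set V) := measurable X /\ forall e : R, (0 < e)%R ->
  exists J D, level_set a h J D /\ rho (sd X D) <= e%:E.

Let mQ : measurable Q. Proof. exact: measurable_cube. Qed.

Let msd X D j : measurable X -> level_set a h j D -> measurable (sd X D).
Proof.
move=> mX /(measurable_level_set h0) mD; apply: measurableU.
  by apply: measurableD => //; exact: measurableI.
exact: measurableD.
Qed.

Let approximable0 : approximable set0.
Proof.
split=> // e e0; exists 0%N, set0; split; first exact: level_set0.
by rewrite /sd set0I !set0D setU0 measure0 lee_fin ltW.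
Qed.

Let approximableC X : approximable X -> approximable (~` X).
Proof.
move=> [mX aX]; split=> [|e /aX [J [D [lD De]]]]; first exact: measurableC.
exists J, (Q `\` D); split; first by apply: level_setD => //; exact: level_setT.
apply: le_trans De; apply: le_measure; rewrite ?inE.
- apply: (msd (j := J)); first exact: measurableC.
  by apply: level_setD => //; exact: level_setT.
- exact: msd lD.
move=> x [[[NX Qx] NQD]|[[Qx ND] NNX]].
  by right; split=> //; apply: contrapT => ND; exact: NQD.
by left; split=> //; split=> //; apply: contrapT.
Qed.

Let approximableU X Y : approximable X -> approximable Y ->
  approximable (X `|` Y).
Proof.
move=> [mX aX] [mY aY]; split=> [|e e0]; first exact: measurableU.
have e20 : (0 < e / 2)%R by rewrite divr_gt0.
have [J [D [lD De]]] := aX _ e20; have [J' [D' [lD' De']]] := aY _ e20.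
have lU : level_set a h (maxn J J') (D `|` D').
  apply: level_setU.
    by apply: level_set_le lD => //; exact: leq_maxl.
  by apply: level_set_le lD' => //; exact: leq_maxr.
exists (maxn J J'), (D `|` D'); split => //.
have m1 := msd mX lD; have m2 := msd mY lD'.
apply: (@le_trans _ _ (rho (sd X D `|` sd Y D'))).
  apply: le_measure; rewrite ?inE.
  - by apply: msd lU; exact: measurableU.
  - exact: measurableU.
  move=> x [[[[Xx|Yx] Qx] /not_orP[ND ND']]|[[Dx|D'x] /not_orP[NX NY]]].
  - by left; left.
  - by right; left.
  - by left; right.
  - by right; right.
apply: le_trans (measureU2 _ m1 m2) _.
by apply: le_trans (leeD De De') _; rewrite -EFinD -splitr.
Qed.

(** Finite unions exhaust the countable one, and what they miss has small measure because [rho Q] is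
    finite. *)
Let approximable_bigcup (F : (set V)^nat) : (forall k, approximable (F k)) ->
  approximable (\bigcup_k F k).
Proof.
move=> aF; have mF k : measurable (F k) by case: (aF k).
have mUF : measurable (\bigcup_k F k) by exact: bigcupT_measurable.
split=> // e e0; have e20 : (0 < e / 2)%R by rewrite divr_gt0.
pose P N := \big[setU/set0]_(k < N) F k.
have aP N : approximable (P N).
  by elim: N => [|N IH]; rewrite /P ?big_ord0// big_ord_recr; exact: approximableU.
have mP N : measurable (P N) by case: (aP N).
pose G N := ((\bigcup_k F k) `&` Q) `\` P N.
have mG N : measurable (G N) by apply: measurableD => //; exact: measurableI.
have G0 : \bigcap_N G N = set0.
  apply/seteqP; split=> // x Gx; have [[[k _ Fkx] Qx] _] := Gx 0%N I.
  have [_] := Gx k.+1 I; apply; rewrite /P big_ord_recr /=; by right.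
have cvgG : rho \o G @ \oo --> rho (\bigcap_N G N).
  apply: nonincreasing_cvg_mu => //.
  - apply: le_lt_trans rhoQ; apply: le_measure; rewrite ?inE//.
    by move=> x [[_ Qx] _].
  - by rewrite G0.
  - apply/nonincreasing_seqP => N; apply/subsetPset => x [UQx NP]; split => //.
    by apply: contra_not NP => Px; rewrite /P big_ord_recr /=; left.
have [N GN] : exists N, rho (G N) <= (e / 2)%:E.
  rewrite G0 measure0 in cvgG.
  have /fine_cvgP[_ cG] := cvgG.
  have /cvgrPdist_le/(_ _ e20)[N _ /(_ N (leqnn N))] := cG.
  rewrite /= sub0r normrN => le; exists N.
  have Gfin : rho (G N) \is a fin_num.
    rewrite ge0_fin_numE//; apply: le_lt_trans rhoQ; apply: le_measure.
    + by rewrite inE.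
    + by rewrite inE.
    + by move=> x [[_ Qx] _].
  by rewrite -(fineK Gfin) lee_fin (le_trans _ le)// ler_norm.
have [_ /(_ _ e20)[J [D [lD De]]]] := aP N.
have m2 := msd (mP N) lD.
exists J, D; split=> //; apply: (@le_trans _ _ (rho (G N `|` sd (P N) D))).
  apply: le_measure; rewrite ?inE.
  - exact: msd lD.
  - exact: measurableU.
  move=> x [[[Fx Qx] ND]|[Dx NF]].
    have [Px|NP] := pselect (P N x); last by left.
    by right; left.
  right; right; split=> //; apply: contra_not NF => Px.
  exact: (@bigsetU_bigcup _ F N).
apply: le_trans (measureU2 _ (mG N) m2) _.
by apply: le_trans (leeD GN De) _; rewrite -EFinD -splitr.
Qed.

Let sigma_approximable : sigma_algebra setT approximable.
Proof.
split=> //; first by move=> X; rewrite setTD; exact: approximableC.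
Qed.

Let approximable_level j X : measurable X -> level_set a h j (X `&` Q) -> approximable X.
Proof.
move=> mX lX; split=> // e e0; exists j, (X `&` Q); split=> //.
rewrite (_ : sd _ _ = set0) ?measure0 ?lee_fin ?ltW//.
by rewrite /sd; apply/seteqP; split=> // x [[XQ NXQ]|[[Xx _] NX]].
Qed.

(** Inside [Q] an open half-space is the union of the subcubes that it contains, since their sides
    tend to 0. *)
Let approximable_ray (i : 'I_n) (c : R) :
  approximable [set x | (tnth x i < c)%R].
Proof.
have mX : measurable [set x : V | (tnth x i < c)%R].
  rewrite (_ : mkset _ = [set: V] `&` (@tnth n R)^~ i @^-1` `]-oo, c[%classic).
    by apply: measurable_tnth.
  by apply/seteqP; split => x /=; rewrite in_itv//= => -[].
pose D j := [set x | Q x /\ sub j x `<=` [set x : V | (tnth x i < c)%R]].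
have lD j : level_set a h j (D j).
  split=> [x []//|x [Qx xX] y xy]; split; first exact: subcube_sub xy.
  by rewrite (eq_subcube h0 Qx xy).
have mD j := measurable_level_set h0 (lD j).
suff XE : [set x | (tnth x i < c)%R] `&` Q = \bigcup_j D j.
  have aDj j : approximable (D j).
    apply: (approximable_level (j := j)) => //.
    by apply: level_setI => //; exact: level_setT.
  have [_ aD] := approximable_bigcup aDj.
  split=> // e /aD [J [D' [lD' le]]]; exists J, D'; split=> //.
  apply: le_trans le; apply: le_measure; rewrite ?inE.
  - exact: msd lD'.
  - by apply: msd lD'; exact: bigcupT_measurable.
  have D'Q : D' `<=` Q by case: lD'.
  move=> x [[XQx ND']|[D'x NX]]; [left|right]; split=> //.
    by rewrite -XE; split=> //; case: XQx.
  by rewrite -XE => -[].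
apply/seteqP; split=> [x [/= xc Qx]|x [j _ [Qx xX]]]; last first.
  by split=> //; apply: xX; exact: subcube_refl.
have cx0 : (0 < c - tnth x i)%R by rewrite subr_gt0.
have [j hj] : exists j, (h / 2 ^+ j < c - tnth x i)%R.
  pose N := Num.truncn (h / (c - tnth x i))%R.
  exists N.+1; rewrite ltr_pdivrMr ?exprn_gt0// mulrC -ltr_pdivrMr//.
  apply: lt_trans (truncnS_gt _) _; rewrite -/N -natrX ltr_nat.
  by rewrite ltn_expl.
exists j => //; split=> // y xy /=.
have /andP[x1 x2] := subcube_refl h0 j Qx i.
have /andP[y1 y2] := xy i.
by move: y2 x1 hj; lra.
Qed.

(** The approximable sets form a sigma-algebra containing the half-spaces that generate the Borel
    sets. This takes the place of a covering lemma in the differentiation theorem. *)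
Lemma dyadic_approximation (X : set V) (e : R) : measurable X -> (0 < e)%R ->
  exists J D, level_set a h J D /\
    rho (((X `&` Q) `\` D) `|` (D `\` X)) <= e%:E.
Proof.
move=> mX; suff [_] : approximable X by apply.
move: X mX; apply: smallest_sub => //.
apply: (big_ind (fun G : set (set V) => G `<=` approximable)) => //.
  by move=> F G FP GP X [/FP|/GP].
move=> i _ _ [B mB <-]; rewrite setTI.
have {mB}: (@RGenInftyO.G R).-sigma.-measurable B by rewrite -RGenInftyO.measurableE.
move: B; apply: (@smallest_sub _ _ _ [set B | approximable ((@tnth n R)^~ i @^-1` B)]).
  split=> [|B aB|F aF] /=.
  - by rewrite preimage_set0.
  - by rewrite setTD preimage_setC; exact: approximableC.
  - by rewrite preimage_bigcup; exact: approximable_bigcup.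
move=> _ [c ->] /=; have := approximable_ray i c; congr approximable.
Qed.

End dyadic_approximation.

(** * Differentiation along dyadic subcubes *)

Section dyadic_maximal_lower_bound.
Context (R : realType) (n : nat) (a : 'I_n -> R) (h : R).
Hypothesis h0 : (0 < h)%R.
Local Notation V := (n.-tuple R).
Local Notation mu := (lebesgue R n).
Local Notation Q := (cube a h).
Local Notation sub := (subcube a h).
Variable g : V -> R.
Hypothesis mg : measurable_fun setT g.
Hypothesis g0 : forall x, (0 <= g x)%R.
Hypothesis gQ : \int[mu]_(x in Q) (g x)%:E < +oo.

Let mQ : measurable Q. Proof. exact: measurable_cube. Qed.

Let E (t : R) := [set x | Q x /\
  forall j, \int[mu]_(y in sub j x) (g y)%:E <= t%:E * mu (sub j x)].

Let lE j t : level_set a h j [set x | Q x /\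
  \int[mu]_(y in sub j x) (g y)%:E <= t%:E * mu (sub j x)].
Proof.
split=> [x []//|x [Qx xt] y xy]; split; first exact: subcube_sub xy.
by rewrite (eq_subcube h0 Qx xy).
Qed.

Let mE t : measurable (E t).
Proof.
rewrite (_ : E t = \bigcap_j [set x | Q x /\
  \int[mu]_(y in sub j x) (g y)%:E <= t%:E * mu (sub j x)]).
  by apply: bigcapT_measurable => j; exact: measurable_level_set (lE j t).
apply/seteqP; split=> [x [Qx xt] j _|x Ex]; first by split.
by split=> [|j]; [case: (Ex 0%N I)|case: (Ex j I)].
Qed.

Let mge s : measurable [set x | (s <= g x)%R].
Proof.
rewrite (_ : mkset _ = [set: V] `&` g @^-1` `[s, +oo[%classic); first exact: mg.
by apply/seteqP; split => x /=; rewrite in_itv/= andbT// => -[].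
Qed.

(** Cover [A] by a level set up to a small error and keep only the subcubes that meet [E t], on
    which [g] has average at most [t]. Hence the integral of [g] over [A] is at most [t * mu A],
    whereas it is at least [s * mu A]. *)
Let negligible_level t s : (0 <= t)%R -> (t < s)%R ->
  mu (E t `&` [set x | (s <= g x)%R]) = 0.
Proof.
move=> t0 ts; set A := E t `&` _.
have mA : measurable A by exact: measurableI.
have AQ : A `<=` Q by move=> x [[]].
have mgD (B : set V) : measurable_fun B (EFin \o g).
  by apply/measurable_EFinP; exact: measurable_funTS.
have mg1 : measurable_fun setT (fun x => g x + 1)%R by exact: measurable_funD.
have g10 x : (0 <= g x + 1)%R by rewrite addr_ge0.
(* With density [g + 1], a single small quantity controls both the Lebesgue measure of the error and
   the integral of [g] over it. *)
pose rho := wmeasure mu mg1 g10.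
have rho_ge B : measurable B -> mu B <= rho B /\ \int[mu]_(x in B) (g x)%:E <= rho B.
  move=> mB; rewrite /rho wmeasureE; split.
    rewrite -[leLHS]mul1e -integral_cst//; apply: le_lower_integral => x _ //=.
    by rewrite lee_fin lerDr.
  by apply: le_lower_integral => x _; rewrite lee_fin// lerDl.
have muQ : mu Q < +oo by rewrite -ge0_fin_numE// lebesgue_cube_fin.
have rhoQ : rho Q < +oo.
  rewrite /rho wmeasureE; under eq_integral do rewrite EFinD.
  rewrite ge0_integralD//; last by move=> x _; rewrite lee_fin.
  by rewrite integral_cst// mul1e lte_add_pinfty.
have muA_fin : mu A \is a fin_num.
  by rewrite ge0_fin_numE//; apply: le_lt_trans muQ; apply: le_measure; rewrite ?inE.
have key : \int[mu]_(x in A) (g x)%:E <= t%:E * mu A.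
  apply/lee_addgt0Pr => e e0.
  have t10 : (0 < t + 1)%R by rewrite ltr_pwDr.
  (* The error is paid once through the integral of [g] and [t] times through the measure, hence the
     division by [t + 1]. *)
  have [J [D [lD]]] := dyadic_approximation h0 rhoQ mA (divr_gt0 e0 t10).
  rewrite setIidl//; set X := A `\` D; set Y := D `\` A => XY.
  have mD := measurable_level_set h0 lD.
  have mX : measurable X by exact: measurableD.
  have mY : measurable Y by exact: measurableD.
  have [DQ DD] := lD.
  pose D' := [set x | D x /\ sub J x `&` E t !=set0].
  have lD' : level_set a h J D'.
    split=> [x [/DQ]//|x [Dx xE] y xy]; split; first exact: DD xy.
    by rewrite (eq_subcube h0 (DQ _ Dx) xy).
  have mD' := measurable_level_set h0 lD'.
  have rX : \int[mu]_(x in X) (g x)%:E <= rho (X `|` Y).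
    by apply: le_trans (rho_ge _ mX).2 _; apply: le_measure; rewrite ?inE//;
      exact: measurableU.
  have rY : mu Y <= rho (X `|` Y).
    by apply: le_trans (rho_ge _ mY).1 _; apply: le_measure; rewrite ?inE//;
      exact: measurableU.
  have iD' : \int[mu]_(x in D') (g x)%:E <= t%:E * mu D'.
    rewrite -integral_cst//; apply: (le_integral_level_set h0 lD') => //.
    - by move=> x _; rewrite lee_fin.
    - move=> x [Dx [y [xy [Qy Ey]]]].
      rewrite integral_cst; last exact: measurable_subcube.
      by rewrite -(eq_subcube h0 (DQ _ Dx) xy).
  have AU : A `<=` D' `|` X.
    move=> x Ax; have [Dx|ND] := pselect (D x); last by right.
    left; split=> //; exists x; split; last by case: Ax.
    exact/subcube_refl/AQ.
  have D'A : mu D' <= mu A + mu Y.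
    apply: le_trans (measureU2 _ mA mY); apply: le_measure; rewrite ?inE//.
      exact: measurableU.
    by move=> x [Dx _]; have [Ax|NA] := pselect (A x); [left|right].
  have s1 : \int[mu]_(x in A) (g x)%:E <=
      \int[mu]_(x in D') (g x)%:E + \int[mu]_(x in X) (g x)%:E.
    apply: (@le_trans _ _ (\int[mu]_(x in D' `|` X) (g x)%:E)).
      apply: ge0_subset_integral => //; first exact: measurableU.
      by move=> x _; rewrite lee_fin.
    rewrite ge0_integral_setU//.
      by move=> x _; rewrite lee_fin.
    apply/disj_setPS => x [[Dx _] [_ ND]]; exact: ND.
  apply: le_trans s1 _; apply: le_trans (leeD iD' rX) _.
  have : t%:E * mu D' <= t%:E * (mu A + rho (X `|` Y)).
    by rewrite lee_wpmul2l ?lee_fin//; apply: le_trans D'A _; rewrite leeD2l.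
  have D'fin : mu D' \is a fin_num.
    rewrite ge0_fin_numE//; apply: le_lt_trans muQ; apply: le_measure; rewrite ?inE//.
    by case: lD'.
  have rho0 : 0 <= rho (X `|` Y) by exact: measure_ge0.
  move: rho0 XY D'fin muA_fin; move: (rho _) (mu A) (mu D') => r v v'.
  case: r => // r; case: v => // v; case: v' => // v' + + _ _.
  rewrite -!EFinM -!EFinD !lee_fin => r0 re vr.
  have rt : (r * (t + 1) <= e)%R by rewrite -ler_pdivlMr.
  apply: le_trans (lerD vr (lexx r)) _; rewrite mulrDr -addrA lerD2l.
  by apply: le_trans rt; rewrite mulrDr mulr1 mulrC.
have sA : s%:E * mu A <= \int[mu]_(x in A) (g x)%:E.
  rewrite -integral_cst//; apply: le_lower_integral => x /=.
    by move=> _; rewrite lee_fin ltW// (le_lt_trans t0).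
  by move=> [_ /= sg]; rewrite lee_fin.
have := le_trans sA key; have : 0 <= mu A by [].
move: muA_fin; case: (mu A) => // v _; rewrite -!EFinM !lee_fin => v0 stv.
congr _%:E; apply/eqP; rewrite eq_le v0 andbT.
have st0 : (0 < s - t)%R by rewrite subr_gt0.
by rewrite -(pmulr_rle0 _ st0) mulrBl subr_le0.
Qed.

(* The lower half of the Lebesgue differentiation theorem. *)
Theorem ae_le_dyadic_averages : {ae mu, forall x, Q x -> forall t : R,
  (forall j, \int[mu]_(y in sub j x) (g y)%:E <= t%:E * mu (sub j x)) ->
  (g x <= t)%R}.
Proof.
(* Rational levels between [t] and [g x] make the exceptional set a countable union. *)
pose F k := if @unpickle (rat * rat)%type k is Some q then
  if (0 <= ratr q.1 :> R)%R && (ratr q.1 < ratr q.2 :> R)%R then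
    E (ratr q.1) `&` [set x | (ratr q.2 <= g x)%R] else set0 else set0.
have nF k : mu.-negligible (F k).
  rewrite /F; case: unpickle => [q|]; last exact: negligible_set0.
  case: ifP => [/andP[q0 q12]|_]; last exact: negligible_set0.
  apply/negligibleP; last exact: negligible_level.
  exact: measurableI.
apply: (@negligibleS _ _ _ mu _ _ _ (negligible_bigcup nF)).
move=> x /= /not_implyP[Qx /existsNP[t /not_implyP[xt /negP]]]; rewrite -ltNge.
move=> /rat_in_itvoo[s]; rewrite in_itv /= => /andP[ts sg].
move: ts => /rat_in_itvoo[r]; rewrite in_itv /= => /andP[tr rs].
have t0 : (0 <= t)%R.
  have := xt 0%N; move: (lebesgue_subcube_gt0 a h0 0 x); move: (mu _) => m m0.
  move=> le; rewrite -lee_fin -(pmule_lge0 _ m0); apply: le_trans le.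
  by apply: integral_ge0 => y _; rewrite lee_fin.
have FE : F (pickle (r, s)) = E (ratr r) `&` [set x | (ratr s <= g x)%R].
  by rewrite /F pickleK ifT// (le_trans t0 (ltW tr)).
exists (pickle (r, s)); rewrite ?FE//; split; last exact: ltW.
split=> // j; apply: le_trans (xt j) _.
by rewrite lee_wpmul2r// lee_fin ltW.
Qed.

End dyadic_maximal_lower_bound.

(** * Averages and mean oscillation on cubes *)

Section mean_oscillation.
Context (R : realType) (n : nat).
Local Notation V := (n.-tuple R).
Local Notation mu := (lebesgue R n).
Implicit Types (P : set V) (b : V -> R).

Lemma measurable_is_cube P : is_cube P -> measurable P.
Proof. by move=> [a [h h0 ->]]; exact: measurable_cube. Qed.

Lemma is_cube_gt0 P : is_cube P -> 0 < mu P.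
Proof. by move=> [a [h h0 ->]]; exact: lebesgue_cube_gt0. Qed.

Lemma is_cube_fin P : is_cube P -> mu P \is a fin_num.
Proof. by move=> [a [h h0 ->]]; exact: lebesgue_cube_fin. Qed.

Lemma avg_mul P (g : V -> \bar R) : is_cube P ->
  avg P g * mu P = \int[mu]_(x in P) g x.
Proof.
move=> cP; have := is_cube_gt0 cP; have := is_cube_fin cP; rewrite /avg.
case: (mu P) => // m _; rewrite lte_fin => m0.
by rewrite -muleA inver gt_eqF// -EFinM mulVf ?gt_eqF// mule1.
Qed.

Lemma avg_le P (g : V -> \bar R) (c : \bar R) : is_cube P ->
  (avg P g <= c) = (\int[mu]_(x in P) g x <= c * mu P).
Proof.
move=> cP; rewrite -(avg_mul g cP).
by rewrite lee_pmul2r//; [exact: is_cube_fin|exact: is_cube_gt0].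
Qed.

Lemma avg_ge0 P (g : V -> \bar R) : (forall x, P x -> 0 <= g x) -> 0 <= avg P g.
Proof.
move=> g0; rewrite /avg mule_ge0 ?inve_ge0 ?measure_ge0//; exact: integral_ge0.
Qed.

Lemma measurable_loc_osc b P c : loc_integrable b ->
  measurable_fun P (fun x => `|b x - c|%:E : \bar R).
Proof.
move=> [mb _]; apply/measurable_EFinP/measurableT_comp => //.
by apply: measurable_funB => //; exact: measurable_funTS.
Qed.

Lemma BMO_osc b (beta : \bar R) P : BMO_norm b <= beta -> is_cube P ->
  \int[mu]_(x in P) `|b x - mean b P|%:E <= beta * mu P.
Proof.
move=> bb cP; rewrite -avg_le//; apply: le_trans bb.
by apply: ereal_sup_ubound; exists P.
Qed.

Lemma mean_diff_le b P (c : R) : loc_integrable b -> is_cube P ->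
  `|mean b P - c|%:E * mu P <= \int[mu]_(x in P) `|b x - c|%:E.
Proof.
move=> lb cP; have mP := measurable_is_cube cP.
have [mb /(_ P cP) bP] := lb.
have ic : mu.-integrable P (EFin \o cst c).
  have [a [h h0 PE]] := cP; apply/integrableP; split.
    by apply/measurable_EFinP; exact: measurable_cst.
  rewrite [ltLHS](_ : _ = `|c|%:E * mu P); last by rewrite -integral_cst.
  by rewrite PE lebesgue_cube ?ltW// -EFinM ltry.
apply: (@le_trans _ _ `|\int[mu]_(x in P) (b x - c)%:E|); last first.
  apply: (le_trans (le_abse_integral _ mP _)); last first.
    by apply: le_lower_integral => x _.
  by apply/measurable_EFinP; apply: measurable_funB => //; exact: measurable_funTS.
have -> : \int[mu]_(x in P) (b x - c)%:E = (mean b P - c)%:E * mu P.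
  under eq_integral do rewrite EFinB.
  have ci : \int[mu]_(x in P) c%:E = c%:E * mu P by rewrite -integral_cst.
  rewrite (integralB_EFin mP bP ic) /= ci EFinB muleBl//; last first.
    exact: is_cube_fin.
  congr (_ - _); rewrite /mean fineK; first by rewrite avg_mul.
  have [a [h h0 PE]] := cP.
  rewrite /avg fin_numM//; first exact: integrable_fin_num.
  by rewrite PE lebesgue_cube ?ltW// inver gt_eqF// exprn_gt0.
by rewrite abseM (gee0_abs (measure_ge0 _ _)).
Qed.

End mean_oscillation.

(** * Calderon-Zygmund stopping cubes *)

Section stopping.
Context (R : realType) (n : nat) (b : n.-tuple R -> R) (beta : R).
Local Notation V := (n.-tuple R).
Local Notation mu := (lebesgue R n).
Hypothesis lb : loc_integrable b.
Hypothesis beta0 : (0 <= beta)%R.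
Hypothesis b_beta : BMO_norm b <= beta%:E.
Variables (a : 'I_n -> R) (h : R).
Hypothesis h0 : (0 < h)%R.
Local Notation Q := (cube a h).
Local Notation sub := (subcube a h).

(* Calderon-Zygmund stopping: the generation of the smallest stopping cube
   containing the generation [j] subcube of [x]. *)
Fixpoint stop j (x : V) : nat := if j is i.+1 then
    if (2 * beta)%:E * mu (sub j x) <
       \int[mu]_(y in sub j x) `|b y - mean b (sub (stop i x) x)|%:E
    then j else stop i x
  else 0.

Lemma stop_le j x : (stop j x <= j)%N.
Proof. by elim: j => //= j IH; case: ifP => // _; exact: leqW. Qed.

Lemma stop_nd i j x : (i <= j)%N -> (stop i x <= stop j x)%N.
Proof.
elim: j => [|j IH]; first by rewrite leqn0 => /eqP ->.
rewrite leq_eqVlt => /predU1P[->//|]; rewrite ltnS => /IH ij /=.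
by case: ifP => // _; rewrite (leq_trans ij)// leqW// stop_le.
Qed.

Lemma stop_level j x y : Q x -> sub j x y -> stop j y = stop j x.
Proof.
elim: j => //= j IH Qx xy.
have xy' : sub j x y by exact: (subcube_le h0 Qx (leqnSn j)).
rewrite (IH Qx xy') (eq_subcube h0 Qx xy).
rewrite (eq_subcube (j := stop j x) h0 Qx)//.
by apply: (subcube_le h0 Qx _ xy'); exact: stop_le.
Qed.

Definition stopped j := [set x | Q x /\ stop j x = j].

Lemma level_stopped j : level_set a h j (stopped j).
Proof.
split=> [x []//|x [Qx xj] y xy]; split; first exact: subcube_sub xy.
by rewrite (stop_level Qx xy).
Qed.

Definition count j x := visits stopped j.+1 x.

Lemma count_nd i j x : (i <= j)%N -> (count i x <= count j x)%N.
Proof.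
move=> ij; rewrite /count /visits.
rewrite (big_ord_widen j.+1 (fun k : nat => (x \in stopped k) : nat))//.
by rewrite [leqRHS](bigID (fun k : 'I_j.+1 => (k < i.+1)%N)) /= leq_addr.
Qed.

Lemma count0 x : Q x -> count 0 x = 1%N.
Proof. by move=> Qx; rewrite /count /visits big_ord1 mem_set. Qed.

Lemma count_gt0 j x : Q x -> (0 < count j x)%N.
Proof. by move=> Qx; apply: leq_trans (count_nd x (leq0n j)); rewrite count0. Qed.

Let osc j x (c : R) := \int[mu]_(y in sub j x) `|b y - c|%:E.

(** Either the subcube has just stopped, and the BMO bound applies to its own mean, or it has not,
    and the bound is the failure of the stopping condition. *)
Let osc_stop j x : Q x ->
  osc j x (mean b (sub (stop j x) x)) <= (2 * beta)%:E * mu (sub j x).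
Proof.
move=> Qx; have BMOsub i : osc i x (mean b (sub i x)) <= (2 * beta)%:E * mu (sub i x).
  apply: le_trans (BMO_osc b_beta (is_cube_subcube a h0 i x)) _.
  by rewrite lee_wpmul2r// lee_fin mulr_natl mulr2n lerDl.
case: j => [|j]; first exact: BMOsub.
rewrite /=; case: ifPn => [_|]; first exact: BMOsub.
by rewrite -leNgt.
Qed.

Let subS j x : mu (sub j x) = (2 ^+ n)%:E * mu (sub j.+1 x).
Proof.
rewrite !lebesgue_subcube// -EFinM -exprMn; congr (_ ^+ _)%:E.
by rewrite exprS invfM mulrCA mulVKf.
Qed.

(** The mean changes only at a new stop. The parent of the new cube oscillates by at most [2 * beta]
    about the previous mean, and passing to a child costs [2 ^+ n]. The [- 1] is for [Q] itself,
    which is counted as a stopping cube. *)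
Lemma mean_stop_le j x : Q x ->
  (`|mean b (sub (stop j x) x) - mean b Q| <=
     2 ^+ n.+1 * beta * ((count j x)%:R - 1))%R.
Proof.
move=> Qx; elim: j => [|j IH] /=.
  by rewrite subcube0// subrr normr0 count0// subrr mulr0.
have countS : (count j.+1 x = count j x + (stop j.+1 x == j.+1))%N.
  rewrite /count /visits big_ord_recr /=; congr (_ + _)%N; congr nat_of_bool.
  by apply/idP/eqP => [/set_mem[]//|xj]; apply/mem_set.
rewrite countS /= natrD addrAC mulrDr; case: ifPn => [_|_]; last first.
  by rewrite ltn_eqF ?ltnS ?stop_le// mulr0 addr0.
rewrite eqxx mulr1 -(subrK (mean b (sub (stop j x) x)) (mean b (sub j.+1 x))).
rewrite -addrA addrC; apply: le_trans (ler_normD _ _) _; apply: lerD => //.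
have muS : 0 < mu (sub j.+1 x) by exact: lebesgue_subcube_gt0.
rewrite -lee_fin -(@lee_pmul2r _ (mu (sub j.+1 x)))//; last first.
  exact: lebesgue_cube_fin (side_gt0 h0 _).
apply: le_trans (mean_diff_le _ lb (is_cube_subcube a h0 j.+1 x)) _.
apply: (@le_trans _ _ (osc j x (mean b (sub (stop j x) x)))).
  apply: ge0_subset_integral => //.
  - exact: measurable_subcube.
  - exact: measurable_subcube.
  - exact: measurable_loc_osc.
  - exact: subcube_le.
apply: le_trans (osc_stop j Qx) _; rewrite subS muleA -EFinM.
by rewrite exprS -[(2 * 2 ^+ n * _)%R]mulrA [(2 ^+ n * beta)%R]mulrC mulrA.
Qed.

Lemma osc_count_le j x : Q x ->
  osc j x (mean b Q) <= (2 ^+ n.+1 * beta * (count j x)%:R)%:E * mu (sub j x).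
Proof.
move=> Qx; set c := mean b (sub (stop j x) x); set m := mean b Q.
have mS : measurable (sub j x) by exact: measurable_subcube.
apply: (@le_trans _ _ (\int[mu]_(y in sub j x) (`|b y - c|%:E + `|c - m|%:E))).
  apply: le_lower_integral => y _; first by rewrite lee_fin.
  by rewrite -EFinD lee_fin -(subrKA c (b y) (- m)%R) ler_normD.
rewrite ge0_integralD//; last exact: measurable_loc_osc.
rewrite integral_cst//.
have le1 := osc_stop j Qx; have le2 := mean_stop_le j Qx.
have : `|c - m|%:E * mu (sub j x) <=
    (2 ^+ n.+1 * beta * ((count j x)%:R - 1))%:E * mu (sub j x).
  by rewrite lee_wpmul2r// lee_fin.
move=> le3; apply: le_trans (leeD le1 le3) _.
rewrite -muleDl ?lebesgue_subcube// -EFinD -!EFinM lee_fin.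
rewrite ler_wpM2r ?exprn_ge0 ?(ltW (side_gt0 h0 _))//.
rewrite mulrBr mulr1 addrCA gerDl subr_le0 ler_wpM2r//.
by rewrite exprS ler_peMr// exprn_ege1// ler1n.
Qed.

(** If the bound failed for every [L], all dyadic averages of [|b - mean b Q|] at [x] would be at
    most half its value there, contrary to the differentiation theorem. The exponent [n.+2] in place
    of [n.+1] supplies this half. *)
Lemma ae_osc_le_count : {ae mu, forall x, Q x ->
  exists L, (`|b x - mean b Q| <= 2 ^+ n.+2 * beta * (count L x)%:R)%R}.
Proof.
pose g x := `|b x - mean b Q|%R.
have mg : measurable_fun setT g.
  by have := @measurable_loc_osc _ _ b setT (mean b Q) lb; move/measurable_EFinP.
have cQ : is_cube Q by exists a, h.
have gQ : \int[mu]_(x in Q) (g x)%:E < +oo.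
  apply: le_lt_trans (BMO_osc b_beta cQ) _.
  by rewrite lte_mul_pinfty ?lee_fin// -ge0_fin_numE// lebesgue_cube_fin.
have g0 x : (0 <= g x)%R by exact: normr_ge0.
apply: filterS (ae_le_dyadic_averages h0 mg g0 gQ) => x + Qx => /(_ Qx) avg_le.
apply: contrapT => /forallNP gt.
have {}gt L : (2 ^+ n.+2 * beta * (count L x)%:R < g x)%R.
  by rewrite ltNge; apply/negP => /gt.
have gx0 : (0 < g x)%R 
  by apply: le_lt_trans (gt 0%N); rewrite mulr_ge0// mulr_ge0// exprn_ge0.
have : (g x <= g x / 2)%R.
  apply: avg_le => j; apply: le_trans (osc_count_le j Qx) _.
  rewrite lee_wpmul2r// lee_fin ler_pdivlMr//.
  apply: le_trans (ltW (gt j)); rewrite [in leRHS]exprS.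
  by rewrite [leLHS]mulrC !mulrA.
by rewrite leNgt ltr_pdivrMr// ltr_pMr// ltr1n.
Qed.

(** The stopping children of [sub i x] in generation [j]: the last stop before [j] is at [i]. *)
Let next i j x := [set y | [/\ sub i x y, stop j y = j & stop j.-1 y = i]].

Let nextP i j x : (i < j)%N -> Q x -> stop i x = i ->
  level_set a h j (next i j x) /\
  forall y, next i j x y ->
    (2 * beta)%:E * mu (sub j y) < osc j y (mean b (sub i x)).
Proof.
case: j => // j; rewrite ltnS => ij Qx xi.
have ijS : (i <= j.+1)%N by exact: leqW.
have sQ : sub i x `<=` Q by exact: subcube_sub.
split.
  split=> [y [xy _ _]|y [xy yj yi] z yz]; first exact: sQ.
  have Qy := sQ _ xy; have yz' : sub j y z by exact: (subcube_le h0 Qy (leqnSn j)).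
  split.
  - rewrite -(eq_subcube h0 Qx xy); exact: (subcube_le h0 Qy ijS).
  - by rewrite (stop_level Qy yz).
  - by rewrite /= (stop_level Qy yz').
move=> y [xy /= + /= yi]; rewrite yi; case: ifP => [+ _|_ ijE].
  by rewrite (eq_subcube h0 Qx xy).
by move: ij; rewrite ijE ltnn.
Qed.

(** Every deeper stopping cube lies in a stopping child. The children are disjoint, and on each the
    integral of [|b - c|] exceeds [2 * beta] times the measure, while over [sub i x] it is at most
    [beta] times the measure; so they fill at most half. *)
Lemma sparse_stopped J : sparse_levels a h 2^-1 J stopped.
Proof.
move=> i x iJ [Qx xi]; set c := mean b (sub i x).
have mS : measurable (sub i x) by exact: measurable_subcube.
have sQ : sub i x `<=` Q by exact: subcube_sub.
have oscx : osc i x c <= beta%:E * mu (sub i x).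
  exact: (BMO_osc b_beta (is_cube_subcube a h0 i x)).
have mosc (D : set V) : measurable_fun D (fun y => `|b y - c|%:E : \bar R).
  exact: measurable_loc_osc.
have mnext j : (i < j)%N -> measurable (next i j x).
  by move=> ij; have [+ _] := nextP ij Qx xi; exact: measurable_level_set.
have dnext j k y : (i < j)%N -> (j < k)%N -> next i j x y -> next i k x y -> False.
  move=> ij jk [_ yj _] [_ _ yk].
  have : (stop j y <= stop k.-1 y)%N by apply: stop_nd; rewrite -ltnS (ltn_predK jk).
  by rewrite yj yk leqNgt ij.
pose s := [seq j <- index_iota 0 J | (i < j)%N].
have sij j : j \in s -> (i < j)%N by rewrite mem_filter => /andP[].
pose N j := if (i < j)%N then next i j x else set0.
have mN j : measurable (N j) by rewrite /N; case: ifPn => // /mnext.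
pose W := \big[setU/set0]_(j <- s) N j.
have mW : measurable W by apply: bigsetU_measurable => j _.
have cover : \bigcup_(j in [set j | (i < j < J)%N]) stopped j `&` sub i x `<=` W.
  move=> y [[k /= /andP[ik kJ] [Qy yk]] xy].
  (* Follow the generations from [i] to [k]: either no stop has occurred since [i], or the first one
     is a stopping child. *)
  suff [yi|[j /andP[ij jk] Nj]] : stop k y = i \/ exists2 j, (i < j <= k)%N & next i j x y.
  - by move: ik; rewrite -{1}yi yk ltnn.
  - rewrite /W -bigcup_seq; exists j; last by rewrite /N ij.
    by rewrite /= mem_filter ij mem_index_iota (leq_ltn_trans jk).
  have yi : stop i y = i by rewrite (stop_level Qx xy).
  have := ltnW ik; elim: k {ik kJ yk} => [|k IH].
    by rewrite leqn0 => /eqP i0; left; rewrite -i0.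
  rewrite leq_eqVlt => /predU1P[<-|ik]; first by left.
  have [yk|[j /andP[ij jk] Nj]] := IH ik; last first.
    by right; exists j => //; rewrite ij leqW.
  have [ykS|ykS] := eqVneq (stop k.+1 y) k.+1.
    by right; exists k.+1; [rewrite ik leqnn|split].
  by left; move: ykS => /=; case: ifP => //; rewrite eqxx.
have tN : trivIset [set` s] N.
  move=> j k /sij ij /sij ik [y [+ +]]; rewrite /N ij ik => Nj Nk.
  have [jk|kj|//] := ltngtP j k; exfalso; first exact: (dnext j k y).
  exact: (dnext k j y).
have us : uniq s by rewrite filter_uniq// iota_uniq.
have WS : W `<=` sub i x.
  move=> y; rewrite /W -bigcup_seq => -[j /sij ij]; rewrite /N ij.
  by case.
have osc_W : \int[mu]_(y in W) `|b y - c|%:E <= beta%:E * mu (sub i x).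
  by apply: le_trans oscx; apply: ge0_subset_integral.
have mC : measurable (\bigcup_(j in [set j | (i < j < J)%N]) stopped j `&` sub i x).
  apply: measurableI => //; apply: bigcup_measurable => j _.
  exact: measurable_level_set (level_stopped j).
apply: (@le_trans _ _ (mu W)); first by apply: le_measure; rewrite ?inE.
have muS_fin : mu (sub i x) \is a fin_num by exact: lebesgue_cube_fin (side_gt0 h0 i).
have W_fin : mu W \is a fin_num.
  rewrite ge0_fin_numE//; apply: (@le_lt_trans _ _ (mu (sub i x))).
    by apply: le_measure; rewrite ?inE.
  by rewrite -ge0_fin_numE.
(* The comparison divides by [beta]. If [beta = 0], there is no oscillation on [sub i x] and hence
   no stopping child. *)
have [beta_gt0|] := ltP 0%R beta; last first.
  move=> b0; have {}b0 : beta = 0%R by apply/eqP; rewrite eq_le b0.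
  suff -> : W = set0 by rewrite measure0 mule_ge0// lee_fin; lra.
  apply/seteqP; split=> // y Wy; have xy := WS _ Wy.
  move: Wy; rewrite /W -bigcup_seq => -[j /sij ij]; rewrite /N ij => Nj.
  have [lN /(_ y Nj)] := nextP ij Qx xi.
  rewrite b0 mulr0 mul0e ltNge => /negP; apply.
  apply: le_trans (_ : osc i x c <= 0); last by move: oscx; rewrite b0 mul0e.
  apply: ge0_subset_integral => //.
  - exact: measurable_subcube.
  - by rewrite -(eq_subcube h0 Qx xy); apply: subcube_le (sQ _ xy) (ltnW ij).
have two : (2 * beta)%:E * mu W <= beta%:E * mu (sub i x).
  apply: le_trans osc_W; rewrite -integral_cst// /W.
  rewrite [leLHS]ge0_integral_bigsetU//; last first.
    by move=> y _; rewrite /= lee_fin mulr_ge0.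
  rewrite ge0_integral_bigsetU//.
  rewrite big_seq [leRHS]big_seq; apply: lee_sum => j /sij ij.
  rewrite /N ij; have [lN yN] := nextP ij Qx xi.
  apply: (le_integral_level_set h0 lN) => //.
    by move=> y _; rewrite /= lee_fin mulr_ge0.
  move=> y Ny; rewrite integral_cst; last exact: measurable_subcube.
  by apply: ltW; exact: yN.
move: two; rewrite -(fineK muS_fin) -(fineK W_fin) -!EFinM !lee_fin.
move: (fine (mu W)) (fine (mu (sub i x))) => u v.
by rewrite [(2 * beta)%R]mulrC -mulrA ler_pM2l// => uv; lra.
Qed.

End stopping.

(** * Exponential and weighted moments of the stopping count *)

Section counting.
Context (R : realType) (n : nat).
Local Notation V := (n.-tuple R).
Local Notation mu := (lebesgue R n).

(* [N L] counts the stopping cubes of generation at most [L]; this replaces the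
   John-Nirenberg inequality for Lebesgue measure and for A_infinity weights. *)
Theorem john_nirenberg_count (b : V -> R) (beta : R) (Q : set V) :
  loc_integrable b -> (0 <= beta)%R -> BMO_norm b <= beta%:E -> is_cube Q ->
  exists N : nat -> V -> nat,
  [/\ forall x, {homo N ^~ x : i j / (i <= j)%N},
      forall L x, Q x -> (0 < N L x)%N,
      forall L, measurable_fun Q (fun x => (N L x)%:R : R),
      {ae mu, forall x, Q x ->
        exists L, (`|b x - mean b Q| <= 2 ^+ n.+2 * beta * (N L x)%:R)%R} &
      (forall L, \int[mu]_(x in Q) ((5 / 4) ^+ N L x)%:E <= 2%:E * mu Q) /\
      forall (nu : {measure set V -> \bar R}) (kappa : R), (1 <= kappa)%R ->
        nu Q < +oo -> maximal_bound nu kappa -> forall k L,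
        \int[nu]_(x in Q) ((N L x)%:R ^+ k.+1)%:E <=
          ((8 * k.+1%:R * kappa) ^+ k * (4 * kappa))%:E * nu Q].
Proof.
move=> lb beta0 bb [a [h h0 ->]].
pose U := stopped b beta a h.
have lU : forall i, level_set a h i (U i) by move=> i; exact: level_stopped.
have mQ : measurable (cube a h) by exact: measurable_cube.
have muQ : mu (cube a h) < +oo by rewrite -ge0_fin_numE// lebesgue_cube_fin.
have cU (nu : {measure set V -> \bar R}) (kappa : R) : nu (cube a h) < +oo -> maximal_bound nu kappa -> forall J,
    carleson a h nu J U (2 * kappa)%R.
  move=> nuQ Mnu J; rewrite mulrC -[X in (_ * X)%R]invrK.
  by apply: carleson_sparse => //; exact: sparse_stopped.
have Omega_le (nu : {measure set V -> \bar R}) J : nu (\bigcup_(i in `I_J) U i) <= nu (cube a h).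
  apply: le_measure; rewrite ?inE//; first exact: (measurable_visited h0 J lU).
  exact: visited_sub.
exists (fun L x => count b beta a h L x); split.
- by move=> x i j; exact: count_nd.
- by move=> L x; exact: count_gt0.
- move=> L; apply: (measurable_fun_const_level h0 (j := L.+1)) => x Qx y xy.
  by congr _%:R; exact: (visits_level h0 lU (leqnn _) Qx xy).
- exact: ae_osc_le_count.
split=> [L|nu kappa k1 nuQ Mnu k L].
  have E x : (((5 / 4) ^+ count b beta a h L x)%:E = 1 + (4^-1)%:E * (visit_sum L.+1 U (5 / 4) x)%:E :> \bar R).
    rewrite -EFinM -EFinD; congr _%:E.
    have := sum_visits (fun i => x \in U i) (5 / 4 : R)%R L.+1.
    rewrite -/(visits U L.+1 x) -/(count b beta a h L x).
    rewrite -/(visit_sum L.+1 U (5 / 4) x)%R.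
    by move: (visit_sum _ _ _ _) (_ ^+ _)%R => S e; lra.
  under eq_integral do rewrite E.
  have ms := measurable_visit_sum h0 L.+1 lU (5 / 4).
  have s0 x : (0 <= visit_sum L.+1 U (5 / 4) x :> R)%R by apply: visit_sum_ge0; lra.
  rewrite ge0_integralD//; last 2 first.
  - by move=> x _; rewrite -EFinM lee_fin mulr_ge0.
  - by apply: emeasurable_funM => //; exact/measurable_EFinP.
  rewrite integral_cst// mul1e ge0_integralZl//; last 2 first.
  - exact/measurable_EFinP.
  - by move=> x _; rewrite lee_fin.
  have K1 : (1 <= 2 * 1 :> R)%R by lra.
  have := integral_visit_sum_le h0 muQ lU K1
    (cU _ _ muQ (@maximal_bound_lebesgue R n) L.+1) (c := (5 / 4)%R).
  have c1 : (1 <= 5 / 4 :> R)%R by lra.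
  have cK : ((5 / 4 - 1) * (2 * 1) <= 2^-1 :> R)%R by lra.
  move=> /(_ c1 cK) le.
  have {}le := le_trans le (lee_wpmul2l _ (Omega_le mu L.+1)).
  apply: (@le_trans _ _ (mu (cube a h) + (4^-1)%:E * ((2 * (2 * 1))%:E * mu (cube a h)))).
    by rewrite leeD2l// lee_wpmul2l ?lee_fin// le// lee_fin; lra.
  rewrite muleA -EFinM -[X in X + _]mul1e -muleDl//; last first.
    exact: lebesgue_cube_fin.
  by rewrite -EFinD lee_wpmul2r// lee_fin; lra.
have K1 : (1 <= 2 * kappa)%R by lra.
(* The count is the sum with [B = 1], so [D = 1], and the packing constant is [2 * kappa]. *)
have := @integral_sum_power_le _ _ _ _ h0 nu nuQ L.+1 U lU _ K1 (cU _ _ nuQ Mnu L.+1)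
  k 1%R (fun _ _ => 1%R) ler01.
move=> /(_ (fun _ => measurable_cst _) (fun _ _ => ler01)) le.
apply: (@le_trans _ _ (\int[nu]_(x in cube a h)
    ((\sum_(i < L.+1) (x \in U i)%:R * 1) ^+ k.+1)%:E)).
  apply: le_lower_integral => x _; first by rewrite lee_fin exprn_ge0.
  rewrite /count /visits natr_sum lee_fin le_eqVlt; apply/orP; left; apply/eqP.
  by congr (_ ^+ _)%R; apply: eq_bigr => i _; rewrite mulr1.
apply: (le_trans (le _)).
  move=> i x _ _; under eq_integral do rewrite expr1n.
  by rewrite -integral_cst//; exact: measurable_subcube.
have -> : ((4 * k.+1%:R * (2 * kappa)) ^+ k * (2 * (2 * kappa) * 1) =
    (8 * k.+1%:R * kappa) ^+ k * (4 * kappa) :> R)%R.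
  congr (_ ^+ _ * _)%R; lra.
rewrite lee_wpmul2l// lee_fin mulr_ge0 ?exprn_ge0 ?mulr_ge0//; lra.
Qed.

End counting.

(** * L log L norms and exponential integrability *)

Section LlogL.
Context (R : realType).

(** Up to [s = ln (e + t)] the first term suffices; beyond it, [expR s] is [e + t] times the
    exponential of the excess [u], which dominates [t * u]. *)
Lemma young_LlogL (s t : R) : (0 <= s)%R -> (0 <= t)%R ->
  (s * t <= t * ln (expR 1 + t) + expR s)%R.
Proof.
move=> s0 t0; have et0 : (0 < expR 1 + t)%R by rewrite ltr_pwDl// expR_gt0.
have [st|/ltW ts] := leP s (ln (expR 1 + t)).
  by rewrite mulrC ler_wpDr ?expR_ge0// ler_wpM2l.
set u := (s - ln (expR 1 + t))%R.
have u0 : (0 <= u)%R by rewrite subr_ge0.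
have -> : expR s = ((expR 1 + t) * expR u)%R.
  by rewrite -[X in (X * _)%R](lnK (x := expR 1 + t)%R) ?posrE// -expRD subrKC.
have -> : (s * t = t * ln (expR 1 + t) + t * u)%R by rewrite /u; ring.
rewrite lerD2l; apply: ler_pM => //; first by rewrite lerDr expR_ge0.
by apply: le_trans (expR_ge1Dx u); rewrite lerDr.
Qed.

Lemma LlogL_fun_ge (t : R) : (0 <= t)%R -> (t <= t * ln (expR 1 + t))%R.
Proof.
move=> t0; rewrite ler_peMr// -[leLHS]expRK ler_ln ?posrE ?expR_gt0//.
  by rewrite lerDl.
by rewrite ltr_pwDl// expR_gt0.
Qed.

Lemma LlogL_fun_le1 (t : R) : (0 <= t <= 2^-1)%R -> (t * ln (expR 1 + t) <= 1)%R.
Proof.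
move=> /andP[t0 t1].
have ln2 : (ln (expR 1 + t) <= 2)%R.
  rewrite -[leRHS]expRK ler_ln ?posrE ?expR_gt0//; last first.
    by rewrite ltr_pwDl// expR_gt0.
  have -> : (2 = 1 + 1 :> R)%R by [].
  rewrite expRD; have := expR_ge1Dx (1 : R)%R; move: (expR 1) => e e2; nra.
have : (0 <= ln (expR 1 + t))%R.
  by apply: ln_ge0; have := expR_ge1Dx (1 : R)%R; move: (expR 1) => e e2; lra.
by move: ln2; move: (ln _) => u; nra.
Qed.

Lemma measurable_LlogL_fun d (T : measurableType d) (D : set T) (g : T -> R) :
  measurable_fun D g ->
  measurable_fun D (fun x => g x * ln (expR 1 + g x))%R.
Proof.
move=> mg; apply: measurable_funM => //.
by apply: measurableT_comp; [exact: measurable_ln|exact: measurable_funD].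
Qed.

End LlogL.

Section LlogL_norm.
Context (R : realType) (n : nat).
Local Notation V := (n.-tuple R).
Local Notation mu := (lebesgue R n).
Implicit Types (f : V -> R) (Q : set V).

Lemma LlogL_norm_ge0 f Q : 0 <= LlogL_norm f Q.
Proof. by apply: le_ereal_inf_tmp => _ [lam [lam0 _] <-]; rewrite lee_fin ltW. Qed.

Lemma LlogL_norm_fin f Q : is_cube Q -> (exists M : R, forall x, (`|f x| <= M)%R) ->
  LlogL_norm f Q \is a fin_num.
Proof.
move=> cQ [M fM]; rewrite ge0_fin_numE ?LlogL_norm_ge0//.
pose lam := (2 * (1 + `|M|))%R.
have lam0 : (0 < lam)%R by rewrite mulr_gt0// ltr_pwDl.
apply: (@le_lt_trans _ _ lam%:E); last exact: ltry.
apply: ereal_inf_lbound; exists lam => //; split=> //.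
rewrite avg_le// -integral_cst//; last exact: measurable_is_cube.
have t0 x : (0 <= `|f x| / lam)%R by rewrite divr_ge0// ltW.
apply: le_lower_integral => x _ /=.
  by rewrite lee_fin (le_trans (t0 x))// LlogL_fun_ge.
rewrite lee_fin LlogL_fun_le1// t0 /= ler_pdivrMr// /lam mulKf//.
by apply: le_trans (fM x) _; apply: le_trans (ler_norm M) _; rewrite lerDr.
Qed.

(** A bound for every admissible [lam] passes to the infimum that defines the norm. *)
Let le_LlogL_norm f Q (I : \bar R) (c : R) : (0 < c)%R ->
  (forall lam : R, (0 < lam)%R ->
    \int[mu]_(x in Q) (`|f x| / lam * ln (expR 1 + `|f x| / lam))%:E <= mu Q ->
    (lam^-1)%:E * I <= c%:E * mu Q) ->
  is_cube Q -> I <= c%:E * LlogL_norm f Q * mu Q.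
Proof.
move=> c0 H cQ; have := is_cube_gt0 cQ; have := is_cube_fin cQ.
case muQ : (mu Q) => [q| |]// _; rewrite lte_fin => q0.
rewrite muleAC -EFinM -lee_pdivrMl ?mulr_gt0//; apply: le_ereal_inf_tmp.
move=> _ [lam [lam0 le] <-]; move: le => /=; rewrite avg_le// mul1e => /(H _ lam0).
rewrite muQ -EFinM lee_pdivrMl// => le; rewrite lee_pdivrMl ?mulr_gt0//.
by rewrite -EFinM mulrC EFinM.
Qed.

Lemma avg_le_LlogL_norm f Q : is_cube Q -> measurable_fun setT f ->
  avg Q (fun x => `|f x|%:E) <= LlogL_norm f Q.
Proof.
move=> cQ mf; rewrite avg_le// -[X in X * _]mul1e.
apply: le_LlogL_norm => // lam lam0 le; rewrite mul1e; apply: le_trans le.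
have mQ := measurable_is_cube cQ.
have mf' : measurable_fun Q (fun x => `|f x|%R).
  by apply: measurableT_comp => //; exact: measurable_funTS.
rewrite -ge0_integralZl//; last 2 first.
- exact/measurable_EFinP.
- by rewrite lee_fin invr_ge0 ltW.
have t0 x : (0 <= `|f x| / lam)%R by rewrite divr_ge0// ltW.
apply: le_lower_integral => x _; rewrite -EFinM mulrC lee_fin//.
exact: LlogL_fun_ge.
Qed.

(** Young's inequality is used with [s = N * ln (5 / 4)]. The 3 adds the bound 1 on the mean of
    [phi (|f| / lam)] and the bound 2 on the mean of [(5 / 4) ^+ N]. *)
Definition exp_const : R := (3 / ln (5 / 4))%R.

Lemma ln54_gt0 : (0 < ln (5 / 4) :> R)%R.
Proof. by apply: ln_gt0; lra. Qed.

Lemma exp_const_gt0 : (0 < exp_const)%R.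
Proof. by rewrite divr_gt0// ln54_gt0. Qed.

Lemma integral_count_le f Q (N : V -> nat) : is_cube Q -> measurable_fun setT f ->
  measurable_fun Q (fun x => (N x)%:R : R) ->
  \int[mu]_(x in Q) ((5 / 4) ^+ N x)%:E <= 2%:E * mu Q ->
  \int[mu]_(x in Q) ((N x)%:R * `|f x|)%:E <=
    exp_const%:E * LlogL_norm f Q * mu Q.
Proof.
move=> cQ mf mN N2; apply: le_LlogL_norm => // [|lam lam0 le].
  exact: exp_const_gt0.
have mQ := measurable_is_cube cQ.
have l0 := ln54_gt0.
have mf' : measurable_fun Q (fun x => `|f x|%R).
  by apply: measurableT_comp => //; exact: measurable_funTS.
have powE x : ((5 / 4) ^+ N x = expR ((N x)%:R * ln (5 / 4)) :> R)%R.
  rewrite expRM_natl lnK// posrE; lra.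
rewrite -ge0_integralZl//; last 2 first.
- by apply/measurable_EFinP; exact: measurable_funM.
- by rewrite lee_fin invr_ge0 ltW.
rewrite /exp_const mulrC EFinM -muleA -lee_pdivrMl ?invr_gt0// invrK.
rewrite -ge0_integralZl//; last 3 first.
- by apply: emeasurable_funM => //; apply/measurable_EFinP; exact: measurable_funM.
- by move=> x _; rewrite mule_ge0// lee_fin ?mulr_ge0// invr_ge0 ltW.
- by rewrite lee_fin ltW.
have t0 x : (0 <= `|f x| / lam)%R by rewrite divr_ge0// ltW.
have mphi : measurable_fun Q (fun x => (`|f x| / lam * ln (expR 1 + `|f x| / lam))%:E).
  apply/measurable_EFinP; apply: (@measurable_LlogL_fun _ _ _ _ (fun x => `|f x| / lam)%R).
  exact: measurable_funM.
have mpow : measurable_fun Q (fun x => ((5 / 4) ^+ N x)%:E : \bar R).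
  apply/measurable_EFinP.
  under eq_fun do rewrite powE.
  by apply: measurableT_comp => //; exact: measurable_funM.
apply: (@le_trans _ _ (\int[mu]_(x in Q)
    ((`|f x| / lam * ln (expR 1 + `|f x| / lam))%:E + ((5 / 4) ^+ N x)%:E))).
  apply: le_lower_integral => x _.
    by rewrite !mule_ge0// lee_fin ?mulr_ge0 ?invr_ge0// ltW.
  rewrite -!EFinM -EFinD lee_fin powE.
  apply: le_trans (young_LlogL _ (t0 x)); last by rewrite mulr_ge0// ltW.
  by rewrite le_eqVlt; apply/orP; left; apply/eqP; ring.
rewrite ge0_integralD//.
- have -> : 3%:E * mu Q = mu Q + 2%:E * mu Q.
    transitivity ((1 + 2)%:E * mu Q); first by congr (_%:E * _); ring.
    by rewrite EFinD muleDl ?mul1e// is_cube_fin.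
  exact: leeD.
- by move=> x _; rewrite lee_fin (le_trans (t0 x))// LlogL_fun_ge.
Qed.

(** Covers both kinds of factor: [2 ^+ n.+2] suffices for [gamma = 1] and [2 ^+ n.+2 * exp_const]
    for [gamma = 2]. *)
Definition osc_const : R := (2 ^+ n.+2 * (1 + exp_const))%R.

Lemma osc_const_gt0 : (0 < osc_const)%R.
Proof. by rewrite mulr_gt0 ?exprn_gt0// ltr_pwDl// ltW// exp_const_gt0. Qed.

(** One count, chosen before [f], serves both values of [gamma]. The factor for [gamma = 2] is
    constant on [Q] and is bounded by Young's inequality; multiplying its bound by the count is
    harmless because the count is at least 1. *)
Theorem sparse_factor_count (b : V -> R) (beta : R) Q :
  loc_integrable b -> (0 <= beta)%R -> BMO_norm b <= beta%:E -> is_cube Q ->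
  exists N : nat -> V -> nat,
  [/\ forall x, {homo N ^~ x : i j / (i <= j)%N},
      forall L x, Q x -> (0 < N L x)%N,
      forall L, measurable_fun Q (fun x => (N L x)%:R : R),
      forall f, measurable_fun setT f -> {ae mu, forall x, Q x ->
        forall first, exists L, sparse_factor b f Q first x <=
          (osc_const * beta * (N L x)%:R)%:E * LlogL_norm f Q} &
      forall (nu : {measure set V -> \bar R}) (kappa : R), (1 <= kappa)%R ->
        nu Q < +oo -> maximal_bound nu kappa -> forall k L,
        \int[nu]_(x in Q) ((N L x)%:R ^+ k.+1)%:E <=
          ((8 * k.+1%:R * kappa) ^+ k * (4 * kappa))%:E * nu Q].
Proof.
move=> lb beta0 bb cQ.
have [N [ndN N0 mN aeN [N2 Nnu]]] := john_nirenberg_count lb beta0 bb cQ.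
exists N; split => // f mf.
have mQ := measurable_is_cube cQ; have [mb _] := lb.
have mf' : measurable_fun Q (fun x => `|f x|%R).
  by apply: measurableT_comp => //; exact: measurable_funTS.
have p2 : (0 < 2 ^+ n.+2 :> R)%R by rewrite exprn_gt0.
have e0 : (0 <= exp_const)%R by rewrite ltW// exp_const_gt0.
have osc2 : (2 ^+ n.+2 <= osc_const)%R by rewrite ler_peMr ?lerDl// ltW.
have osce : (2 ^+ n.+2 * exp_const <= osc_const)%R by rewrite ler_pM2l// lerDr.
have avg2 : avg Q (fun y => `|(b y - mean b Q) * f y|%:E) <=
    (osc_const * beta)%:E * LlogL_norm f Q.
  rewrite avg_le//.
  apply: (@ae_le_sup_integral _ _ _ mu Q _
    (fun L x => (2 ^+ n.+2 * beta * ((N L x)%:R * `|f x|))%:E)) => //.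
  - move=> L; apply/measurable_EFinP; apply: measurable_funM => //.
    exact: measurable_funM.
  - by move=> L x _; rewrite lee_fin mulr_ge0//; exact: (mulr_ge0 (ltW p2)).
  - move=> x _ i j ij; rewrite lee_fin ler_wpM2l ?(mulr_ge0 (ltW p2))//.
    by rewrite ler_wpM2r// ler_nat ndN.
  - apply: filterS aeN => x + Qx => /(_ Qx)[L le].
    apply: (@le_trans _ _ (2 ^+ n.+2 * beta * ((N L x)%:R * `|f x|))%:E); last first.
      by apply: ereal_sup_ubound; exists L.
    by rewrite lee_fin normrM mulrA ler_wpM2r.
  - move=> L; under eq_integral do rewrite EFinM.
    rewrite ge0_integralZl//; last 2 first.
    + by apply/measurable_EFinP; exact: measurable_funM.
    + by rewrite lee_fin mulr_ge0// ltW.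
    apply: (@le_trans _ _ ((2 ^+ n.+2 * beta)%:E * (exp_const%:E * LlogL_norm f Q * mu Q))).
      rewrite lee_wpmul2l ?lee_fin ?(mulr_ge0 (ltW p2))//.
      exact: integral_count_le.
    rewrite !muleA lee_wpmul2r// lee_wpmul2r ?LlogL_norm_ge0// -EFinM lee_fin.
    by rewrite mulrAC ler_wpM2r.
apply: filterS aeN => x + Qx first => /(_ Qx)[L le]; exists L.
have NL1 : (1 <= (N L x)%:R :> R)%R by rewrite ler1n N0.
rewrite /sparse_factor; case: first.
  apply: lee_pmul => //.
  - by apply: avg_ge0 => y _; rewrite lee_fin.
  - rewrite lee_fin; apply: le_trans le _.
    apply: ler_wpM2r => //; exact: ler_wpM2r.
  - exact: avg_le_LlogL_norm.
apply: le_trans avg2 _; rewrite lee_wpmul2r ?LlogL_norm_ge0// lee_fin.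
by rewrite ler_peMr// mulr_ge0// ltW// osc_const_gt0.
Qed.

End LlogL_norm.

(** * Weighted bounds for finite sparse families *)

Section geometric_levels.
Context (R : realType).
Local Open Scope ring_scope.
Implicit Types (s X L : R) (T : nat).

(** The sum of the geometric series of ratio [2^(-s)]. *)
Definition geo s : R := (1 - 2^-1 `^ s)^-1.

Lemma half_powR_lt1 s : 0 < s -> 2^-1 `^ s < 1 :> R.
Proof.
move=> s0; rewrite [ltRHS](_ : _ = 1 `^ s); last by rewrite powR1.
have h12 : 2^-1 < 1 :> R by lra.
by have := @gt0_ltr_powR R s s0 2^-1 1; rewrite !nnegrE; apply.
Qed.

Lemma le_powR s (x y : R) : 0 <= s -> 0 <= x -> x <= y -> x `^ s <= y `^ s.
Proof.
by move=> s0 x0 xy; apply: ge0_ler_powR; rewrite ?nnegrE// (le_trans x0).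
Qed.

Lemma geo_gt0 s : 0 < s -> 0 < geo s.
Proof. by move=> s0; rewrite invr_gt0 subr_gt0 half_powR_lt1. Qed.

Lemma sum_geometric_levels s X L T : 0 < s -> 0 <= X -> 0 < L ->
  \sum_(t < T | L / 2 ^+ t <= X) (L / 2 ^+ t) `^ s <= geo s * X `^ s.
Proof.
move=> s0 X0 L0; have c0 : 0 < 1 - 2^-1 `^ s by rewrite subr_gt0 half_powR_lt1.
have L2 t : 0 <= L / 2 ^+ t by rewrite divr_ge0 ?exprn_ge0// ltW.
have LS t : L / 2 ^+ t.+1 <= L / 2 ^+ t.
  by rewrite ler_pM2l// lef_pV2 ?posrE ?exprn_gt0// ler_weXn2l// ler1n.
rewrite /geo ler_pdivlMl//.
pose g t := Num.min (L / 2 ^+ t) X `^ s.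
have step t : (if L / 2 ^+ t <= X then (1 - 2^-1 `^ s) * (L / 2 ^+ t) `^ s else 0)
    <= g t - g t.+1.
  case: ifP => LX; rewrite /g.
    rewrite (min_idPl LX) (min_idPl (le_trans (LS t) LX)).
    have -> : L / 2 ^+ t.+1 = 2^-1 * (L / 2 ^+ t) by rewrite exprS invfM mulrCA.
    rewrite (@powRM _ 2^-1) ?invr_ge0//.
    by rewrite mulrBl mul1r.
  rewrite subr_ge0 le_powR ?(ltW s0) ?le_min ?L2//.
  by rewrite !ge_min LS lexx orbT.
rewrite mulr_sumr big_mkcond /=.
apply: le_trans (ler_sum _ (fun (t : 'I_T) _ => step t)) _.
rewrite -(big_mkord xpredT (fun t => g t - g t.+1)).
rewrite (@telescope_sumr_eq _ 0 T (fun t => - g t))//; last first.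
  by move=> t _; rewrite opprK addrC.
rewrite opprK addrC; apply: (@le_trans _ _ (g 0%N)).
  by rewrite gerDl oppr_le0 powR_ge0.
by rewrite /g le_powR ?(ltW s0) ?le_min ?L2// ge_min lexx orbT.
Qed.

Lemma level_exists x L T : L / 2 ^+ T < x <= L ->
  exists2 t, (t < T)%N & L / 2 ^+ t.+1 < x <= L / 2 ^+ t.
Proof.
elim: T => [|T IH]; first by rewrite expr0 divr1 ltNge andNb.
move=> /andP[Lx xL]; have [xT|Tx] := leP x (L / 2 ^+ T).
  by exists T; rewrite ?ltnSn// Lx.
by have [|t tT xt] := IH; rewrite ?Tx//; exists t => //; exact: ltnW.
Qed.

(** A weighted geometric mean is at most the larger of its two entries. *)
Lemma powR_interpolation (X Y th : R) : 0 <= X -> 0 <= Y -> 0 < th < 1 ->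
  X `^ (1 - th) * Y `^ th <= X + Y.
Proof.
move=> X0 Y0 /andP[th0 th1].
have th10 : 0 <= 1 - th by rewrite subr_ge0 ltW.
have D (Z : R) : 0 <= Z -> Z `^ (1 - th) * Z `^ th = Z.
  move=> Z0; rewrite -powRD; first by rewrite subrK powRr1.
  by rewrite subrK oner_eq0.
have [XY|/ltW YX] := leP X Y.
  apply: (@le_trans _ _ Y); last by rewrite lerDr.
  by rewrite -[leRHS](D Y)// ler_wpM2r ?powR_ge0// le_powR.
apply: (@le_trans _ _ X); last by rewrite lerDl.
by rewrite -[leRHS](D X)// ler_wpM2l ?powR_ge0// le_powR// ltW.
Qed.

Lemma powR_factor_le (p : R) (m : nat) (L u Y : R) : 0 < p -> (0 < m)%N ->
  0 < L -> 0 <= u -> L `^ p * u ^+ m <= Y ->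
  L * u <= L `^ (1 - p / m%:R) * Y `^ m%:R^-1.
Proof.
move=> p0 m0 L0 u0 LuY; have m0' : m%:R != 0 :> R by rewrite pnatr_eq0 -lt0n.
have LE : L * u = L `^ (1 - p / m%:R) * ((L `^ p * u ^+ m) `^ m%:R^-1).
  rewrite powRM ?powR_ge0 ?exprn_ge0// -powRrM mulrA -powRD; last first.
    by rewrite (gt_eqF L0) implybT.
  rewrite subrK powRr1 ?ltW//; congr (_ * _).
  by rewrite -powR_mulrn// -powRrM divff// powRr1.
rewrite LE ler_wpM2l ?powR_ge0// le_powR ?invr_ge0//.
by rewrite mulr_ge0 ?powR_ge0 ?exprn_ge0.
Qed.

(** [F t] stands for the cubes of size about [L / 2 ^+ t]. With [Y] the last sum, the term
    [L / 2^t * F t / H] is at most [(L / 2^t)^(1 - p/m) Y^(1/m)]. Since only sizes up to [X] occur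
    and [p < m], the sum over [t] is geometric, and the weighted geometric mean inequality separates
    [X^p] from [Y]. *)
Lemma sum_levels_le (p : R) (m T : nat) (L X H A : R) (F : nat -> R) :
  0 < p -> p < m%:R -> 0 < L -> 0 <= X -> 0 < H -> 0 <= A ->
  (forall t, 0 <= F t) -> (forall t, F t != 0 -> L / 2 ^+ t <= X) ->
  A <= \sum_(t < T) (L / 2 ^+ t) * F t ->
  A `^ p <= geo (1 - p / m%:R) `^ p * H `^ p *
    (X `^ p + \sum_(t < T) (L / 2 ^+ t) `^ p * (F t / H) ^+ m).
Proof.
move=> p0 pm L0 X0 H0 A0 F0 FX AF.
have m0' : 0 < m%:R :> R by exact: lt_trans pm.
have m0 : (0 < m)%N by rewrite -(ltr0n R).
have th1 : p / m%:R < 1 by rewrite ltr_pdivrMr// mul1r.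
have th0 : 0 < p / m%:R by rewrite divr_gt0.
set th := p / m%:R in th0 th1 *; have th10 : 0 < 1 - th by rewrite subr_gt0.
set Y := \sum_(t < T) _.
have FH0 t : 0 <= F t / H by rewrite divr_ge0// ltW.
have L2 t : 0 < L / 2 ^+ t by rewrite divr_gt0 ?exprn_gt0.
have Y0 : 0 <= Y by rewrite sumr_ge0// => t _; rewrite mulr_ge0 ?powR_ge0 ?exprn_ge0.
have g0 := geo_gt0 th10.
have AH : A / H <= geo (1 - th) * X `^ (1 - th) * Y `^ m%:R^-1.
  rewrite ler_pdivrMr//; apply: le_trans AF _.
  apply: (@le_trans _ _ (\sum_(t < T | L / 2 ^+ t <= X)
     (L / 2 ^+ t) `^ (1 - th) * Y `^ m%:R^-1 * H)).
    rewrite [leRHS]big_mkcond /=; apply: ler_sum => t _.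
    case: ifPn => [_|]; last first.
      by apply: contraNT; rewrite -ltNge => tF; apply: FX; apply: contraTneq tF => ->; rewrite mulr0 ltxx.
    rewrite -ler_pdivrMr// -(mulrA (L / 2 ^+ t)); apply: powR_factor_le => //.
    by rewrite /Y (bigD1 t)//= lerDl sumr_ge0// => i _; rewrite mulr_ge0 ?powR_ge0 ?exprn_ge0.
  rewrite -!mulr_suml ler_wpM2r ?(ltW H0)// ler_wpM2r ?powR_ge0//.
  exact: sum_geometric_levels.
have -> : A = H * (A / H) by rewrite mulrCA divff ?mulr1// gt_eqF.
rewrite powRM ?(ltW H0) ?divr_ge0 ?(ltW H0)//.
rewrite [geo _ `^ p * _]mulrC -mulrA ler_wpM2l ?powR_ge0//.
apply: (@le_trans _ _ ((geo (1 - th) * X `^ (1 - th) * Y `^ m%:R^-1) `^ p)).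
  by apply: le_powR => //; rewrite ?divr_ge0// ltW.
rewrite powRM ?mulr_ge0 ?powR_ge0 ?(ltW g0)// powRM ?powR_ge0 ?(ltW g0)//.
rewrite -mulrA ler_wpM2l ?powR_ge0//.
have -> : X `^ (1 - th) `^ p = X `^ p `^ (1 - th) by rewrite -!powRrM mulrC.
have -> : Y `^ m%:R^-1 `^ p = Y `^ th by rewrite -powRrM mulrC.
by apply: powR_interpolation; rewrite ?powR_ge0// th0.
Qed.

End geometric_levels.

(** * Carleson embedding by size classes *)

Section carleson_levels.
Context (R : realType) (n : nat) (a : 'I_n -> R) (h : R).
Hypothesis h0 : (0 < h)%R.
Variable nu : {measure set (n.-tuple R) -> \bar R}.
Local Notation V := (n.-tuple R).
Local Notation Q := (cube a h).
Local Notation sub := (subcube a h).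
Hypothesis nuQ : nu Q < +oo.

Lemma carleson_subset (J : nat) (U U' : nat -> set V) (K : R) :
  (forall i, level_set a h i (U i)) -> (forall i, level_set a h i (U' i)) ->
  (forall i, U' i `<=` U i) ->
  carleson a h nu J U K -> carleson a h nu J U' K.
Proof.
move=> lU lU' UU cU i x iJ U'x; apply: le_trans (cU i x iJ (UU _ _ U'x)).
apply: lee_sum => j _; apply: le_measure; rewrite ?inE.
- apply: measurableI; first exact: measurable_level_set (lU' j).
  exact: measurable_subcube.
- apply: measurableI; first exact: measurable_level_set (lU j).
  exact: measurable_subcube.
- by apply: setSI; exact: UU.
Qed.

(** [geo (1 - p / k.+1)] comes from adding the size classes pointwise, [geo p] from adding the
    measures of their unions, and [2 ^ p] from the ratio 2 between the ends of a class. *)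
Definition power_const (p : R) (k : nat) : R :=
  (geo (1 - p / k.+1%:R) `^ p * (2 `^ p * (1 + geo p)))%R.

(** At height [H], the moment of order [k.+1] of the class [t] is at most [nu (Om t)]. There remains
    the sum of [(L / 2^t)^p nu (Om t)], bounded by the integral of a multiple of [(2 M)^p] because
    [2 M >= L / 2^t] on [Om t]. *)
Theorem carleson_embedding_power (J : nat) (U : nat -> set V) (K p : R) (k : nat)
    (lam B : nat -> V -> R) (M : V -> R) (L D H : R) (T : nat) :
  (forall i, level_set a h i (U i)) -> (1 <= K)%R -> carleson a h nu J U K ->
  (0 < p)%R -> (p < k.+1%:R)%R ->
  (forall i x, Q x -> forall y, sub i x y -> lam i y = lam i x) ->
  (0 < L)%R -> (forall i x, (i < J)%N -> U i x -> (L / 2 ^+ T < lam i x <= L)%R) ->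
  measurable_fun Q M -> (forall x, 0 <= M x)%R ->
  (forall i x, (i < J)%N -> U i x -> (lam i x <= M x)%R) ->
  (forall i, measurable_fun Q (B i)) -> (forall i x, 0 <= B i x)%R ->
  (0 <= D)%R ->
  (forall i x, (i < J)%N -> U i x ->
    \int[nu]_(y in sub i x) (B i y ^+ k.+1)%:E <= D%:E * nu (sub i x)) ->
  (0 < H)%R -> ((4 * k.+1%:R * K) ^+ k * (2 * K * D) <= H ^+ k.+1)%R ->
  \int[nu]_(x in Q) ((\sum_(i < J) (x \in U i)%:R * (lam i x * B i x)) `^ p)%:E <=
  (power_const p k * H `^ p)%:E * \int[nu]_(x in Q) (M x `^ p)%:E.
Proof.
move=> lU K1 cU p0 pk lamE L0 lamL mM M0 lamM mB B0 D0 BD H0 HD.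
have mQ : measurable Q by exact: measurable_cube.
pose Ut t i := [set x | U i x /\ (L / 2 ^+ t.+1 < lam i x <= L / 2 ^+ t)%R].
have lUt t i : level_set a h i (Ut t i).
  have [UQ UU] := lU i; split=> [x [/UQ]//|x [Ux xt] y xy]; split.
    exact: UU xy.
  by rewrite (lamE i x (UQ _ Ux) y xy).
have UtU t i : Ut t i `<=` U i by move=> x [].
have cUt t : carleson a h nu J (Ut t) K := carleson_subset lU (lUt t) (UtU t) cU.
pose F t x : R := (\sum_(i < J) (x \in Ut t i)%:R * B i x)%R.
have F0 t x : (0 <= F t x)%R by rewrite sumr_ge0// => i _; rewrite mulr_ge0.
pose Om t := \bigcup_(i in `I_J) Ut t i.
have mOm t : measurable (Om t) := measurable_visited h0 J (lUt t).
have OmQ t : Om t `<=` Q := @visited_sub _ _ _ _ J _ (lUt t).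
have mind t i : measurable_fun Q (fun x => (x \in Ut t i)%:R : R).
  apply: (measurable_fun_const_level h0 (j := i)) => x Qx y xy.
  by rewrite (mem_level h0 (lUt t) (leqnn i) Qx xy).
have mF t : measurable_fun Q (F t).
  by apply: measurable_sum => i; exact: measurable_funM.
have L2 t : (0 < L / 2 ^+ t)%R by rewrite divr_gt0 ?exprn_gt0.
have FE t : \int[nu]_(x in Q) (F t x ^+ k.+1)%:E <= (H ^+ k.+1)%:E * nu (Om t).
  apply: (@le_trans _ _ (((4 * k.+1%:R * K) ^+ k * (2 * K * D))%:E * nu (Om t))).
    apply: (integral_sum_power_le h0 nuQ (lUt t) K1 (cUt t) D0 mB B0).
    by move=> i x iJ /UtU; exact: BD.
  by rewrite lee_wpmul2r ?lee_fin.
have OmM t x : Om t x -> (L / 2 ^+ t <= 2 * M x)%R.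
  move=> [i /= iJ [Ux /andP[xt _]]].
  have := lamM i x iJ Ux; move: xt; rewrite exprS invfM mulrCA.
  move: (L / 2 ^+ t)%R (lam i x) => l y; lra.
have FM t x : (F t x != 0)%R -> (L / 2 ^+ t <= 2 * M x)%R.
  move=> Fx; apply: OmM; apply: contrapT => NOm; move/eqP: Fx; apply.
  rewrite /F big1// => i _; rewrite memNset ?mul0r// => Utx.
  by apply: NOm; exists i => //=.
have sumF x : (\sum_(i < J) (x \in U i)%:R * (lam i x * B i x) <=
    \sum_(t < T) L / 2 ^+ t * F t x)%R.
  under [leRHS]eq_bigr do rewrite mulr_sumr.
  rewrite exchange_big /=; apply: ler_sum => i _.
  have [Ux|NUx] := boolP (x \in U i); last first.
    by rewrite mul0r sumr_ge0// => t _; rewrite mulr_ge0 ?mulr_ge0// ltW.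
  have [t tT xt] := level_exists (lamL i x (ltn_ord i) (set_mem Ux)).
  rewrite (bigD1 (Ordinal tT))//= mem_set; last by split=> //; exact: set_mem.
  rewrite !mul1r; apply: (@le_trans _ _ (L / 2 ^+ t * B i x)%R).
    by rewrite ler_wpM2r//; case/andP: xt.
  rewrite lerDl sumr_ge0// => t' _; rewrite mulr_ge0 ?mulr_ge0//; exact: ltW.
have geo1 : (0 < geo p)%R by exact: geo_gt0.
pose C := (geo (1 - p / k.+1%:R) `^ p)%R.
have C0 : (0 <= C)%R by exact: powR_ge0.
have Hp0 : (0 <= H `^ p)%R by exact: powR_ge0.
have pointwise x : ((\sum_(i < J) (x \in U i)%:R * (lam i x * B i x)) `^ p <=
   C * H `^ p * ((2 * M x) `^ p +
      \sum_(t < T) (L / 2 ^+ t) `^ p * (F t x / H) ^+ k.+1))%R.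
  apply: (@sum_levels_le _ p k.+1 T L (2 * M x) H _ (F ^~ x)) => //.
  - by rewrite mulr_ge0.
  - rewrite sumr_ge0// => i _; have [Ux|] := boolP (x \in U i); last by rewrite mul0r.
    rewrite mul1r mulr_ge0//; have /andP[le _] := lamL i x (ltn_ord i) (set_mem Ux).
    by apply: ltW; apply: lt_trans le.
  - by move=> t; exact: FM.
have mMp : measurable_fun Q (fun x => (2 * M x) `^ p)%R.
  apply: (measurableT_comp (f := fun y => y `^ p)%R); first exact: measurable_powR.
  exact: measurable_funM.
have mMp1 : measurable_fun Q (fun x => M x `^ p)%R.
  by apply: (measurableT_comp (f := fun y => y `^ p)%R); first exact: measurable_powR.
have mFk t : measurable_fun Q (fun x => (F t x ^+ k.+1)%:E : \bar R).
  by apply/measurable_EFinP; exact: measurable_funX.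
have mterm t : measurable_fun Q (fun x => (L / 2 ^+ t) `^ p * (F t x / H) ^+ k.+1)%R.
  apply: measurable_funM => //; apply: measurable_funX.
  exact: measurable_funM.
have term0 t x : (0 <= (L / 2 ^+ t) `^ p * (F t x / H) ^+ k.+1)%R.
  by rewrite mulr_ge0 ?powR_ge0// exprn_ge0// divr_ge0// ltW.
apply: (@le_trans _ _ (\int[nu]_(x in Q) ((C * H `^ p)%:E * (((2 * M x) `^ p)%:E +
      \sum_(t < T) ((L / 2 ^+ t) `^ p * (F t x / H) ^+ k.+1)%:E)))).
  apply: le_lower_integral => x _; first by rewrite lee_fin powR_ge0.
  by rewrite sumEFin -EFinD -EFinM lee_fin pointwise.
rewrite ge0_integralZl//; last 3 first.
- apply: emeasurable_funD; first exact/measurable_EFinP.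
  by apply: emeasurable_sum => t; exact/measurable_EFinP.
- move=> x _; rewrite adde_ge0 ?lee_fin ?powR_ge0//.
  by apply: sume_ge0 => t _; rewrite lee_fin.
- by rewrite lee_fin mulr_ge0.
have -> : (power_const p k * H `^ p = C * H `^ p * (2 `^ p * (1 + geo p)))%R.
  by rewrite /power_const -/C mulrAC.
rewrite [in leRHS]EFinM -muleA lee_wpmul2l ?lee_fin ?mulr_ge0//.
rewrite ge0_integralD//; last 4 first.
- by move=> x _; rewrite lee_fin powR_ge0.
- exact/measurable_EFinP.
- by move=> x _; apply: sume_ge0 => t _; rewrite lee_fin.
- by apply: emeasurable_sum => t; exact/measurable_EFinP.
have E1 : \int[nu]_(x in Q) ((2 * M x) `^ p)%:E =
    (2 `^ p)%:E * \int[nu]_(x in Q) (M x `^ p)%:E.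
  rewrite -ge0_integralZl//.
  - by apply: eq_integral => x _; rewrite -EFinM powRM.
  - exact/measurable_EFinP.
  - by move=> x _; rewrite lee_fin powR_ge0.
suff E2 : \int[nu]_(x in Q) (\sum_(t < T) ((L / 2 ^+ t) `^ p * (F t x / H) ^+ k.+1)%:E) <=
    (geo p)%:E * \int[nu]_(x in Q) ((2 * M x) `^ p)%:E.
  apply: le_trans (leeD (lexx _) E2) _.
  rewrite E1 muleA -ge0_muleDl ?lee_fin ?powR_ge0 ?mulr_ge0 ?powR_ge0 ?(ltW geo1)//.
  by rewrite -EFinD -[X in (X + _)%R]mul1r -mulrDl mulrC.
rewrite ge0_integral_sum//; last 2 first.
  by move=> t; exact/measurable_EFinP.
  by move=> t x _; rewrite lee_fin.
apply: (@le_trans _ _ (\sum_(t < T) \int[nu]_(x in Q) ((L / 2 ^+ t) `^ p * \1_(Om t) x)%:E)).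
  apply: lee_sum => t _.
  have -> : \int[nu]_(x in Q) ((L / 2 ^+ t) `^ p * (F t x / H) ^+ k.+1)%:E =
    ((L / 2 ^+ t) `^ p)%:E * ((H ^- k.+1)%:E * \int[nu]_(x in Q) (F t x ^+ k.+1)%:E).
    rewrite -ge0_integralZl//; last 2 first.
    + by move=> x _; rewrite lee_fin exprn_ge0.
    + by rewrite lee_fin invr_ge0 exprn_ge0// ltW.
    rewrite -ge0_integralZl//; last 3 first.
    + exact: emeasurable_funM.
    + by move=> x _; rewrite mule_ge0 ?lee_fin ?exprn_ge0// invr_ge0 exprn_ge0// ltW.
    + by rewrite lee_fin powR_ge0.
    by apply: eq_integral => x _; rewrite -!EFinM expr_div_n [(_ / H ^+ k.+1)%R]mulrC.
  under [in leRHS]eq_integral do rewrite EFinM.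
  rewrite [leRHS]ge0_integralZl//; last 2 first.
  + exact/measurable_EFinP.
  + by rewrite lee_fin powR_ge0.
  rewrite lee_wpmul2l ?lee_fin ?powR_ge0// integral_indic// setIidl//.
  rewrite lee_pdivrMl ?exprn_gt0//.
rewrite -ge0_integral_sum//; last 2 first.
  by move=> t; apply/measurable_EFinP; exact: measurable_funM.
  by move=> t x _; rewrite lee_fin mulr_ge0 ?powR_ge0.
rewrite -ge0_integralZl//; last 3 first.
- exact/measurable_EFinP.
- by move=> x _; rewrite lee_fin powR_ge0.
- by rewrite lee_fin ltW.
apply: le_lower_integral => x _.
  by apply: sume_ge0 => t _; rewrite lee_fin mulr_ge0 ?powR_ge0.
rewrite sumEFin -EFinM lee_fin.
apply: le_trans (sum_geometric_levels T p0 _ L0); last by rewrite mulr_ge0.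
rewrite [leRHS]big_mkcond /=; apply: ler_sum => t _.
rewrite indicE; case: ifPn => [_|].
  by case: (_ \in _); rewrite ?mulr1 ?mulr0 ?powR_ge0.
by move=> N; rewrite memNset ?mulr0// => Omx; move: N; rewrite OmM.
Qed.

End carleson_levels.

(** * A_infinity weights *)

Section Ainfty_weights.
Context (R : realType) (n : nat) (w : n.-tuple R -> R).
Local Notation V := (n.-tuple R).
Local Notation mu := (lebesgue R n).
Hypothesis mw : measurable_fun [set: V] w.
Hypothesis w0 : forall x, (0 <= w x)%R.
Hypothesis ww : weight w.

Local Notation nu := (wmeasure mu mw w0).

Lemma weight_fin P : is_cube P -> nu P < +oo.
Proof.
move=> cP; have [[_ /(_ P cP) /integrableP[_ fin]] _ _] := ww.
rewrite wmeasureE; apply: le_lt_trans fin; apply: le_lower_integral => x _.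
  by rewrite lee_fin.
by rewrite /= lee_fin ler_norm.
Qed.

(** Positive mass allows the division in the definition of [[w]] to be undone. *)
Lemma weight_gt0 P : is_cube P -> 0 < nu P.
Proof.
move=> cP; rewrite lt0e measure_ge0 andbT; apply/eqP => nuP.
have mP := measurable_is_cube cP.
have mwP : measurable_fun P (EFin \o w).
  by apply/measurable_EFinP; exact: measurable_funTS.
have /(ae_eq_integral_abs mu mP mwP) wP0 : \int[mu]_(x in P) `|(EFin \o w) x| = 0.
  rewrite -nuP wmeasureE; apply: eq_integral => x _.
  by rewrite /= ger0_norm.
have [_ _ wpos] := ww.
have : {ae mu, forall x, ~ P x}.
  apply: filterS2 wP0 wpos => x /= wx0 wx Px.
  by have := wx0 Px; move=> [wxE]; move: wx; rewrite wxE ltxx.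
move=> [N [mN N0 PN]]; have : mu P <= 0.
  by rewrite -N0; apply: le_measure; rewrite ?inE// => x Px; apply: PN; exact.
by rewrite leNgt is_cube_gt0.
Qed.

Let HL P x := HL_max_cubes (fun y => w y * \1_P y)%R x.

Let HL_ge P P' x : is_cube P' -> P' `<=` P -> P' x -> nu P' <= HL P x * mu P'.
Proof.
move=> cP' P'P P'x.
have -> : nu P' = avg P' (fun y => `|w y * \1_P y|%:E) * mu P'.
  rewrite avg_mul// wmeasureE; apply: eq_integral => y /set_mem P'y.
  by rewrite indicE mem_set ?mulr1 ?ger0_norm//; exact: P'P.
by rewrite lee_wpmul2r//; apply: ereal_sup_ubound; exists P'.
Qed.

Let HL_ge0 P x : 0 <= HL P x.
Proof.
pose P' : set V := cube (tnth x) 1.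
have P'x : P' x by move=> i; rewrite lexx ltrDl ltr01.
apply: (@le_trans _ _ (avg P' (fun y => `|w y * \1_P y|%:E))).
  by apply: avg_ge0 => y _; rewrite lee_fin.
by apply: ereal_sup_ubound; exists P' => //; split=> //; exists (tnth x), 1%R.
Qed.

Lemma Ainfty_maximal_bound (kappa : R) : Ainfty_const w <= kappa%:E ->
  maximal_bound nu kappa.
Proof.
move=> wk P cP; exists (HL P); split=> [x|| P' x cP'].
- exact: HL_ge0.
- have : (\int[mu]_(x in P) HL P x) / nu P <= kappa%:E.
    by apply: le_trans wk; apply: ereal_sup_ubound; exists P.
  have := weight_gt0 cP; have := weight_fin cP.
  case: (nu P) => // v _; rewrite lte_fin => v0.
  by rewrite inver gt_eqF// lee_pdivrMr.
- exact: HL_ge.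
Qed.

(** Throughout [P], the maximal function of [w 1_P] is at least the mean of [w] on [P]; the unit
    cube suffices. *)
Lemma Ainfty_const_ge1 : 1 <= Ainfty_const w.
Proof.
pose P : set V := cube (fun=> 0%R) 1.
have cP : is_cube P by exists (fun=> 0%R), 1%R.
have mP := measurable_is_cube cP.
apply: (@le_trans _ _ ((\int[mu]_(x in P) HL P x) / nu P)); last first.
  by apply: ereal_sup_ubound; exists P.
have : nu P <= \int[mu]_(x in P) HL P x.
  have muP : mu P = 1 by rewrite lebesgue_cube// expr1n.
  rewrite -[leLHS]mule1 -muP -integral_cst//; apply: le_lower_integral => x Px.
    exact: (measure_ge0 nu).
  by have := HL_ge cP (@subset_refl _ P) Px; rewrite muP mule1.
have := weight_gt0 cP; have := weight_fin cP.
case: (nu P) => // v _; rewrite lte_fin => v0.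
by rewrite inver gt_eqF// lee_pdivlMr// mul1e.
Qed.

End Ainfty_weights.

(** * Countability and finite subfamilies of dyadic lattices *)

Section dyadic_lattices.
Context (R : realType) (n : nat).
Hypothesis n0 : (0 < n)%N.
Local Notation V := (n.-tuple R).
Variable D : set (set V).
Hypothesis lD : dyadic_lattice D.

Lemma descendantE (a : 'I_n -> R) (h : R) P : (0 < h)%R ->
  dyadic_descendant (cube a h) P -> exists j (z : 'I_n -> nat),
  (forall i, z i < 2 ^ j)%N /\
  P = cube (fun i => a i + (z i)%:R * (h / 2 ^+ j))%R (h / 2 ^+ j)%R.
Proof.
move=> h0 [a' [h' [j [z [h'0 E zj PE]]]]]; exists j, z; split=> //.
by have [-> ->] := cube_inj n0 h0 h'0 E.
Qed.

(** Every cube of [D] shares an ancestor with a fixed [Q0]. The ancestor is determined by the depth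
    and position of [Q0] in it, and the cube by its own depth and position: countably many data. *)
Lemma dyadic_lattice_enum : exists e : nat -> set V, D `<=` range e.
Proof.
have [Dc _ anc cov] := lD.
have [Q0 DQ0 _] : exists2 Q, D Q & set0 `<=` Q.
  by apply: cov; rewrite /compact_in image_set0; exact: compact0.
have [a0 [h0 h00 Q0E]] := Dc _ DQ0.
pose C := (nat * nat * n.-tuple nat * n.-tuple nat)%type.
pose F (c : C) : set V := let: (k, k', z, z') := c in
  let H := (h0 * 2 ^+ k)%R in
  cube (fun i => a0 i - (tnth z i)%:R * h0 + (tnth z' i)%:R * (H / 2 ^+ k'))%R
    (H / 2 ^+ k')%R.
exists (fun i => if @unpickle C i is Some c then F c else set0) => Q DQ.
have [Q' [DQ' Q'Q0 Q'Q]] := anc _ _ DQ0 DQ.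
have [a [h h_gt0 Q'E]] := Dc _ DQ'.
rewrite Q'E in Q'Q0 Q'Q.
have [k [z [zk Q0E']]] := descendantE h_gt0 Q'Q0.
have [k' [z' [zk' QE]]] := descendantE h_gt0 Q'Q.
have hk : (0 < h / 2 ^+ k)%R by rewrite divr_gt0// exprn_gt0.
have [aE hE] := cube_inj n0 h00 hk (etrans (esym Q0E) Q0E').
exists (pickle ((k, k', [tuple z i | i < n], [tuple z' i | i < n]) : C)) => //.
rewrite pickleK /F QE.
have hE' : (h0 * 2 ^+ k = h)%R by rewrite hE divfK// expf_neq0.
rewrite hE'; congr cube; apply/funext => i; rewrite !tnth_mktuple.
by rewrite aE hE addrK.
Qed.

Lemma common_ancestor (s : seq (set V)) : (forall P, P \in s -> D P) ->
  exists a h, [/\ (0 < h)%R & forall P, P \in s -> dyadic_descendant (cube a h) P].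
Proof.
have [Dc _ anc cov] := lD; move=> sD.
suff [Q [DQ Qs]] : exists Q, D Q /\ forall P, P \in s -> dyadic_descendant Q P.
  by have [a [h h0 QE]] := Dc _ DQ; exists a, h; split=> //; rewrite -QE.
elim: s sD => [|P s IH] sD.
  have [Q0 DQ0 _] : exists2 Q, D Q & set0 `<=` Q.
    by apply: cov; rewrite /compact_in image_set0; exact: compact0.
  by exists Q0.
have [|Q [DQ Qs]] := IH; first by move=> P' P's; apply: sD; rewrite inE P's orbT.
have [|Q' [DQ' Q'Q Q'P]] := anc Q P DQ; first by apply: sD; rewrite mem_head.
exists Q'; split=> // P'; rewrite inE => /predU1P[->//|/Qs].
exact: dyadic_descendant_trans.
Qed.

Lemma levels_bound (a : 'I_n -> R) (h : R) (s : seq (set V)) : (0 < h)%R ->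
  (forall P, P \in s -> dyadic_descendant (cube a h) P) ->
  exists J, forall P, P \in s -> exists2 j, (j < J)%N &
    forall x, P x -> cube a h x /\ P = subcube a h j x.
Proof.
move=> h0; elim: s => [|P s IH] sP; first by exists 0%N.
have [|J Js] := IH; first by move=> P' P's; apply: sP; rewrite inE P's orbT.
have [j [z [zj PE]]] := descendantE h0 (sP P (mem_head _ _)).
exists (maxn J j.+1) => P'; rewrite inE => /predU1P[->|/Js[j' j'J P'E]].
  exists j; first by rewrite leq_max ltnSn orbT.
  by rewrite PE => x Px; exact: dyadicE.
by exists j' => //; rewrite leq_max j'J.
Qed.

End dyadic_lattices.

Section family_levels.
Context (R : realType) (n : nat).
Hypothesis n0 : (0 < n)%N.
Local Notation V := (n.-tuple R).
Local Notation mu := (lebesgue R n).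
Variables (a : 'I_n -> R) (h : R).
Hypothesis h0 : (0 < h)%R.
Variables (E : seq (set V)) (J : nat).
Hypothesis uE : uniq E.
Hypothesis EJ : forall P, P \in E -> exists2 j, (j < J)%N &
    forall x, P x -> cube a h x /\ P = subcube a h j x.

Definition family_level i := [set x | cube a h x /\ subcube a h i x \in E].

Lemma level_family i : level_set a h i (family_level i).
Proof.
split=> [x []//|x [Qx xE] y xy]; split; first exact: subcube_sub xy.
by rewrite (eq_subcube h0 Qx xy).
Qed.

(** A cube of the family containing [x] is [subcube a h i x] for exactly one [i], because distinct
    generations have distinct cubes. *)
Lemma sum_family (c : set V -> R) x : cube a h x ->
  (\sum_(P <- E) \1_P x * c P =
   \sum_(i < J) (x \in family_level i)%:R * c (subcube a h i x))%R.
Proof.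
move=> Qx; transitivity (\sum_(P <- E) \sum_(i < J) (subcube a h i x == P)%:R * c P)%R.
  rewrite big_seq [RHS]big_seq; apply: eq_bigr => P PE.
  rewrite -mulr_suml; congr (_ * _)%R; rewrite indicE.
  have [Px|NPx] := boolP (x \in P); last first.
    rewrite big1// => i _; case: eqP => // iP; exfalso; move/negP: NPx; apply.
    by rewrite -iP; apply/mem_set; exact: subcube_refl.
  have [j jJ /(_ x (set_mem Px))[_ Pj]] := EJ PE.
  rewrite (bigD1 (Ordinal jJ))//= -Pj eqxx big1 ?addr0// => i ij.
  case: eqP => // iP; exfalso; move/negP: ij; apply; apply/eqP/val_inj => /=.
  exact: (subcube_inj h0 n0 (etrans iP Pj)).
rewrite exchange_big /=; apply: eq_bigr => i _.
have [iE|iE] := boolP (x \in family_level i).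
  have [_ {}iE] := set_mem iE.
  rewrite (bigD1_seq (subcube a h i x))//= eqxx !mul1r big1 ?addr0// => P Pi.
  by rewrite eq_sym (negbTE Pi) mul0r.
rewrite mul0r big_seq big1// => P PE; case: eqP => [iP|]; last by rewrite mul0r.
have {}PE : subcube a h i x \in E by rewrite iP.
by exfalso; move/negP: iE; apply; apply/mem_set.
Qed.

Lemma sparse_family (eta : R) (S : set (set V)) (e : nat -> set V) :
  S `<=` range e ->
  (forall P, S P -> is_cube P) -> (forall P, P \in E -> S P) ->
  (forall Q, S Q ->
    mu (\bigcup_(P in [set P | S P /\ P `<` Q]) P) <= (1 - eta)%:E * mu Q) ->
  sparse_levels a h eta J family_level.
Proof.
move=> Se Sc ES spS i x iJ [Qx xE].
apply: le_trans (spS _ (ES _ xE)); apply: le_measure; rewrite ?inE.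
- apply: measurableI; last exact: measurable_subcube.
  apply: bigcup_measurable => j _; exact: measurable_level_set (level_family j).
(* The enumeration makes the union over all smaller cubes of [S] countable, hence measurable. *)
- pose F k := if `[< S (e k) /\ e k `<` subcube a h i x >] then e k else set0.
  have -> : \bigcup_(P in [set P | S P /\ P `<` subcube a h i x]) P = \bigcup_k F k.
    apply/seteqP; split=> [y [P SP Py]|y [k _]].
      have [k _ ekP] := Se _ SP.1; exists k => //.
      by rewrite /F; case: asboolP => [_|[]]; rewrite ekP.
    by rewrite /F; case: asboolP => // ek eky; exists (e k).
  apply: bigcupT_measurable => k; rewrite /F; case: asboolP => // -[Sek _].
  by apply: measurable_is_cube; exact: Sc.
move=> y [[j /= /andP[ij jJ] [Qy yE]] xy].
exists (subcube a h j y); last exact: subcube_refl.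
split; first exact: ES.
rewrite -(eq_subcube h0 Qx xy); rewrite properEneq; split; last first.
  by apply: subcube_le => //; exact: ltnW.
apply/eqP => /(subcube_inj h0 n0) ji; by rewrite ji ltnn in ij.
Qed.

End family_levels.

(** * Constants for a finite family *)

Section family_constants.
Context (R : realType).
Local Open Scope ring_scope.

(** Both sides are compared with the largest factor. This stands in for Holder's inequality when
    moments of a product of counts are taken. *)
Lemma prod_le_sum_power (l : nat) (y : 'I_l -> R) : (0 < l)%N ->
  (forall s, 0 <= y s) -> \prod_s y s <= \sum_s y s ^+ l.
Proof.
move=> l0 y0; pose s0 := [arg max_(s > Ordinal l0) y s]%O.
have ys s : y s <= y s0 by rewrite /s0; case: arg_maxP => // i _; apply.
apply: (@le_trans _ _ (y s0 ^+ l)).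
  rewrite -[X in _ <= _ ^+ X]card_ord -prodr_const.
  by apply: ler_prod => s _; rewrite y0 ys.
by rewrite (bigD1 s0)//= lerDl sumr_ge0// => s _; rewrite exprn_ge0.
Qed.

Lemma exists_small_level (L : R) (s : seq R) : 0 < L ->
  (forall x, x \in s -> 0 < x) -> exists T, forall x, x \in s -> L / 2 ^+ T < x.
Proof.
move=> L0; elim: s => [|x s IH] s0; first by exists 0%N.
have [|T Ts] := IH; first by move=> y ys; apply: s0; rewrite inE ys orbT.
have x0 : 0 < x by apply: s0; rewrite mem_head.
pose t := (Num.truncn (L / x)).+1.
have tx : L / 2 ^+ t < x.
  rewrite ltr_pdivrMr ?exprn_gt0// mulrC -ltr_pdivrMr//.
  by apply: lt_trans (truncnS_gt _) _; rewrite -natrX ltr_nat ltn_expl.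
have mono T' T'' : (T' <= T'')%N -> L / 2 ^+ T'' <= L / 2 ^+ T'.
  move=> TT; rewrite ler_pM2l// lef_pV2 ?posrE ?exprn_gt0// ler_weXn2l//.
  by rewrite ler1n.
exists (maxn t T) => y; rewrite inE => /predU1P[->|/Ts].
  by apply: le_lt_trans tx; apply: mono; exact: leq_maxl.
by apply: le_lt_trans; apply: mono; exact: leq_maxr.
Qed.

Section constants.
Variables (l : nat) (eta p : R).

(** With [k = truncn p], the power [k.+1] of a product of [l] counts leads to moments of order
    [l * k.+1]; the predecessor fits the moment bounds, which are stated for a successor. *)
Definition moment_order : nat := (l * (Num.truncn p).+1).-1.

Definition moment_const : R :=
  l%:R * ((8 * moment_order.+1%:R) ^+ moment_order * 4).

(** The summand 1 makes the constant at most its own power [k.+1], which avoids taking a root. *)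
Definition height_const : R :=
  1 + (4 * (Num.truncn p).+1%:R / eta) ^+ Num.truncn p * (2 / eta) * moment_const.

Definition family_const : R :=
  power_const p (Num.truncn p) * height_const `^ p.

Lemma moment_const_ge0 : 0 <= moment_const.
Proof. by rewrite mulr_ge0// mulr_ge0// exprn_ge0// mulr_ge0. Qed.

Hypothesis eta0 : 0 < eta.

Lemma height_const_ge1 : 1 <= height_const.
Proof.
rewrite lerDl mulr_ge0 ?moment_const_ge0// mulr_ge0//.
  by rewrite exprn_ge0// divr_ge0 ?mulr_ge0// ltW.
by rewrite divr_ge0// ltW.
Qed.

Lemma family_const_gt0 : 0 < p -> 0 < family_const.
Proof.
move=> p0; have pk := truncnS_gt p.
have pk1 : 0 < 1 - p / (Num.truncn p).+1%:R.
  by rewrite subr_gt0 ltr_pdivrMr// mul1r.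
rewrite mulr_gt0 ?powR_gt0 ?(lt_le_trans ltr01 height_const_ge1)//.
rewrite mulr_gt0 ?powR_gt0 ?geo_gt0//.
by rewrite mulr_gt0 ?powR_gt0// ltr_wpDr// ltW// geo_gt0.
Qed.

End constants.

End family_constants.

(** * The weighted bound for a finite subfamily *)

Section sparse_family_power.
Context (R : realType) (n : nat).
Hypothesis n0 : (0 < n)%N.
Local Notation V := (n.-tuple R).
Local Notation mu := (lebesgue R n).

Theorem sparse_family_power_le (l : nat) (eta p kappa : R)
    (D S : set (set V)) (E : seq (set V)) (nu : {measure set V -> \bar R})
    (lam : set V -> R) (N : 'I_l -> set V -> V -> nat) (M : V -> \bar R) :
  (0 < l)%N -> (0 < eta <= 1)%R -> (0 < p)%R -> (1 <= kappa)%R ->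
  dyadic_lattice D -> S `<=` D ->
  (forall Q, S Q ->
    mu (\bigcup_(P in [set P | S P /\ P `<` Q]) P) <= (1 - eta)%:E * mu Q) ->
  uniq E -> (forall P, P \in E -> S P) ->
  (forall P, is_cube P -> nu P < +oo) -> maximal_bound nu kappa ->
  (forall P, P \in E -> 0 < lam P)%R ->
  (forall s P, P \in E -> measurable_fun P (fun x => (N s P x)%:R : R)) ->
  (forall s P k, P \in E -> \int[nu]_(x in P) ((N s P x)%:R ^+ k.+1)%:E <=
          ((8 * k.+1%:R * kappa) ^+ k * (4 * kappa))%:E * nu P) ->
  (forall x, 0 <= M x) -> (forall P x, P \in E -> P x -> (lam P)%:E <= M x) ->
  \int[nu]_x ((\sum_(P <- E) \1_P x * (lam P * \prod_s (N s P x)%:R)) `^ p)%:E <=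
  (family_const l eta p * kappa `^ (p * l.+1%:R))%:E * \int[nu]_x (M x `^ p).
Proof.
move=> l0 /andP[eta0 eta1] p0 k1 lD SD spS uE ES nufin nuM lam0 mN EN M0 lamM.
have Dc : D `<=` @is_cube R n by case: lD.
have [e De] := dyadic_lattice_enum n0 lD.
have [|a [h [h0 Eanc]]] := @common_ancestor _ _ n0 _ lD E.
  by move=> P /ES/SD.
have [J EJ] := levels_bound n0 h0 Eanc.
set Q := cube a h.
pose sub := subcube a h.
have cQ : is_cube Q by exists a, h.
have mQ : measurable Q by exact: measurable_is_cube.
have k0 : (0 < kappa)%R by exact: lt_le_trans k1.
pose U := family_level a h E.
have lU : forall i, level_set a h i (U i) := level_family a h0 E.
have spU : sparse_levels a h eta J U.
  apply: (sparse_family n0 h0 (S := S) (e := e)) => //.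
  - by move=> P /SD/De.
  - by move=> P /SD/Dc.
have cU : carleson a h nu J U (kappa / eta)%R.
  by apply: carleson_sparse => //; exact: nufin.
have K1 : (1 <= kappa / eta)%R by rewrite ler_pdivlMr// mul1r (le_trans eta1).
set k := Num.truncn p.
have pk : (p < k.+1%:R)%R by exact: truncnS_gt.
pose B i x : R := ((x \in U i)%:R * \prod_s (N s (sub i x) x)%:R)%R.
have prod0 P x : (0 <= \prod_s (N s P x)%:R :> R)%R by rewrite prodr_ge0.
have B0 i x : (0 <= B i x)%R by rewrite mulr_ge0.
have mB i : measurable_fun Q (B i).
  apply: (measurable_fun_level h0 (level_setT a h0 i)) => x Qx.
  have mS : measurable (sub i x) by exact: measurable_subcube.
  have [xU|xU] := boolP (x \in U i); last first.
    apply: (@eq_measurable_fun _ _ _ _ _ (cst 0%R : V -> R)) => // y /set_mem xy.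
    by rewrite /B (mem_level h0 lU (leqnn i) Qx xy) (negbTE xU) mul0r.
  apply: (@eq_measurable_fun _ _ _ _ _ (fun y : V => \prod_s (N s (sub i x) y)%:R : R)%R).
    move=> y /set_mem xy; rewrite /B (mem_level h0 lU (leqnn i) Qx xy) xU mul1r.
    by rewrite /sub (eq_subcube h0 Qx xy).
  apply: measurable_prod => s _; apply: mN; by case: (set_mem xU).
pose Dk := (moment_const l p * kappa ^+ (l * k.+1))%R.
have Dk0 : (0 <= Dk)%R by rewrite mulr_ge0 ?moment_const_ge0// exprn_ge0// ltW.
have lk : (moment_order l p).+1 = (l * k.+1)%N by rewrite prednK// muln_gt0 l0.
have BD i x : (i < J)%N -> U i x ->
    \int[nu]_(y in sub i x) (B i y ^+ k.+1)%:E <= Dk%:E * nu (sub i x).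
  move=> iJ [Qx xE]; have mS : measurable (sub i x) by exact: measurable_subcube.
  have mNk s : measurable_fun (sub i x) (fun y => ((N s (sub i x) y)%:R ^+ (l * k.+1))%:E : \bar R).
    by apply/measurable_EFinP; apply: measurable_funX; exact: mN.
  apply: (@le_trans _ _ (\int[nu]_(y in sub i x)
      \sum_s ((N s (sub i x) y)%:R ^+ (l * k.+1))%:E)).
    apply: le_lower_integral => y xy; first by rewrite lee_fin exprn_ge0.
    rewrite sumEFin lee_fin /B -[sub i y]/(subcube a h i y) (eq_subcube h0 Qx xy).
    rewrite -/(sub i x) mem_set ?mul1r; last first.
      have [_ UU] := lU i; apply: (UU x) => //.
    rewrite -prodrXl; under [leRHS]eq_bigr do rewrite mulnC exprM.
    by apply: prod_le_sum_power => // s; rewrite exprn_ge0.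
  rewrite ge0_integral_sum//.
  apply: (@le_trans _ _ (\sum_(s < l) ((8 * (l * k.+1)%:R * kappa) ^+ moment_order l p
       * (4 * kappa))%:E * nu (sub i x))).
    by apply: lee_sum => s _; rewrite -lk; exact: EN.
  rewrite -ge0_sume_distrl; last first.
    by move=> s _; rewrite lee_fin !mulr_ge0 ?exprn_ge0 ?mulr_ge0// ltW.
  rewrite lee_wpmul2r// sumEFin lee_fin sumr_const card_ord -[leLHS]mulr_natl.
  rewrite /Dk /moment_const -lk; move: (moment_order l p) => m.
  rewrite (exprMn m _ kappa) (exprS kappa) le_eqVlt; apply/orP; left; apply/eqP.
  move: ((8 * m.+1%:R) ^+ m)%R (kappa ^+ m)%R => X Y; ring.
(* Packing contributes [kappa ^+ k.+1] and [Dk] contributes [kappa ^+ (l * k.+1)], together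
   [(kappa ^+ l.+1) ^+ k.+1]. *)
pose H := (height_const l eta p * kappa ^+ l.+1)%R.
have hc1 := height_const_ge1 l p eta0.
have H0 : (0 < H)%R by rewrite mulr_gt0 ?exprn_gt0// (lt_le_trans ltr01).
have HD : ((4 * k.+1%:R * (kappa / eta)) ^+ k * (2 * (kappa / eta) * Dk) <= H ^+ k.+1)%R.
  have -> : ((4 * k.+1%:R * (kappa / eta)) ^+ k * (2 * (kappa / eta) * Dk) =
      (4 * k.+1%:R / eta) ^+ k * (2 / eta) * moment_const l p * (kappa ^+ l.+1) ^+ k.+1)%R.
    have -> : (4 * k.+1%:R * (kappa / eta) = (4 * k.+1%:R / eta) * kappa)%R by ring.
    rewrite (exprMn k _ kappa) /Dk -exprM mulSn exprD (exprS kappa).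
    move: ((4 * k.+1%:R / eta) ^+ k)%R (kappa ^+ k)%R (kappa ^+ (l * k.+1))%R => X Y Z.
    by ring.
  rewrite /H (exprMn _ (height_const l eta p)) ler_wpM2r ?exprn_ge0// ?(ltW k0)//.
  apply: (@le_trans _ _ (height_const l eta p)); first by rewrite /height_const lerDr.
  by rewrite ler_eXnr.
have EQ P : P \in E -> P `<=` Q.
  by move=> /EJ[j _ Pj] x /Pj[].
(* A measurable substitute for [M] from below: the largest [lam] over the cubes of the finite family
   that contain the point. *)
pose M1 x := \big[Num.max/0%R]_(i < J) ((x \in U i)%:R * lam (sub i x))%R.
have lamU i x : U i x -> (0 < lam (sub i x))%R by move=> [_ /lam0].
have mM1 : measurable_fun Q M1.
  apply: (measurable_fun_const_level h0 (j := J)) => x Qx y xy.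
  apply: eq_bigr => i _; have iJ := ltnW (ltn_ord i).
  by rewrite (mem_level h0 lU iJ Qx xy) /sub (eq_subcube h0 Qx (subcube_le h0 Qx iJ xy)).
have M10 x : (0 <= M1 x)%R by exact: bigmax_ge_id.
have lamM1 i x : (i < J)%N -> U i x -> (lam (sub i x) <= M1 x)%R.
  by move=> iJ Ux; apply: (bigmax_sup (Ordinal iJ)); rewrite //= mem_set// mul1r.
have M1M x : (M1 x)%:E <= M x.
  have := M0 x; have lamMx i : U i x -> (lam (sub i x))%:E <= M x.
    by move=> [Qx xE]; apply: lamM => //; exact: subcube_refl.
  case: (M x) lamMx => [r|_ _|//]; last exact: leey.
  move=> lamMx r0; rewrite lee_fin; apply: bigmax_le => // i _.
  have [xU|_] := boolP (x \in U i); last by rewrite mul0r.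
  by rewrite mul1r -lee_fin; apply: lamMx; exact: set_mem.
(* Bounds every [lam P]; as the family is finite with positive [lam], some [L / 2 ^+ T] lies below
   all of them. *)
pose L := (1 + \sum_(P <- E) lam P)%R.
have sum0 : (0 <= \sum_(P <- E) lam P)%R.
  by rewrite big_seq sumr_ge0// => P /lam0/ltW.
have L0 : (0 < L)%R by rewrite ltr_pwDl.
have [|T LT] := @exists_small_level _ L [seq lam P | P <- E] L0.
  by move=> y /mapP[P PE ->]; exact: lam0.
have lamL i x : (i < J)%N -> U i x -> (L / 2 ^+ T < lam (sub i x) <= L)%R.
  move=> iJ [Qx xE]; rewrite LT ?map_f//= /L (bigD1_seq (sub i x))//=.
  rewrite addrCA lerDl addr_ge0// big_seq_cond sumr_ge0// => P /andP[PE _].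
  by rewrite ltW// lam0.
have lamE i x : Q x -> forall y, sub i x y -> lam (sub i y) = lam (sub i x).
  by move=> Qx y xy; rewrite /sub (eq_subcube h0 Qx xy).
have main := carleson_embedding_power h0 (nufin _ cQ) lU K1 cU p0 pk lamE L0 lamL
  mM1 M10 lamM1 mB B0 Dk0 BD H0 HD.
pose G x := ((\sum_(P <- E) \1_P x * (lam P * \prod_s (N s P x)%:R)) `^ p)%R.
have -> : \int[nu]_x (G x)%:E = \int[nu]_(x in Q)
    ((\sum_(i < J) (x \in U i)%:R * (lam (sub i x) * B i x)) `^ p)%:E.
  transitivity (\int[nu]_(x in Q) (G x)%:E).
    rewrite [RHS]integral_mkcond; apply: eq_integral => x _; rewrite patchE.
    case: ifPn => // /negP xQ; rewrite /G big_seq big1 ?powR0 ?gt_eqF// => P PE.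
    rewrite indicE memNset ?mul0r// => Px; apply: xQ; apply/mem_set.
    exact: (EQ _ PE).
  apply: eq_integral => x /set_mem Qx; rewrite /G; congr (_ `^ p)%:E.
  rewrite (sum_family n0 h0 uE EJ (fun P => lam P * \prod_s (N s P x)%:R)%R Qx).
  apply: eq_bigr => i _; rewrite -/U /B; case: (x \in U i); last by rewrite !mul0r.
  by rewrite !mul1r.
apply: le_trans main _.
have -> : (power_const p k * H `^ p = family_const l eta p * kappa `^ (p * l.+1%:R))%R.
  rewrite /family_const -mulrA; congr (_ * _)%R.
  rewrite /H powRM ?(le_trans ler01 hc1) ?exprn_ge0 ?(ltW k0)//; congr (_ * _)%R.
  by rewrite -powR_mulrn ?(ltW k0)// -powRrM mulrC.
rewrite lee_wpmul2l//.
  by rewrite lee_fin mulr_ge0 ?powR_ge0// ltW// family_const_gt0.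
rewrite [leLHS]integral_mkcond; apply: le_lower_integral => x _.
  by rewrite patchE; case: ifP => // _; rewrite lee_fin powR_ge0.
rewrite patchE; case: ifP => _; last exact: poweR_ge0.
rewrite -poweR_EFin; apply: gt0_ler_poweR => //; rewrite ?ltW// ?in_itv /= ?leey ?andbT//.
by rewrite lee_fin.
Qed.

End sparse_family_power.

(** * Pointwise domination and the weighted estimate *)

Section finite_sums.
Context (R : realType).

Lemma sum_ereal_sup_le (K : nat) (u : 'I_K -> nat -> R) :
  (forall j, {homo u j : a b / (a <= b)%N >-> (a <= b)%R}) ->
  (forall j m, 0 <= u j m)%R ->
  \sum_(j < K) ereal_sup (range (fun m => (u j m)%:E)) <=
  ereal_sup (range (fun m => (\sum_(j < K) u j m)%:E)).
Proof.
move=> ndu u0.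
have cvgu j : (u j m)%:E @[m --> \oo] --> ereal_sup (range (fun m => (u j m)%:E)).
  by apply: ereal_nondecreasing_cvgn => a b ab; rewrite lee_fin ndu.
have c1 : (\sum_(j < K) (u j m)%:E) @[m --> \oo] -->
    \sum_(j < K) ereal_sup (range (fun m => (u j m)%:E)).
  by apply: cvg_nnesum => // j _; apply: nearW => m; rewrite lee_fin.
have c2 : (\sum_(j < K) u j m)%:E @[m --> \oo] -->
    ereal_sup (range (fun m => (\sum_(j < K) u j m)%:E)).
  apply: ereal_nondecreasing_cvgn => a b ab; rewrite lee_fin; apply: ler_sum => j _.
  exact: ndu.
have E : (fun m => \sum_(j < K) (u j m)%:E) = (fun m => (\sum_(j < K) u j m)%:E).
  by apply/funext => m; rewrite sumEFin.
by rewrite E in c1; rewrite -(cvg_lim _ c1)// -(cvg_lim _ c2).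
Qed.

(** The supremum may be infinite or not attained; giving up a factor 2 makes a single term
    suffice. *)
Lemma le_half_sup (r c : R) (u : nat -> R) : (0 <= r)%R -> (0 <= c)%R ->
  (forall m, 0 <= u m)%R ->
  r%:E <= c%:E * ereal_sup (range (fun m => (u m)%:E)) ->
  exists m, (r <= 2 * (c * u m))%R.
Proof.
move=> r0 c0 u0 rc; apply: contrapT => /forallNP H.
have {}H m : (2 * (c * u m) < r)%R by rewrite ltNge; apply/negP/H.
have r_gt0 : (0 < r)%R by apply: le_lt_trans (H 0%N); rewrite !mulr_ge0.
suff : c%:E * ereal_sup (range (fun m => (u m)%:E)) <= (r / 2)%:E.
  move=> /(le_trans rc); rewrite lee_fin leNgt ltr_pdivrMr// ltr_pMr// ltr1n.
  by [].
have [c_gt0|] := ltP 0%R c; last first.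
  move=> cle; have -> : c = 0%R by apply/eqP; rewrite eq_le cle.
  by rewrite mul0e lee_fin divr_ge0.
rewrite -lee_pdivlMl//; apply: ge_ereal_sup => _ [m _ <-].
rewrite -EFinM lee_fin ler_pdivlMl// ler_pdivlMr// mulrC; exact: ltW.
Qed.

(** Comparison with the largest term, which works for [p] below and above 1 alike. *)
Lemma powR_sum_le (K : nat) (p : R) (y : 'I_K -> R) : (0 < K)%N -> (0 <= p)%R ->
  (forall j, 0 <= y j)%R ->
  ((\sum_j y j) `^ p <= K%:R `^ p * \sum_j y j `^ p)%R.
Proof.
move=> K0 p0 y0; pose j0 := [arg max_(j > Ordinal K0) y j]%O.
have yj j : (y j <= y j0)%R by rewrite /j0; case: arg_maxP => // i _; apply.
apply: (@le_trans _ _ ((K%:R * y j0) `^ p)%R).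
  apply: le_powR => //; first by rewrite sumr_ge0.
  rewrite mulr_natl -[X in (_ <= _ *+ X)%R]card_ord -sumr_const.
  exact: ler_sum.
rewrite powRM// ler_wpM2l ?powR_ge0// (bigD1 j0)//= lerDl sumr_ge0// => j _.
exact: powR_ge0.
Qed.

Lemma sum_subseq_le (T : eqType) (s t : seq T) (F : T -> R) : uniq s -> uniq t ->
  {subset s <= t} -> (forall x, 0 <= F x)%R ->
  (\sum_(x <- s) F x <= \sum_(x <- t) F x)%R.
Proof.
move=> us ut st F0; rewrite [leRHS](bigID (fun x => x \in s)) /= -[X in (_ <= X + _)%R]big_filter.
have ps : perm_eq [seq x <- t | x \in s] s.
  apply: uniq_perm => //; first exact: filter_uniq.
  by move=> x; rewrite mem_filter andb_idr//; exact: st.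
by rewrite (perm_big _ ps) lerDl sumr_ge0.
Qed.

End finite_sums.

(** * Exhaustion of a sparse family by finite sums *)

Section enumerated_family.
Context (R : realType) (n l : nat).
Local Notation V := (n.-tuple R).
Variables (S : set (set V)) (e : nat -> set V).
Hypothesis Se : S `<=` range e.
Variables (lam : set V -> R) (N : 'I_l -> set V -> nat -> V -> nat).
Hypothesis lam0 : forall P, (0 <= lam P)%R.
Hypothesis ndN : forall s P, S P -> forall x, {homo (N s P)^~ x : i j / (i <= j)%N}.

(* [e] may enumerate a cube several times; only its first index is kept. *)
Definition fresh i : bool := `[< [/\ S (e i), (0 < lam (e i))%R &
  forall i', (i' < i)%N -> e i' <> e i] >].

Definition selection m : seq (set V) := [seq e i | i <- iota 0 m & fresh i].

(** The same [m] truncates the stopping counts here and the enumeration in [selection], so that one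
    monotone sequence exhausts both. *)
Definition summand m (P : set V) (x : V) : R :=
  (\1_P x * (lam P * \prod_s (N s P m x)%:R))%R.

Definition partial_sum m x : R := (\sum_(P <- selection m) summand m P x)%R.

Lemma mem_selection m P : P \in selection m -> S P /\ (0 < lam P)%R.
Proof.
by move=> /mapP[i]; rewrite mem_filter => /andP[/asboolP[Sei lei _] _] ->.
Qed.

Lemma selection_uniq m : uniq (selection m).
Proof.
rewrite map_inj_in_uniq; first by rewrite filter_uniq// iota_uniq.
move=> i j; rewrite !mem_filter => /andP[/asboolP[_ _ fi] _] /andP[/asboolP[_ _ fj] _] ij.
have [lij|lji|//] := ltngtP i j; first by case: (fj i lij).
by case: (fi j lji).
Qed.

Lemma selection_le m m' : (m <= m')%N -> {subset selection m <= selection m'}.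
Proof.
move=> mm P /mapP[i]; rewrite mem_filter mem_iota /= => /andP[fi im] ->.
by apply: map_f; rewrite mem_filter fi mem_iota /= (leq_trans im).
Qed.

Lemma selection_exists P : S P -> (0 < lam P)%R -> exists m, P \in selection m.
Proof.
move=> SP lP; have [i0 _ i0P] := Se SP.
have ex : exists i, `[< e i = P >] by exists i0; apply/asboolP.
have := ex_minnP ex; case=> i /asboolP eiP imin; exists i.+1.
rewrite -eiP; apply: map_f; rewrite mem_filter mem_iota /= ltnSn andbT.
apply/asboolP; rewrite eiP; split=> // i' i'i ei'.
by have := imin i' (introT (asboolP _) ei'); rewrite leqNgt i'i.
Qed.

Lemma summand_ge0 m P x : (0 <= summand m P x)%R.
Proof. by rewrite mulr_ge0// mulr_ge0// prodr_ge0. Qed.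

Lemma partial_sum_ge0 m x : (0 <= partial_sum m x)%R.
Proof. by apply: sumr_ge0 => P _; exact: summand_ge0. Qed.

Lemma summand_le m m' P x : S P -> (m <= m')%N -> (summand m P x <= summand m' P x)%R.
Proof.
move=> SP mm; rewrite ler_wpM2l// ler_wpM2l//; apply: ler_prod => s _.
by rewrite ler0n ler_nat ndN.
Qed.

Lemma partial_sum_nd x : {homo partial_sum^~ x : a b / (a <= b)%N >-> (a <= b)%R}.
Proof.
move=> m m' mm; apply: (@le_trans _ _ (\sum_(P <- selection m) summand m' P x)%R).
  rewrite /partial_sum big_seq [leRHS]big_seq; apply: ler_sum => P /mem_selection[SP _].
  exact: summand_le.
apply: sum_subseq_le; [exact: selection_uniq|exact: selection_uniq|exact: selection_le|].
by move=> P; exact: summand_ge0.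
Qed.

Lemma measurable_partial_sum m :
  (forall P, S P -> measurable P) ->
  (forall s P L, S P -> measurable_fun P (fun x => (N s P L x)%:R : R)) ->
  measurable_fun setT (partial_sum m).
Proof.
move=> mP mN; rewrite /partial_sum.
under eq_fun do rewrite big_seq.
have mS P : P \in selection m -> measurable_fun setT (summand m P).
  move=> /mem_selection[SP _].
  have -> : summand m P = (fun x => lam P * \prod_s (N s P m x)%:R)%R \_ P.
    apply/funext => x; rewrite /summand patchE indicE.
    by case: (x \in P); rewrite ?mul1r ?mul0r.
  apply/(measurable_restrictT _ _).1; first exact: mP.
  apply: measurable_funM => //; apply: measurable_prod => s _; exact: mN.
under eq_fun do rewrite big_mkcond /=.
apply: measurable_sum => P; case: (boolP (P \in selection m)) => // PE.
exact: mS.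
Qed.

(** A finite subsum involves finitely many cubes, each with its own index; by monotonicity the
    largest index serves them all. Cubes with [lam P = 0] are left out of [selection] and contribute
    at most 0. *)
Lemma esum_le_partial_sum (term : set V -> \bar R) (c : R) (x : V) : (0 <= c)%R ->
  (forall P, S P -> P x ->
    exists L, term P <= (c * (lam P * \prod_s (N s P L x)%:R))%:E) ->
  (forall P, S P -> ~ P x -> term P <= 0) ->
  \esum_(P in S) term P <=
    c%:E * ereal_sup (range (fun m => (partial_sum m x)%:E)).
Proof.
move=> c0 Hin Hout; apply: ge_ereal_sup => _ [A [finA AS] <-].
rewrite fsbig_finite//=; set s := finmap.enum_fset _.
have sS P : P \in s -> S P.
  by rewrite in_fset_set// => /set_mem; exact: AS.
have us : uniq s by exact: finmap.fset_uniq.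
have good P : S P -> exists m, ((0 < lam P)%R -> P \in selection m) /\
    term P <= (c * summand m P x)%:E.
  move=> SP.
  have [m1 Pm1] : exists m, (0 < lam P)%R -> P \in selection m.
    have [lP|lP] := ltP 0%R (lam P); last by exists 0%N.
    by have [m Pm] := selection_exists SP lP; exists m.
  have [Px|NPx] := pselect (P x); last first.
    exists m1; split=> //; apply: le_trans (Hout P SP NPx) _.
    by rewrite lee_fin mulr_ge0// summand_ge0.
  have [L HL] := Hin P SP Px; exists (maxn m1 L); split.
    by move=> /Pm1; apply: selection_le; exact: leq_maxl.
  apply: (le_trans HL); rewrite lee_fin ler_wpM2l//.
  apply: le_trans (summand_le x SP (leq_maxr m1 L)).
  by rewrite /summand indicE mem_set// mul1r.
have [m Hm] : exists m, forall P, P \in s -> ((0 < lam P)%R -> P \in selection m) /\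
    term P <= (c * summand m P x)%:E.
  elim: (s) sS => [|P s' IH] sS; first by exists 0%N.
  have [|m1 H1] := IH; first by move=> P' P's; apply: sS; rewrite inE P's orbT.
  have [m2 [H2 H2']] := good P (sS _ (mem_head _ _)).
  have step m' P' : (m' <= maxn m1 m2)%N -> S P' ->
      ((0 < lam P')%R -> P' \in selection m') /\ term P' <= (c * summand m' P' x)%:E ->
      ((0 < lam P')%R -> P' \in selection (maxn m1 m2)) /\
      term P' <= (c * summand (maxn m1 m2) P' x)%:E.
    move=> mm SP' [Ha Hb]; split; first by move=> /Ha; exact: selection_le.
    by apply: le_trans Hb _; rewrite lee_fin ler_wpM2l// summand_le.
  exists (maxn m1 m2) => P'; rewrite inE => /predU1P[->|P's].
    by apply: (step m2); [exact: leq_maxr|apply: sS; exact: mem_head|].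
  apply: (step m1); [exact: leq_maxl| |exact: H1].
  by apply: sS; rewrite inE P's orbT.
apply: (@le_trans _ _ (c%:E * (partial_sum m x)%:E)); last first.
  by rewrite lee_wpmul2l ?lee_fin//; apply: ereal_sup_ubound; exists m.
apply: (@le_trans _ _ (\sum_(P <- s) (c * summand m P x)%:E)).
  by rewrite big_seq [leRHS]big_seq; apply: lee_sum => P /Hm[].
rewrite sumEFin -EFinM lee_fin -mulr_sumr ler_wpM2l//.
rewrite (bigID (fun P => 0 < lam P)%R) /= [X in (_ + X <= _)%R]big1 ?addr0; last first.
  move=> P; rewrite -leNgt => lP; have lP0 : lam P = 0%R by apply/eqP; rewrite eq_le lP lam0.
  by rewrite /summand lP0 mul0r mulr0.
rewrite -big_filter /partial_sum; apply: sum_subseq_le.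
- exact: filter_uniq.
- exact: selection_uniq.
- by move=> P; rewrite mem_filter => /andP[lP /Hm[+ _]]; apply.
- by move=> P; exact: summand_ge0.
Qed.

End enumerated_family.

(** * Pointwise domination of the commutator *)

Section pointwise_domination.
Context (R : realType).

Lemma lee_prod_nneg (I : Type) (r : seq I) (Pr : pred I) (F G : I -> \bar R) :
  (forall i, Pr i -> 0 <= F i) -> (forall i, Pr i -> F i <= G i) ->
  \prod_(i <- r | Pr i) F i <= \prod_(i <- r | Pr i) G i.
Proof.
move=> F0 FG.
suff : 0 <= \prod_(i <- r | Pr i) F i /\
    \prod_(i <- r | Pr i) F i <= \prod_(i <- r | Pr i) G i by case.
apply: (big_ind2 (fun a b : \bar R => 0 <= a /\ a <= b)).
- by split=> //; rewrite lee_fin.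
- move=> a b c d [a0 ab] [c0 cd]; split; first exact: mule_ge0.
  exact: lee_pmul.
- by move=> i Pi; split; [exact: F0|exact: FG].
Qed.

Lemma prode_fin_num (I : Type) (r : seq I) (Pr : pred I) (F : I -> \bar R) :
  (forall i, Pr i -> F i \is a fin_num) ->
  \prod_(i <- r | Pr i) F i \is a fin_num.
Proof.
move=> Ff; apply: (big_ind (fun a : \bar R => a \is a fin_num)) => //.
by move=> a b; exact: fin_numM.
Qed.

Variables (n m l : nat) (lm : (l <= m)%N).
Hypothesis n0 : (0 < n)%N.
Hypothesis l0 : (0 < l)%N.
Local Notation V := (n.-tuple R).
Local Notation mu := (lebesgue R n).

(** The 2 is lost in replacing a supremum by one term, [2 ^+ l] counts the vectors [gamma], and each
    of the [l] factors costs [osc_const]. *)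
Definition domination_const (C : R) : R :=
  (2 * (C * (2 ^+ l * osc_const R n ^+ l)))%R.

Lemma domination_const_gt0 C : (0 < C)%R -> (0 < domination_const C)%R.
Proof.
by move=> C0; rewrite !mulr_gt0// exprn_gt0// osc_const_gt0.
Qed.

Variables (C eta : R) (b : 'I_l -> V -> R) (f : 'I_m -> V -> R).
Variable U : ('I_m -> V -> R) -> V -> R.
Hypothesis C0 : (0 < C)%R.
Hypothesis eta0 : (0 < eta <= 1)%R.
Hypothesis bBMO : forall s, BMO (b s).
Hypothesis bcf : forall i, bounded_compactly_supported (f i).
Hypothesis sdU : sparse_domination lm C eta b U.

Let beta s : R := fine (BMO_norm (b s)).

Lemma BMO_norm_ge0 (c : V -> R) : 0 <= BMO_norm c.
Proof.
pose P : set V := cube (fun=> 0%R) 1.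
apply: (@le_trans _ _ (avg P (fun x => `|c x - mean c P|%:E))).
  by apply: avg_ge0 => x _; rewrite lee_fin.
by apply: ereal_sup_ubound; exists P => //; exists (fun=> 0%R), 1%R.
Qed.

Lemma BMO_norm_fin (c : V -> R) : BMO c -> BMO_norm c \is a fin_num.
Proof. by move=> [_ c_fin]; rewrite ge0_fin_numE ?BMO_norm_ge0. Qed.

Definition LlogL_prod (P : set V) : R := fine (\prod_(i < m) LlogL_norm (f i) P).

Lemma LlogL_prodE P : is_cube P ->
  (LlogL_prod P)%:E = \prod_(i < m) LlogL_norm (f i) P.
Proof.
move=> cP; rewrite fineK//; apply: prode_fin_num => i _.
by have [_ fb _] := bcf i; exact: LlogL_norm_fin.
Qed.

Lemma LlogL_prod_ge0 P : (0 <= LlogL_prod P)%R.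
Proof. by rewrite fine_ge0// prode_ge0// => i _; exact: LlogL_norm_ge0. Qed.

Lemma LlogL_prod_le_max P x : is_cube P -> P x ->
  (LlogL_prod P)%:E <= LlogL_max f x.
Proof.
by move=> cP Px; rewrite LlogL_prodE//; apply: ereal_sup_ubound; exists P.
Qed.

(** The index [k] of the pointwise bound depends on [x], so [F j] must be monotone for the integrals
    to pass to the limit. The clause on vanishing [LlogL_prod] serves the degenerate case in which
    [[w]] is infinite and the maximal integral is 0. *)
Theorem sparse_pointwise_domination :
  exists F : 'I_(3 ^ n) -> nat -> V -> R,
  [/\ (forall j k, measurable_fun setT (F j k)) /\
      (forall j k x, 0 <= F j k x)%R,
      forall j x, {homo (F j)^~ x : i k / (i <= k)%N >-> (i <= k)%R},
      {ae mu, forall x, exists k, (`|U f x| <=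
        domination_const C * \prod_s fine (BMO_norm (b s)) *
        \sum_(j < 3 ^ n) F j k x)%R},
      (forall P, is_cube P -> LlogL_prod P = 0%R) -> forall j k x, F j k x = 0%R &
      forall (nu : {measure set V -> \bar R}) (kappa p : R) (M : V -> \bar R),
        (0 < p)%R -> (1 <= kappa)%R -> (forall P, is_cube P -> nu P < +oo) ->
        maximal_bound nu kappa -> (forall x, 0 <= M x) ->
        (forall P x, is_cube P -> P x -> (LlogL_prod P)%:E <= M x) ->
        forall j k, \int[nu]_x (F j k x `^ p)%:E <=
          (family_const l eta p * kappa `^ (p * l.+1%:R))%:E * \int[nu]_x (M x `^ p)].
Proof.
have beta0 s : (0 <= beta s)%R by rewrite fine_ge0// BMO_norm_ge0.
have betaE s : BMO_norm (b s) <= (beta s)%:E by rewrite fineK// BMO_norm_fin.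
(* Counts are chosen for all pairs at once, so the requirements are conditional on [is_cube]; other
   sets get the count 0. *)
pose good_count (sP : 'I_l * set V) (N : nat -> V -> nat) := is_cube sP.2 ->
  [/\ forall x, {homo N ^~ x : i j / (i <= j)%N},
      forall L, measurable_fun sP.2 (fun x => (N L x)%:R : R),
      forall g, measurable_fun setT g -> {ae mu, forall x, sP.2 x ->
        forall first, exists L, sparse_factor (b sP.1) g sP.2 first x <=
          (osc_const R n * beta sP.1 * (N L x)%:R)%:E * LlogL_norm g sP.2} &
      forall (nu : {measure set V -> \bar R}) (kappa : R), (1 <= kappa)%R ->
        nu sP.2 < +oo -> maximal_bound nu kappa -> forall k L,
        \int[nu]_(x in sP.2) ((N L x)%:R ^+ k.+1)%:E <=
          ((8 * k.+1%:R * kappa) ^+ k * (4 * kappa))%:E * nu sP.2].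
have [NN HN] : {NN : 'I_l * set V -> nat -> V -> nat &
    forall sP, good_count sP (NN sP)}.
  apply: choice => -[s P]; rewrite /good_count; have [cP|ncP] := pselect (is_cube P); last first.
    by by exists (fun _ _ => 0%N) => /= cP.
  have [lb _] := bBMO s.
  have [N [N1 _ N3 N4 N5]] := sparse_factor_count lb (beta0 s) (betaE s) cP.
  by exists N => _; split.
pose N s P := NN (s, P).
have [S [spS domS]] := sdU bcf.
have Scube j P : S j P -> is_cube P.
  by have [[D lD SD] _] := spS j => /SD; case: lD => Dc _ _ _; exact: Dc.
have [e Se] : {e : 'I_(3 ^ n) -> nat -> set V & forall j, S j `<=` range (e j)}.
  apply: (@choice _ _ (fun j ej => S j `<=` range ej)) => j; have [[D lD SD] _] := spS j.
  by have [e De] := dyadic_lattice_enum n0 lD; exists e => P /SD/De.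
have ndN j s P : S j P -> forall x, {homo (N s P)^~ x : i j / (i <= j)%N}.
  by move=> /Scube cP; have [+ _ _ _] := HN (s, P) cP.
pose F j k := partial_sum (S j) (e j) LlogL_prod N k.
have F0 j k x : (0 <= F j k x)%R by apply: partial_sum_ge0 => P; exact: LlogL_prod_ge0.
exists F; split.
- split=> // j k; apply: measurable_partial_sum.
    by move=> P /Scube; exact: measurable_is_cube.
  by move=> s P L /Scube cP; have [_ mN _ _] := HN (s, P) cP; exact: mN.
- move=> j x; apply: partial_sum_nd; first by move=> P; exact: LlogL_prod_ge0.
  exact: ndN.
(* One null set has to serve all cubes of all families, which the enumerations [e j] make
   possible. *)
- have good : {ae mu, forall x, forall j i s, S j (e j i) -> e j i x ->
      forall first, exists L, sparse_factor (b s) (f (widen_ord lm s)) (e j i) first x <=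
        (osc_const R n * beta s * (N s (e j i) L x)%:R)%:E *
          LlogL_norm (f (widen_ord lm s)) (e j i)}.
    apply: filter_forall => j; apply: ae_foralln => i; apply: filter_forall => s.
    have [Sji|nS] := pselect (S j (e j i)); last by apply: nearW => x /nS.
    have [_ _ + _] := HN (s, e j i) (Scube _ _ Sji).
    have [mf _ _] := bcf (widen_ord lm s).
    by move=> /(_ _ mf); apply: filterS => x + _.
  apply: filterS2 good domS => x good dom.
  have osc0 : (0 <= osc_const R n)%R by rewrite ltW// osc_const_gt0.
  have [c cE c0] : exists2 c, (c = osc_const R n ^+ l * \prod_s beta s)%R & (0 <= c)%R.
    by eexists; [reflexivity|rewrite mulr_ge0 ?exprn_ge0 ?prodr_ge0].
  pose sup j := ereal_sup (range (fun k => (F j k x)%:E)).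
  have sup0 j : 0 <= sup j.
    apply: (@le_trans _ _ (F j 0%N x)%:E); first by rewrite lee_fin.
    by apply: ereal_sup_ubound; exists 0%N.
  have esum_le j (g : {ffun 'I_l -> bool}) : \esum_(Q in S j)
      ((\prod_(s < l) sparse_factor (b s) (f (widen_ord lm s)) Q (g s) x) *
       (\prod_(i < m | (l <= i)%N) avg Q (fun y => `|f i y|%:E)) *
       (\1_Q x)%:E) <= c%:E * sup j.
    apply: (@esum_le_partial_sum _ _ _ (S j) (e j) (Se j)) => //.
    - by move=> P; exact: LlogL_prod_ge0.
    - exact: ndN.
    - move=> Q SQ Qx; have cQ := Scube _ _ SQ; have [i _ eQ] := Se j Q SQ.
      have [L HL] : {L : 'I_l -> nat & forall s,
          sparse_factor (b s) (f (widen_ord lm s)) Q (g s) x <=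
          (osc_const R n * beta s * (N s Q (L s) x)%:R)%:E *
          LlogL_norm (f (widen_ord lm s)) Q}.
        apply: (@choice _ _ (fun s L => sparse_factor (b s) (f (widen_ord lm s)) Q (g s) x
          <= (osc_const R n * beta s * (N s Q L x)%:R)%:E *
          LlogL_norm (f (widen_ord lm s)) Q)) => s.
        by rewrite -eQ; apply: good; rewrite ?eQ.
      pose L1 := (\max_s L s)%N; exists L1.
      rewrite indicE mem_set// mule1.
      have sf0 s : 0 <= sparse_factor (b s) (f (widen_ord lm s)) Q (g s) x.
        rewrite /sparse_factor; case: (g s); last first.
          by apply: avg_ge0 => y _; rewrite lee_fin.
        by rewrite mule_ge0 ?lee_fin//; apply: avg_ge0 => y _; rewrite lee_fin.
      have p1 : \prod_(s < l) sparse_factor (b s) (f (widen_ord lm s)) Q (g s) x <=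
          \prod_(s < l) ((osc_const R n * beta s * (N s Q L1 x)%:R)%:E *
            LlogL_norm (f (widen_ord lm s)) Q).
        apply: lee_prod_nneg => // s _; apply: le_trans (HL s) _.
        rewrite lee_wpmul2r ?LlogL_norm_ge0// lee_fin ler_wpM2l ?(mulr_ge0 osc0 (beta0 s))//.
        by rewrite ler_nat (ndN j s Q SQ)//; exact: leq_bigmax.
      have p2 : \prod_(i < m | (l <= i)%N) avg Q (fun y => `|f i y|%:E) <=
          \prod_(i < m | (l <= i)%N) LlogL_norm (f i) Q.
        apply: lee_prod_nneg => k _.
          by apply: avg_ge0 => y _; rewrite lee_fin.
        by have [mf _ _] := bcf k; exact: avg_le_LlogL_norm.
      apply: (le_trans (lee_pmul _ _ p1 p2)).
      + exact: prode_ge0.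
      + by apply: prode_ge0 => k _; apply: avg_ge0 => y _; rewrite lee_fin.
      rewrite big_split /= -muleA.
      have -> : (\prod_(s < l) LlogL_norm (f (widen_ord lm s)) Q) *
          \prod_(i < m | (l <= i)%N) LlogL_norm (f i) Q = (LlogL_prod Q)%:E.
        rewrite LlogL_prodE// [RHS](bigID (fun i : 'I_m => (i < l)%N)) /=.
        congr (_ * _); first by rewrite (big_ord_narrow lm).
        by apply: eq_bigl => i'; rewrite -leqNgt.
      have -> : \prod_(s < l) (osc_const R n * beta s * (N s Q L1 x)%:R)%:E =
          (c * \prod_(s < l) (N s Q L1 x)%:R)%:E.
        rewrite cE prodEFin big_split; congr (_ * _)%:E.
        by rewrite big_split prodr_const card_ord.
      by rewrite -EFinM lee_fin -mulrA [(\prod_s _ * LlogL_prod Q)%R]mulrC.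
    - by move=> Q SQ NQx; rewrite indicE memNset// mule0.
  have dom2 : `|U f x|%:E <= (C * (2 ^+ l * c))%:E *
      ereal_sup (range (fun k => (\sum_(j < 3 ^ n) F j k x)%:E)).
    apply: (le_trans dom); rewrite EFinM -muleA lee_wpmul2l ?lee_fin ?(ltW C0)//.
    apply: (@le_trans _ _ ((2 ^+ l * c)%:E * \sum_(j < 3 ^ n) sup j)); last first.
      rewrite lee_wpmul2l ?lee_fin ?mulr_ge0 ?exprn_ge0//.
      apply: sum_ereal_sup_le => // j; apply: partial_sum_nd; last exact: ndN.
      by move=> P; exact: LlogL_prod_ge0.
    rewrite ge0_sume_distrr//; apply: lee_sum => j _.
    apply: (@le_trans _ _ (\sum_(g : {ffun 'I_l -> bool}) (c%:E * sup j))).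
      by apply: lee_sum => g _; exact: esum_le.
    under eq_bigr do rewrite -[c%:E * _]mul1e.
    rewrite -ge0_sume_distrl ?sumEFin; last by move=> _ _; rewrite lee_fin.
    by rewrite sumr_const card_ffun card_bool card_ord natrX EFinM muleA.
  have Cc0 : (0 <= C * (2 ^+ l * c))%R.
    by rewrite mulr_ge0 ?(ltW C0)// mulr_ge0// exprn_ge0.
  have sumF0 k : (0 <= \sum_(j < 3 ^ n) F j k x)%R by apply: sumr_ge0.
  have [k Hk] := le_half_sup (normr_ge0 _) Cc0 sumF0 dom2.
  exists k; apply: (le_trans Hk); rewrite /domination_const cE.
  by rewrite le_eqVlt; apply/orP; left; apply/eqP; rewrite -/beta; ring.
- move=> lam0 j k x; rewrite /F /partial_sum big_seq big1// => P /mem_selection[SP].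
  by rewrite lam0 ?ltxx//; exact: Scube SP.
- move=> nu kappa p M p0 k1 nufin nuM M0 lamM j k.
  have [[D lD SD] spSj] := spS j.
  apply: (@sparse_family_power_le _ _ n0 l eta p kappa D (S j)
    (selection (S j) (e j) LlogL_prod k) nu LlogL_prod (fun s P => N s P k) M) => //.
  - exact: selection_uniq.
  - by move=> P /mem_selection[].
  - by move=> P /mem_selection[].
  - by move=> s P /mem_selection[/Scube cP _]; have [_ mN _ _] := HN (s, P) cP; exact: mN.
  - move=> s P k' /mem_selection[/Scube cP _]; have [_ _ _ +] := HN (s, P) cP.
    by move=> /(_ nu kappa k1 (nufin _ cP) nuM k' k).
  - by move=> P x /mem_selection[/Scube cP _]; exact: lamM.
Qed.

End pointwise_domination.

(** * The weighted estimate *)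

Section weighted_estimate.
Context (R : realType) (n m l : nat) (lm : (l <= m)%N).
Hypothesis n0 : (0 < n)%N.
Hypothesis l0 : (0 < l)%N.
Local Notation V := (n.-tuple R).
Local Notation mu := (lebesgue R n).

Variables (C eta p : R) (b : 'I_l -> V -> R) (f : 'I_m -> V -> R).
Variables (U : ('I_m -> V -> R) -> V -> R) (w : V -> R).
Hypothesis C0 : (0 < C)%R.
Hypothesis eta0 : (0 < eta <= 1)%R.
Hypothesis p0 : (0 < p)%R.
Hypothesis bBMO : forall s, BMO (b s).
Hypothesis bcf : forall i, bounded_compactly_supported (f i).
Hypothesis sdU : sparse_domination lm C eta b U.
Hypothesis ww : weight w.

(** The number [3 ^ n] of families enters to the power [p] through the power of their sum, and once
    more when the integrals are added. *)
Definition estimate_const : R :=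
  (domination_const n l C `^ p * (3 ^ n)%:R `^ p * (3 ^ n)%:R * family_const l eta p)%R.

Lemma estimate_const_gt0 : (0 < estimate_const)%R.
Proof.
have [eta_gt0 _] := andP eta0.
have K0 : (0 < (3 ^ n)%:R :> R)%R by rewrite ltr0n expn_gt0.
apply: mulr_gt0; last exact: family_const_gt0.
by rewrite !mulr_gt0 ?powR_gt0// domination_const_gt0.
Qed.

Let osc : R := (\prod_s fine (BMO_norm (b s)))%R.

Lemma osc_ge0 : (0 <= osc)%R.
Proof. by apply: prodr_ge0 => s _; rewrite fine_ge0// BMO_norm_ge0. Qed.

Lemma LlogL_max_ge0 x : 0 <= LlogL_max f x.
Proof.
pose P : set V := cube (tnth x) 1.
have Px : P x by move=> i; rewrite lexx ltrDl ltr01.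
have cP : is_cube P by exists (tnth x), 1%R.
by apply: le_trans (LlogL_prod_le_max bcf cP Px); rewrite lee_fin LlogL_prod_ge0.
Qed.

Lemma weighted_estimate_fin (kappa : R) : Ainfty_const w <= kappa%:E ->
  \int[mu]_x ((`|U f x| `^ p)%R%:E * (w x)%:E) <=
  (estimate_const * osc `^ p * kappa `^ (p * l.+1%:R))%:E *
  \int[mu]_x (LlogL_max f x `^ p * (w x)%:E).
Proof.
move=> wk; have [[mw _] w0 _] := ww.
have k1 : (1 <= kappa)%R by rewrite -lee_fin (le_trans (Ainfty_const_ge1 mw w0 ww)).
pose nu := wmeasure mu mw w0.
have [F [[mF F0] ndF dom _ Fint]] :=
  sparse_pointwise_domination n0 l0 C0 eta0 bBMO bcf sdU.
have {}Fint := Fint nu kappa p _ p0 k1 (weight_fin mw w0 ww)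
  (Ainfty_maximal_bound mw w0 ww wk) LlogL_max_ge0 (LlogL_prod_le_max bcf).
pose K := (3 ^ n)%N.
have K0 : (0 < K)%N by rewrite expn_gt0.
pose c := (domination_const n l C * osc)%R.
have dc0 : (0 <= domination_const n l C)%R by rewrite ltW// domination_const_gt0.
have c0 : (0 <= c)%R by rewrite mulr_ge0// osc_ge0.
pose A k x := (c * \sum_(j < K) F j k x)%R.
have sF0 k x : (0 <= \sum_(j < K) F j k x)%R by apply: sumr_ge0.
have A0 k x : (0 <= A k x)%R by rewrite mulr_ge0.
have mpowR (g : V -> R) : measurable_fun setT g ->
    measurable_fun setT (fun x => (g x `^ p)%R).
  by move=> mg; apply: (measurableT_comp (measurable_powR p) mg).
have mA k : measurable_fun setT (fun x => (A k x `^ p)%R).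
  by apply: mpowR; apply: measurable_funM => //; exact: measurable_sum.
apply: (@ae_le_sup_integral _ _ _ mu setT _ (fun k x => (A k x `^ p)%:E * (w x)%:E)) => //.
- move=> k; under eq_fun do rewrite -EFinM.
  by apply/measurable_EFinP; exact: measurable_funM.
- by move=> k x _; rewrite -EFinM lee_fin mulr_ge0 ?powR_ge0.
- move=> x _ i j ij; rewrite lee_wpmul2r ?lee_fin//; apply: le_powR => //.
    exact: ltW.
  by rewrite ler_wpM2l//; apply: ler_sum => s _; exact: ndF.
- by move=> x _; rewrite -EFinM lee_fin mulr_ge0 ?powR_ge0.
- apply: filterS dom => x [k Hk] _.
  apply: (@le_trans _ _ ((A k x `^ p)%:E * (w x)%:E)).
    by rewrite lee_wpmul2r ?lee_fin//; apply: le_powR => //; exact: ltW.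
  by apply: ereal_sup_ubound; exists k.
move=> k; rewrite -(@integral_wmeasure _ _ _ mu _ mw w0 (fun x => (A k x `^ p)%:E))//.
- rewrite -/nu; set I := (\int[mu]_x _).
  have II : \int[nu]_x (LlogL_max f x `^ p) <= I.
    by apply: lower_integral_wmeasure_le => x; exact: poweR_ge0.
  pose cK := (c `^ p * K%:R `^ p)%R.
  have cK0 : (0 <= cK)%R by rewrite mulr_ge0 ?powR_ge0.
  apply: (@le_trans _ _ (\int[nu]_x \sum_(j < K) (cK%:E * (F j k x `^ p)%:E))).
    apply: le_lower_integral => x _; first by rewrite lee_fin powR_ge0.
    rewrite -ge0_sume_distrr; last by move=> j _; rewrite lee_fin powR_ge0.
    rewrite sumEFin -EFinM lee_fin /A powRM// /cK -mulrA ler_wpM2l ?powR_ge0//.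
    by apply: powR_sum_le => //; exact: ltW.
  rewrite ge0_integral_sum//; last 2 first.
  + move=> j; under eq_fun do rewrite -EFinM.
    by apply/measurable_EFinP; apply: measurable_funM => //; exact: mpowR.
  + by move=> j x _; rewrite -EFinM lee_fin mulr_ge0 ?powR_ge0.
  pose fk := (family_const l eta p * kappa `^ (p * l.+1%:R))%R.
  apply: (@le_trans _ _ (\sum_(j < K) ((cK * fk)%:E * I))).
    apply: lee_sum => j _; rewrite ge0_integralZl_EFin//; last 2 first.
    + by move=> x _; rewrite lee_fin powR_ge0.
    + by apply/measurable_EFinP; exact: mpowR.
    rewrite (EFinM cK fk) -muleA lee_wpmul2l ?lee_fin//; apply: le_trans (Fint j k) _.
    rewrite lee_wpmul2l// lee_fin mulr_ge0 ?powR_ge0// ltW// family_const_gt0//.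
    by case/andP: eta0.
  have I0 : 0 <= I.
    by apply: integral_ge0 => x _; rewrite mule_ge0 ?poweR_ge0 ?lee_fin.
  under eq_bigr do rewrite -[(cK * fk)%:E * I]mul1e.
  rewrite -ge0_sume_distrl ?sumEFin; last by move=> _ _; rewrite lee_fin.
  rewrite sumr_const card_ord muleA -EFinM lee_wpmul2r// lee_fin.
  rewrite le_eqVlt; apply/orP; left; apply/eqP.
  rewrite /cK /fk /c /estimate_const powRM// ?osc_ge0// -/K.
  by rewrite -!mulrA; ring.
- by apply/measurable_EFinP.
- by move=> x; rewrite lee_fin powR_ge0.
Qed.

Lemma weighted_estimate0 :
  osc = 0%R \/ (forall P, is_cube P -> LlogL_prod f P = 0%R) ->
  \int[mu]_x ((`|U f x| `^ p)%R%:E * (w x)%:E) <= 0.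
Proof.
move=> H; have [[mw _] w0 _] := ww.
have [F [_ _ dom FE _]] := sparse_pointwise_domination n0 l0 C0 eta0 bBMO bcf sdU.
have U0 : {ae mu, forall x, U f x = 0%R}.
  apply: filterS dom => x [k]; rewrite -/osc => Hk; apply/eqP; rewrite -normr_le0.
  case: H => [osc0|/FE lam0]; first by rewrite osc0 mulr0 mul0r in Hk.
  by rewrite big1 ?mulr0 in Hk.
rewrite -[leRHS](@integral0 _ _ _ mu setT).
apply: ae_lower_integral_le => //.
  by move=> x _; rewrite -EFinM lee_fin mulr_ge0 ?powR_ge0.
by apply: filterS U0 => x -> _; rewrite normr0 powR0 ?gt_eqF// mul0e.
Qed.

(** A positive product of norms on a cube [P] would bound the maximal function from below on [P],
    which has positive weight. *)
Lemma LlogL_prod_eq0 : \int[mu]_x (LlogL_max f x `^ p * (w x)%:E) = 0 ->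
  forall P, is_cube P -> LlogL_prod f P = 0%R.
Proof.
move=> I0 P cP; apply: contrapT => /eqP lamP; have [[mw _] w0 _] := ww.
have lam0 : (0 < LlogL_prod f P)%R by rewrite lt_def lamP LlogL_prod_ge0.
have mP := measurable_is_cube cP.
have : (LlogL_prod f P `^ p)%:E * wmeasure mu mw w0 P <= 0.
  rewrite -integral_cst// -I0.
  apply: le_trans (@lower_integral_wmeasure_le _ _ _ mu _ mw w0 _ _); last first.
    by move=> x; exact: poweR_ge0.
  rewrite [leLHS]integral_mkcond; apply: le_lower_integral => x _.
    by rewrite patchE; case: ifP => // _; rewrite lee_fin powR_ge0.
  rewrite patchE; case: ifPn => [/set_mem Px|_]; last exact: poweR_ge0.
  rewrite -poweR_EFin; apply: gt0_ler_poweR; rewrite ?in_itv /= ?leey ?andbT.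
  - exact: ltW.
  - by rewrite lee_fin ltW.
  - exact: LlogL_max_ge0.
  - exact: (LlogL_prod_le_max bcf).
by rewrite leNgt mule_gt0// ?lte_fin ?powR_gt0// weight_gt0.
Qed.

Theorem weighted_estimate :
  \int[mu]_x ((`|U f x| `^ p)%R%:E * (w x)%:E) <=
  estimate_const%:E * (\prod_(s < l) BMO_norm (b s)) `^ p *
  Ainfty_const w `^ (p * l%:R)%R * Ainfty_const w `^ (Num.max 2 p)%R *
  \int[mu]_x (LlogL_max f x `^ p * (w x)%:E).
Proof.
have [[mw _] w0 _] := ww.
have -> : \prod_(s < l) BMO_norm (b s) = osc%:E.
  by rewrite /osc -prodEFin; apply: eq_bigr => s _; rewrite fineK// BMO_norm_fin.
have := Ainfty_const_ge1 mw w0 ww; set I := (\int[mu]_x (LlogL_max _ _ `^ _ * _)).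
have I0 : 0 <= I.
  by apply: integral_ge0 => x _; rewrite mule_ge0 ?poweR_ge0 ?lee_fin.
have ec0 := estimate_const_gt0; have o0 := osc_ge0.
(* If [w] = +oo, the right-hand side is +oo unless one of its factors vanishes,
   and then the left-hand side vanishes too. *)
case E : (Ainfty_const w) => [kappa| |] //; last first.
  move=> _; have [/eqP oscE|oscN] := boolP (osc == 0%R).
    apply: (le_trans (weighted_estimate0 (or_introl oscE))).
    by rewrite mule_ge0 ?I0// mule_ge0 ?poweR_ge0// mule_ge0 ?poweR_ge0// mule_ge0 ?poweR_ge0// lee_fin ltW.
  have [/eqP IE|IN] := boolP (I == 0).
    apply: (le_trans (weighted_estimate0 (or_intror (LlogL_prod_eq0 IE)))).
    by rewrite mule_ge0 ?I0// mule_ge0 ?poweR_ge0// mule_ge0 ?poweR_ge0// mule_ge0 ?poweR_ge0// lee_fin ltW.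
  have l_gt0 : (0 < p * l%:R)%R by rewrite mulr_gt0// ltr0n.
  have m_gt0 : (0 < Num.max 2 p)%R by rewrite lt_max ltr0n.
  rewrite poweR_EFin !poweRyr ?gt_eqF//.
  have -> : estimate_const%:E * (osc `^ p)%:E * +oo = +oo.
    by rewrite -EFinM gt0_muley// lte_fin mulr_gt0 ?powR_gt0// lt_def oscN.
  by rewrite -muleA gt0_mulye// ?leey// mule_gt0 // lt0e IN.
rewrite lee_fin => k1; apply: (le_trans (@weighted_estimate_fin kappa _)).
  by rewrite E.
rewrite !poweR_EFin -!EFinM lee_wpmul2r// lee_fin.
rewrite -[X in (_ <= X)%R]mulrA; apply: ler_wpM2l.
  by rewrite mulr_ge0 ?powR_ge0 ?ltW.
have kgt0 : (0 < kappa)%R by exact: lt_le_trans k1.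
rewrite -natr1 mulrDr mulr1 powRD; last by rewrite (gt_eqF kgt0) implybT.
by rewrite ler_wpM2l ?powR_ge0// ler_powR// le_max lexx orbT.
Qed.

End weighted_estimate.

(** Replacing each [b s] by [t * b s] multiplies the left side by [t^(p l)] for [t > 0], so a
    constant chosen before [b] goes with the power [p] of the product of norms. The first power
    comes with a constant chosen after [b], which absorbs the remaining power [p - 1]. *)
Theorem theorem1p8 (R : realType) (n m l : nat) (n_gt0 : (0 < n)%N)
    (l_gt0 : (0 < l)%N) (lm : (l <= m)%N) (C eta p : R) (C_gt0 : (0 < C)%R)
    (eta_gt0 : (0 < eta)%R) (eta_lt1 : (eta < 1)%R) (p_gt0 : (0 < p)%R) :
  exists2 C' : R, (0 < C')%R &
    forall (D : 'I_m -> set (n.-tuple R -> R))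
      (T : ('I_m -> n.-tuple R -> R) -> n.-tuple R -> R)
      (b : 'I_l -> n.-tuple R -> R),
    multilinear_on D T ->
    (forall s, BMO (b s)) ->
    suitable_domain lm D b ->
    sparse_domination lm C eta b (iterated_commutator lm b T) ->
    (forall (w : n.-tuple R -> R) (f : 'I_m -> n.-tuple R -> R),
      Ainfty w -> (forall i, bounded_compactly_supported (f i)) ->
      \int[lebesgue R n]_x
        ((`|iterated_commutator lm b T f x| `^ p)%R%:E * (w x)%:E) <=
      C'%:E * (\prod_(s < l) BMO_norm (b s)) `^ p *
      Ainfty_const w `^ (p * l%:R)%R * Ainfty_const w `^ (Num.max 2 p)%R *
      \int[lebesgue R n]_x (LlogL_max f x `^ p * (w x)%:E)) /\
    (exists2 C'' : R, (0 < C'')%R &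
      forall (w : n.-tuple R -> R) (f : 'I_m -> n.-tuple R -> R),
      Ainfty w -> (forall i, bounded_compactly_supported (f i)) ->
      \int[lebesgue R n]_x
        ((`|iterated_commutator lm b T f x| `^ p)%R%:E * (w x)%:E) <=
      C''%:E * (\prod_(s < l) BMO_norm (b s)) *
      Ainfty_const w `^ (p * l%:R)%R * Ainfty_const w `^ (Num.max 2 p)%R *
      \int[lebesgue R n]_x (LlogL_max f x `^ p * (w x)%:E)).
Proof.
have eta01 : (0 < eta <= 1)%R by rewrite eta_gt0 ltW.
have ec0 := @estimate_const_gt0 R n l C eta p C_gt0 eta01 p_gt0.
exists (estimate_const n l C eta p) => // D T b _ bB _ sd.
have main w f : Ainfty w -> (forall i, bounded_compactly_supported (f i)) -> _ :=
  fun Aw bcf => weighted_estimate n_gt0 l_gt0 C_gt0 eta01 p_gt0 bB bcf sd Aw.1.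
split; first exact: main.
pose osc := (\prod_(s < l) fine (BMO_norm (b s)))%R.
have oscE : \prod_(s < l) BMO_norm (b s) = osc%:E.
  by rewrite /osc -prodEFin; apply: eq_bigr => s _; rewrite fineK// BMO_norm_fin.
rewrite oscE poweR_EFin in main *.
have : (0 <= osc)%R by exact: osc_ge0.
(* The power [p - 1] may be negative, so [osc = 0] is set apart; both right-hand sides then vanish
   and the constant 1 serves. *)
rewrite le_eqVlt => /predU1P[osc0|osc_gt0].
  exists 1%R => // w f Aw bcf; apply: le_trans (main w f Aw bcf) _.
  by rewrite -osc0 powR0 ?gt_eqF// !mule0 !mul0e.
exists (estimate_const n l C eta p * osc `^ (p - 1))%R.
  by rewrite mulr_gt0 ?powR_gt0.
move=> w f Aw bcf; apply: le_trans (main w f Aw bcf) _.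
have <- : (osc `^ (p - 1) * osc = osc `^ p)%R.
  rewrite -[X in (_ * X)%R]powRr1 ?ltW// -powRD ?subrK//.
  by rewrite (gt_eqF osc_gt0) implybT.
by rewrite -!EFinM mulrA.
Qed.
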